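(* Let $(W_1,S_1)$ and $(W_2,S_2)$ be Coxeter systems, each of which is either doubly laced or dihedral, with identity elements $e_1$ and $e_2$. Let $H_1\subseteq S_1$, $H_2\subseteq S_2$, and let $v_1\in W_1^{H_1}$, $v_2\in W_2^{H_2}$ be such that there exists a poset isomorphism from $[e_1,v_1]$ to $[e_2,v_2]$ which restricts to a poset isomorphism from $[e_1,v_1]^{H_1}$ to $[e_2,v_2]^{H_2}$. Then, for $x\in\{-1,q\}$, $$P_{e_1,v_1}^{H_1,x}(q)=P_{e_2,v_2}^{H_2,x}(q)$$ (equivalently, $R_{e_1,v_1}^{H_1,x}(q)=R_{e_2,v_2}^{H_2,x}(q)$).
   Context: A Coxeter system $(W,S)$ with Coxeter matrix entries $m(s,s')$ is doubly laced if $m(s,s')\le 4$ for all $s,s'\in S$; it is dihedral if it has rank $2$, i.e. $|S|=2$. The group $W$ is partially ordered by Bruhat order $\le$, with $\ell$ the length function. $D_L(w)=\{s\in S:\ell(sw)<\ell(w)\}$ and $D_R(w)=\{s\in S:\ell(ws)<\ell(w)\}$. For $u,v\in W$, $[u,v]=\{z\in W:u\le z\le v\}$. For $H\subseteq S$, $W^H=\{w\in W: D_R(w)\subseteq S\setminus H\}$ (minimal coset representatives), ordered by the restriction of Bruhat order, and $[u,v]^H=\{z\in W^H: u\le z\le v\}$ for $u,v\in W^H$. Parabolic $R$-polynomials: for $x\in\{-1,q\}$, $\{R^{H,x}_{u,v}(q)\}_{u,v\in W^H}\subseteq\mathbb Z[q]$ is the unique family of polynomials such that for all $u,v\in W^H$: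 (1) $R^{H,x}_{u,v}(q)=0$ if $u\not\le v$; (2) $R^{H,x}_{u,u}(q)=1$; (3) if $u<v$ and $s\in D_L(v)$, then $R^{H,x}_{u,v}(q)$ equals $R^{H,x}_{su,sv}(q)$ if $s\in D_L(u)$; equals $(q-1)R^{H,x}_{u,sv}(q)+qR^{H,x}_{su,sv}(q)$ if $s\notin D_L(u)$ and $su\in W^H$; equals $(q-1-x)R^{H,x}_{u,sv}(q)$ if $s\notin D_L(u)$ and $su\notin W^H$. Parabolic Kazhdan--Lusztig polynomials: $\{P^{H,x}_{u,v}(q)\}_{u,v\in W^H}\subseteq\mathbb Z[q]$ is the unique family such that for all $u,v\in W^H$: (1) $P^{H,x}_{u,v}(q)=0$ if $u\not\le v$; (2) $P^{H,x}_{u,u}(q)=1$; (3) $\deg P^{H,x}_{u,v}(q)\le\frac12(\ell(v)-\ell(u)-1)$ if $u<v$; (4) $q^{\ell(v)-\ell(u)}P^{H,x}_{u,v}(1/q)=\sum_{z\in[u,v]^H}R^{H,x}_{u,z}(q)P^{H,x}_{z,v}(q)$. *)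

(* Defs.v *)
From HB Require Import structures.
From mathcomp Require Import all_boot all_order all_algebra all_fingroup.
From mathcomp Require Import boolp classical_sets functions cardinality fsbigop.
From Stdlib Require Import Relation_Operators.

Set Implicit Arguments.
Unset Strict Implicit.
Unset Printing Implicit Defensive.

Import GRing.Theory.
Local Open Scope classical_set_scope.

(** * Coxeter systems *)

(* A word over the group is a [seq W].  One step deletes a relator
   (s t)^{m(s,t)}, with [m s t = None] encoding m(s,t) = infinity; the relators
   with s = t are s s, since m(s,s) = 1. *)
Definition relator_step (W : groupType) (S : set W) (m : W -> W -> option nat)
    (w1 w2 : seq W) : Prop :=
  exists (l r : seq W) (s t : W) (n : nat),
    [/\ S s, S t, m s t = Some n,
        w1 = l ++ flatten (nseq n [:: s; t]) ++ r & w2 = l ++ r].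

(* [coxeter_presentation] says that W is presented by the generators S and the
   relations (s t)^{m(s,t)} = 1.  Because s s is a relator, every element of
   the presented group is given by a positive word, so it is enough to describe
   the kernel of the evaluation of positive words. *)
Record coxeterSystem := CoxeterSystem {
  coxeter_group :> groupType;
  simple : set coxeter_group;
  coxeter_matrix : coxeter_group -> coxeter_group -> option nat;
  coxeter_matrix_sym : forall s t, simple s -> simple t ->
    coxeter_matrix s t = coxeter_matrix t s;
  coxeter_matrix_diag : forall s t, simple s -> simple t ->
    (coxeter_matrix s t = Some 1%N <-> s = t);
  coxeter_matrix_neq0 : forall s t, simple s -> simple t ->
    coxeter_matrix s t <> Some 0%N;
  coxeter_generated : forall w : coxeter_group, exists l : seq coxeter_group,
    [set` l] `<=` simple /\ (\prod_(s <- l) s)%g = w;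
  coxeter_presentation : forall l : seq coxeter_group, [set` l] `<=` simple ->
    ((\prod_(s <- l) s)%g = 1%g <->
     clos_refl_sym_trans _ (relator_step simple coxeter_matrix) l [::])
}.

Arguments simple : clear implicits.

Definition doubly_laced (W : coxeterSystem) : Prop :=
  forall s t : W, simple W s -> simple W t ->
    exists2 n, coxeter_matrix s t = Some n & (n <= 4)%N.

Definition dihedral (W : coxeterSystem) : Prop :=
  (simple W #= `I_2)%card.

Section Coxeter.
Variable W : coxeterSystem.
Implicit Types (u v w s t z : W) (H : set W).

Definition has_word_of_size w : pred nat := fun n =>
  `[< exists l : seq W,
      [/\ [set` l] `<=` simple W, (\prod_(s <- l) s)%g = w & size l = n] >].

Lemma has_word_of_size_ex w : exists n, has_word_of_size w n.
Proof.
have [l [lS lw]] := coxeter_generated w.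
by exists (size l); apply/asboolP; exists l.
Qed.

Definition len w : nat := ex_minn (has_word_of_size_ex w).

Definition left_descents w : set W :=
  [set s | simple W s /\ (len (s * w)%g < len w)%N].
Definition right_descents w : set W :=
  [set s | simple W s /\ (len (w * s)%g < len w)%N].

(** ** Bruhat order *)

Definition reflection t : Prop :=
  exists w s, simple W s /\ t = (w * s * w^-1)%g.

Definition bruhat_step u v : Prop :=
  exists t, [/\ reflection t, v = (u * t)%g & (len u < len v)%N].

Definition bruhat_le : W -> W -> Prop := clos_refl_trans W bruhat_step.

Definition bruhat_itv u v : set W :=
  [set z | bruhat_le u z /\ bruhat_le z v].

(** ** Parabolic quotients *)

Definition min_coset_reps H : set W :=
  [set w | right_descents w `<=` simple W `\` H].

Definition parabolic_itv H u v : set W :=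
  [set z | min_coset_reps H z /\ (bruhat_le u z /\ bruhat_le z v)].

(** ** Parabolic R- and Kazhdan-Lusztig polynomials *)

Local Open Scope ring_scope.

(* Families are total on W x W; their values outside W^H are unconstrained. *)
Record is_parabolic_R H (x : {poly int}) (R : W -> W -> {poly int}) : Prop :=
  IsParabolicR {
  parabolic_R_out : forall u v, min_coset_reps H u -> min_coset_reps H v ->
    ~ bruhat_le u v -> R u v = 0;
  parabolic_R_diag : forall u, min_coset_reps H u -> R u u = 1;
  parabolic_R_desc : forall u v s, min_coset_reps H u -> min_coset_reps H v ->
    bruhat_le u v -> u <> v -> left_descents v s -> left_descents u s ->
    R u v = R (s * u)%g (s * v)%g;
  parabolic_R_asc_in : forall u v s, min_coset_reps H u ->
    min_coset_reps H v -> bruhat_le u v -> u <> v -> left_descents v s ->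
    ~ left_descents u s -> min_coset_reps H (s * u)%g ->
    R u v = ('X - 1) * R u (s * v)%g + 'X * R (s * u)%g (s * v)%g;
  parabolic_R_asc_out : forall u v s, min_coset_reps H u ->
    min_coset_reps H v -> bruhat_le u v -> u <> v -> left_descents v s ->
    ~ left_descents u s -> ~ min_coset_reps H (s * u)%g ->
    R u v = ('X - 1 - x) * R u (s * v)%g
}.

(* q^n p(1/q), computed in the field of fractions of Z[q]. *)
Definition qpow_eval_inv (n : nat) (p : {poly int}) : {fraction {poly int}} :=
  let q := FracField.tofrac ('X : {poly int}) in
  q ^+ n * (map_poly intr p).[q^-1].

(* [(size p).-1] is the degree of p if p != 0, and 0 if p = 0; since u < v
   forces len u < len v, the degree bound is satisfied by p = 0, as it must
   be. *)
Record is_parabolic_P H (R P : W -> W -> {poly int}) : Prop :=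
  IsParabolicP {
  parabolic_P_out : forall u v, min_coset_reps H u -> min_coset_reps H v ->
    ~ bruhat_le u v -> P u v = 0;
  parabolic_P_diag : forall u, min_coset_reps H u -> P u u = 1;
  parabolic_P_deg : forall u v, min_coset_reps H u -> min_coset_reps H v ->
    bruhat_le u v -> u <> v ->
    (2 * (size (P u v)).-1 <= len v - len u - 1)%N;
  parabolic_P_inv : forall u v, min_coset_reps H u -> min_coset_reps H v ->
    qpow_eval_inv (len v - len u) (P u v) =
    FracField.tofrac (\sum_(z \in parabolic_itv H u v) R u z * P z v)
}.

End Coxeter.

Definition poset_iso (W1 W2 : coxeterSystem) (A : set W1) (B : set W2)
    (f : W1 -> W2) : Prop :=
  set_bij A B f /\
  (forall a b, A a -> A b -> (bruhat_le a b <-> bruhat_le (f a) (f b))).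

(* Main.v *)
(* The greatest element of [W^H] below [z] is the minimal representative of the
   coset [z W_H], so cosets are visible in the order, and Deodhar's formula writes
   [R^{H,x}_{u,v}] as the sum of [(-x)^{l(z)-l(u)} R_{z,v}] over the [z <= v] in
   [u W_H].  Hence it suffices to show that the ordinary polynomials [R_{u,v}] are
   preserved by isomorphisms of lower intervals; the Kazhdan-Lusztig polynomials
   are then determined by their degree bound.

   An isomorphism carries left multiplication by a descent of [v1] to a special
   matching [M] of [1, v2], and the point is that [M] computes R-polynomials by the
   same recursion as a descent.  In a dihedral interval they depend on the length
   difference only.  Otherwise the group is doubly laced, and a left or right
   multiplication by a descent of [w] commutes with [M] on [1, w] and differs from
   [M] at [w]; induction on the length of [w] then applies.  Commutation rests on
   the fact that two distinct elements of equal positive length with the same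
   coatoms lie in a common dihedral parabolic subgroup. *)

Require Import Defs.
From mathcomp Require Import all_boot all_order all_algebra all_fingroup.
From mathcomp Require Import boolp classical_sets functions cardinality fsbigop.
From mathcomp Require Import zify ring.
From Stdlib Require Import Relation_Operators Operators_Properties.

Set Implicit Arguments.
Unset Strict Implicit.
Unset Printing Implicit Defensive.

(** A special matching need not be a multiplication, and its definition speaks of the order only.
    The link to the group is the letter [s = M 1]: every other letter [c] below [w] has [M c] equal
    to [s * c] or [c * s]. Whether a multiplication by [f] commutes with [M] can be tested on
    elements of length at most one. If commutation first fails at [u], the two competing elements
    have length [len u + 2] and the same coatoms, so they lie in one dihedral subgroup; since m <= 4
    leaves at most one element of each length from 4 on, [len u] is at most 1. This is where the
    constant 4 enters. The remaining obstacle is that [M] may act on the dihedral subgroup of [s]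
    and one letter [d] neither as a left nor as a right multiplication. Most of the combinatorics
    shows that such a twist is confined to a single factor [d * s] of [w], so that the letters
    around it still supply a commuting multiplication, unless [w] itself is dihedral. *)

(** * Words, length and the reflections attached to a word *)

Section CoxeterBasics.
Variable W : coxeterSystem.
Implicit Types (s t u v w x y z : W) (l : seq W).
Local Open Scope group_scope.

Definition sword l := forall s, s \in l -> simple W s.
Definition prodw l : W := \prod_(s <- l) s.

(* [mulgA] infers the product of [W] through its semigroup structure, which
   [lia] does not identify with the inferred group product. *)
Lemma wmulA x y z : x * (y * z) = x * y * z.
Proof. exact: mulgA. Qed.

Lemma sword_sub l : ([set` l] `<=` simple W)%classic <-> sword l.
Proof. by split=> h s; exact: h. Qed.

Lemma sword_cons s l : sword (s :: l) <-> simple W s /\ sword l.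
Proof.
split=> [h|[hs hl] t]; last by rewrite inE => /orP[/eqP->|/hl].
by split=> [|t tl]; apply: h; rewrite inE ?eqxx ?tl ?orbT.
Qed.

Lemma sword_cat l1 l2 : sword (l1 ++ l2) <-> sword l1 /\ sword l2.
Proof.
split=> [h|[h1 h2] t]; last by rewrite mem_cat => /orP[/h1|/h2].
by split=> t tl; apply: h; rewrite mem_cat tl ?orbT.
Qed.

Lemma sword_rev l : sword (rev l) <-> sword l.
Proof. by split=> h t tl; apply: h; rewrite ?mem_rev // -mem_rev. Qed.

Lemma sword_subseq l1 l2 : subseq l1 l2 -> sword l2 -> sword l1.
Proof. by move=> /mem_subseq h h2 s /h /h2. Qed.

Lemma prodw_nil : prodw [::] = 1. Proof. exact: big_nil. Qed.
Lemma prodw_cons s l : prodw (s :: l) = s * prodw l.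
Proof. exact: big_cons. Qed.
Lemma prodw_cat l1 l2 : prodw (l1 ++ l2) = prodw l1 * prodw l2.
Proof. exact: big_cat. Qed.
Lemma prodw_seq1 s : prodw [:: s] = s.
Proof. exact: big_seq1. Qed.

Lemma word_rel1 l : sword l -> prodw l = 1 ->
  clos_refl_sym_trans _ (relator_step (simple W) (@coxeter_matrix W)) l [::].
Proof. by move=> /sword_sub hl /(coxeter_presentation hl). Qed.

Lemma relator_prod s t n : simple W s -> simple W t ->
  coxeter_matrix s t = Some n -> (s * t) ^+ n = 1.
Proof.
move=> hs ht hm.
have -> : (s * t) ^+ n = prodw (flatten (nseq n [:: s; t])).
  elim: n {hm} => [|n IH]; first by rewrite prodw_nil.
  by rewrite expgS IH /= !prodw_cons wmulA.
apply/coxeter_presentation.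
  apply/sword_sub => r /flattenP[l /nseqP[-> _]].
  by rewrite !inE => /orP[]/eqP->.
apply: rst_step; exists [::], [::], s, t, n; split=> //.
by rewrite /= cats0.
Qed.

Lemma simple_sqr s : simple W s -> s * s = 1.
Proof.
move=> hs; have := relator_prod hs hs ((coxeter_matrix_diag hs hs).2 erefl).
by rewrite expg1.
Qed.

Lemma simple_inv s : simple W s -> s^-1 = s.
Proof. by move=> /simple_sqr h; apply/mulg1_eq. Qed.

Lemma simpleK s : simple W s -> involutive (mulg s).
Proof. by move=> hs x; rewrite wmulA simple_sqr // mul1g. Qed.

Lemma simpleKr s : simple W s -> involutive (fun x => x * s).
Proof. by move=> hs x; rewrite -wmulA simple_sqr // mulg1. Qed.

Lemma prodw_rev l : sword l -> prodw (rev l) = (prodw l)^-1.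
Proof.
elim: l => [|s l IH]; first by rewrite /= prodw_nil invg1.
move=> /sword_cons[hs hl]; rewrite rev_cons -cats1 prodw_cat IH //.
by rewrite prodw_seq1 prodw_cons invMg (simple_inv hs).
Qed.

(** Relators have even length, so the parity of a word is an invariant of its product: this is the
    sign character, and it makes multiplication by a letter change the length by exactly one. *)
Lemma relator_step_odd l1 l2 :
  relator_step (simple W) (@coxeter_matrix W) l1 l2 -> odd (size l1) = odd (size l2).
Proof.
case=> a [b] [s] [t] [n] [_ _ _ -> ->].
rewrite !size_cat; suff -> : size (flatten (nseq n [:: s; t])) = n.*2.
  by rewrite !oddD odd_double.
by elim: n => //= n ->; rewrite doubleS.
Qed.

Lemma word1_even l : sword l -> prodw l = 1 -> odd (size l) = false.
Proof.
move=> hl /(word_rel1 hl).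
suff H l1 l2 : clos_refl_sym_trans _ (relator_step (simple W)
   (@coxeter_matrix W)) l1 l2 -> odd (size l1) = odd (size l2) by move/H.
elim=> // {l1 l2 hl} [l1 l2 /relator_step_odd //|l1 l2 l3 _ -> _ -> //].
Qed.

Lemma word_odd l1 l2 : sword l1 -> sword l2 -> prodw l1 = prodw l2 ->
  odd (size l1) = odd (size l2).
Proof.
move=> h1 h2 e; have := @word1_even (l1 ++ rev l2).
rewrite prodw_cat prodw_rev // e mulgV size_cat size_rev oddD.
have hr : sword (l1 ++ rev l2) by apply/sword_cat; split=> //; exact/sword_rev.
by move=> /(_ hr erefl); case: odd; case: odd.
Qed.

Definition cj (g t : W) : W := g * t * g^-1.

(** For a word s1 ... sk these are the reflections s1 ... si ... s1; multiplying the product by the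
    i-th of them on the left deletes the letter si. *)
Fixpoint reflseq l : seq W :=
  if l is s :: l' then s :: map (cj s) (reflseq l') else [::].

Lemma cjM g h t : cj (g * h) t = cj g (cj h t).
Proof. by rewrite /cj invMg !wmulA. Qed.
Lemma cj1 t : cj 1 t = t.
Proof. by rewrite /cj invg1 mul1g mulg1. Qed.
Lemma cjK g : cancel (cj g) (cj g^-1).
Proof. by move=> t; rewrite -cjM mulVg cj1. Qed.
Lemma cjKV g : cancel (cj g^-1) (cj g).
Proof. by move=> t; rewrite -cjM mulgV cj1. Qed.

Lemma reflseq_cat l1 l2 :
  reflseq (l1 ++ l2) = reflseq l1 ++ map (cj (prodw l1)) (reflseq l2).
Proof.
elim: l1 => [|s l1 IH] /=.
  by rewrite prodw_nil -[LHS]map_id; apply: eq_map => t; rewrite cj1.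
rewrite IH map_cat -map_comp; congr (_ :: _ ++ _).
by apply: eq_map => t; rewrite /= -cjM prodw_cons.
Qed.

(** The reflection cocycle: this parity turns out to depend on the product of [l] only, although the
    sequence [reflseq l] does not. *)
Definition nrefl l t : bool := odd (count_mem t (reflseq l)).

Lemma count_cj g t l : count_mem t (map (cj g) l) = count_mem (cj g^-1 t) l.
Proof.
rewrite count_map; apply: eq_count => x /=.
by apply/eqP/eqP => [<-|->]; rewrite ?cjK ?cjKV.
Qed.

Lemma nrefl_cat l1 l2 t :
  nrefl (l1 ++ l2) t = nrefl l1 t (+) nrefl l2 (cj (prodw l1)^-1 t).
Proof. by rewrite /nrefl reflseq_cat count_cat oddD count_cj. Qed.

Lemma reflseq_relator s t n : simple W s -> simple W t ->
  reflseq (flatten (nseq n [:: s; t])) =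
  [seq (s * t) ^+ j * s | j <- iota 0 n.*2].
Proof.
move=> hs ht; elim: n => //= n ->.
rewrite expg0 mul1g -[2]/(2 + 0)%N iotaDl -!map_comp expg1.
congr [:: _, _ & _]; first by rewrite /cj simple_inv.
apply: eq_map => j; rewrite /= /cj expgnDr expg2 (simple_inv hs) (simple_inv ht).
have cst : commute (s * t) ((s * t)^+j) by apply: commuteX; exact: commute_refl.
by rewrite -(wmulA (s * t) (s * t)) cst !wmulA.
Qed.

(** The reflections of the relator are (s t)^j s for j < 2n. As (s t)^n = 1, the second half of the
    list repeats the first, and every reflection occurs an even number of times. *)
Lemma nrefl_relator s t n r : simple W s -> simple W t ->
  coxeter_matrix s t = Some n -> nrefl (flatten (nseq n [:: s; t])) r = false.
Proof.
move=> hs ht hm; rewrite /nrefl reflseq_relator // -addnn iotaD add0n map_cat.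
rewrite -{2}(addn0 n) iotaDl -map_comp count_cat oddD.
rewrite (@eq_map _ _ _ (fun j => (s * t) ^+ j * s)) ?addbb // => j.
by rewrite /= expgnDr (relator_prod hs ht hm) mul1g.
Qed.

Lemma nrefl_step l1 l2 t :
  relator_step (simple W) (@coxeter_matrix W) l1 l2 -> nrefl l1 t = nrefl l2 t.
Proof.
case=> a [b] [s] [r] [n] [hs hr hm -> ->].
rewrite !nrefl_cat nrefl_relator // addFb; congr (_ (+) nrefl _ _).
have -> : prodw (flatten (nseq n [:: s; r])) = 1; last by rewrite invg1 cj1.
rewrite -(relator_prod hs hr hm); elim: (n) => [|k IH]; first exact: prodw_nil.
by rewrite expgS /= !prodw_cons IH wmulA.
Qed.

Lemma nrefl1 l t : sword l -> prodw l = 1 -> nrefl l t = false.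
Proof.
move=> hl /(word_rel1 hl).
suff H l1 l2 : clos_refl_sym_trans _ (relator_step (simple W)
   (@coxeter_matrix W)) l1 l2 -> nrefl l1 t = nrefl l2 t by move/H.
elim=> // {l1 l2 hl} [l1 l2 /nrefl_step //|l1 l2 l3 _ -> _ -> //].
Qed.

Lemma nrefl_prod l1 l2 t : sword l1 -> sword l2 -> prodw l1 = prodw l2 ->
  nrefl l1 t = nrefl l2 t.
Proof.
move=> h1 h2 e; have h l : sword l -> prodw l = prodw l2 ->
    nrefl l t = nrefl (rev l2) (cj (prodw l2)^-1 t).
  move=> hl el; have := @nrefl1 (l ++ rev l2) t.
  rewrite nrefl_cat prodw_cat prodw_rev // el mulgV => h.
  have : nrefl l t (+) nrefl (rev l2) (cj (prodw l2)^-1 t) = false.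
    by apply: h => //; apply/sword_cat; split=> //; apply/sword_rev.
  by case: nrefl; case: nrefl.
by rewrite (h _ h1 e) (h _ h2 erefl).
Qed.

Lemma exists_word w : exists2 l, sword l & prodw l = w.
Proof. by have [l [/sword_sub hl hw]] := coxeter_generated w; exists l. Qed.

Lemma len_word l : sword l -> (len (prodw l) <= size l)%N.
Proof.
move=> /sword_sub hl; rewrite /len; case: ex_minnP => m _; apply.
by apply/asboolP; exists l.
Qed.

Lemma reduced_word w : exists l, [/\ sword l, prodw l = w & size l = len w].
Proof.
rewrite /len; case: ex_minnP => m /asboolP[l [/sword_sub hl hw hm]] _.
by exists l.
Qed.

Lemma len_odd l : sword l -> odd (len (prodw l)) = odd (size l).
Proof.
move=> hl; have [l' [hl' e <-]] := reduced_word (prodw l).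
exact: word_odd.
Qed.

Lemma len1 : len (1 : W) = 0%N.
Proof. by apply/eqP; rewrite -leqn0 -prodw_nil; apply: len_word. Qed.

Lemma len_eq0 w : len w = 0%N -> w = 1.
Proof.
have [l [_ <- <-]] := reduced_word w.
by case: l => //; rewrite prodw_nil.
Qed.

Lemma len_mul x y : (len (x * y) <= len x + len y)%N.
Proof.
have [l1 [h1 <- <-]] := reduced_word x; have [l2 [h2 <- <-]] := reduced_word y.
by rewrite -prodw_cat -size_cat; apply: len_word; apply/sword_cat.
Qed.

Lemma lenV w : len w^-1 = len w.
Proof.
have H x : (len x^-1 <= len x)%N.
  have [l [h <- <-]] := reduced_word x; rewrite -prodw_rev // -size_rev.
  by apply: len_word; apply/sword_rev.
by apply/eqP; rewrite eqn_leq H -{1}(invgK w) H.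
Qed.

Lemma len_simple s : simple W s -> len s = 1%N.
Proof.
move=> hs; have h : sword [:: s] by move=> t; rewrite inE => /eqP->.
have := len_word h; have := len_odd h; rewrite prodw_seq1 /=.
by case: (len s) => [|[|]].
Qed.

Lemma len_eq1 w : len w = 1%N -> simple W w.
Proof.
have [l [h <- <-]] := reduced_word w.
by case: l h => // s [] // h _; rewrite prodw_seq1; apply: h; rewrite inE.
Qed.

Lemma simple_neq1 s : simple W s -> s <> 1.
Proof. by move=> /len_simple h e; rewrite e len1 in h. Qed.

Lemma len_odd_mul x y : odd (len (x * y)) = odd (len x) (+) odd (len y).
Proof.
have [l1 h1 <-] := exists_word x; have [l2 h2 <-] := exists_word y.
rewrite -prodw_cat !len_odd // ?size_cat ?oddD //; exact/sword_cat.
Qed.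

Lemma len_sl s w : simple W s ->
  len (s * w) = (len w).+1 \/ len w = (len (s * w)).+1.
Proof.
move=> hs; have := len_odd_mul s w; have := len_mul s w.
have := len_mul s (s * w); rewrite (simpleK hs) (len_simple hs) => h1 h2 h3.
have {}h3 : odd (len (s * w)) = ~~ odd (len w) by [].
have [e|e|e] := ltngtP (len (s * w)) (len w); [right|left|]; last first.
- by rewrite e in h3; case: odd h3.
- by apply/eqP; rewrite eqn_leq e andbT -add1n.
- by apply/eqP; rewrite eqn_leq e andbT -add1n.
Qed.

Lemma len_sr s w : simple W s ->
  len (w * s) = (len w).+1 \/ len w = (len (w * s)).+1.
Proof.
move=> hs; rewrite -lenV -(lenV w) invMg (simple_inv hs); exact: len_sl.
Qed.

(** * Strong exchange *)

Lemma reflection_simple s : simple W s -> @reflection W s.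
Proof. by move=> hs; exists 1, s; rewrite mul1g invg1 mulg1. Qed.

Lemma reflection_cj g t : @reflection W t -> @reflection W (cj g t).
Proof.
case=> w [s] [hs ->]; exists (g * w), s; split=> //.
by rewrite /cj invMg !wmulA.
Qed.

Lemma reflection_sqr t : @reflection W t -> t * t = 1.
Proof.
case=> w [s] [hs ->]; by rewrite !wmulA mulgVK -(wmulA w) simple_sqr // mulg1 mulgV.
Qed.

Lemma reflection_inv t : @reflection W t -> t^-1 = t.
Proof. by move/reflection_sqr => h; apply/mulg1_eq. Qed.

Lemma reflection_odd t : @reflection W t -> odd (len t).
Proof.
case=> w [s] [hs ->]; rewrite !len_odd_mul lenV (len_simple hs).
by case: odd.
Qed.

(** In the palindromic word [l ++ [:: s] ++ rev l] the middle letter contributes [t] once; the two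
    halves contribute as they do in [l ++ rev l], a word for 1, hence evenly. *)
Lemma nrefl_self t : @reflection W t ->
  exists2 l, sword l & prodw l = t /\ nrefl l t.
Proof.
case=> w [s] [hs {t}->]; have [l hl <-] := exists_word w.
exists (l ++ [:: s] ++ rev l).
  apply/sword_cat; split=> //; apply/sword_cons; split=> //.
  exact/sword_rev.
split; first by rewrite !prodw_cat prodw_rev // prodw_seq1 wmulA.
set t := _ * _ * _; rewrite !nrefl_cat prodw_seq1.
have -> : cj (prodw l)^-1 t = s by rewrite -[t]/(cj _ s) cjK.
have -> : cj s^-1 s = s by rewrite /cj mulVg mul1g invgK.
have : nrefl (l ++ rev l) t = false.
  apply: nrefl1; last by rewrite prodw_cat prodw_rev // mulgV.
  by apply/sword_cat; split=> //; apply/sword_rev.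
rewrite nrefl_cat -[t]/(cj _ s) cjK => h.
by rewrite /nrefl /= eqxx addbA addbC addbA [X in X (+) _]addbC h.
Qed.

Lemma reflseq_delete l t : sword l -> t \in reflseq l ->
  exists l1 s l2, l = l1 ++ s :: l2 /\ t * prodw l = prodw (l1 ++ l2).
Proof.
elim: l t => //= s l IH t /sword_cons[hs hl]; rewrite inE.
case/orP => [/eqP->|/mapP[r /IH-/(_ hl)[l1 [s' [l2 [-> e]]]] ->]].
  by exists [::], s, l; rewrite prodw_cons simpleK.
exists (s :: l1), s', l2; split=> //=.
by rewrite !prodw_cons -e /cj -!wmulA mulKg.
Qed.

(** If [t] occurred an even number of times for [l], the cocycle rule would make it occur oddly for
    a reduced word of [t * prodw l]. Deleting a letter there would make [prodw l] the shorter of the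
    two elements. *)
Lemma strong_exchange l t : sword l -> @reflection W t ->
  (len (t * prodw l) < len (prodw l))%N ->
  exists l1 s l2, l = l1 ++ s :: l2 /\ t * prodw l = prodw (l1 ++ l2).
Proof.
move=> hl ht hlt; apply: reflseq_delete => //.
case: (boolP (nrefl l t)) => [|hn].
  by rewrite /nrefl -has_pred1 has_count; case: (count _ _).
have [k hk [ek nk]] := nrefl_self ht.
have [l' [hl' el sl]] := reduced_word (t * prodw l).
have hkl : sword (k ++ l) by apply/sword_cat.
have := @nrefl_prod l' (k ++ l) t hl' hkl.
rewrite el prodw_cat ek nrefl_cat nk ek => /(_ erefl).
have -> : cj t^-1 t = t by rewrite /cj mulVg mul1g invgK.
rewrite (negbTE hn) addbF => h.
have tl' : t \in reflseq l'.
  by move: h; rewrite /nrefl -has_pred1 has_count; case: (count _ _).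
have [l1 [s [l2 [e1]]]] := reflseq_delete hl' tl'.
rewrite el wmulA reflection_sqr // mul1g => e2.
have : (len (prodw l) <= size (l1 ++ l2))%N.
  rewrite e2; apply: len_word; move: hl'; rewrite e1 !sword_cat sword_cons.
  by case=> ? [].
by move: sl; rewrite e1 !size_cat /=; lia.
Qed.

Lemma exchange s l : simple W s -> sword l ->
  (len (s * prodw l) < len (prodw l))%N ->
  exists l1 r l2, l = l1 ++ r :: l2 /\ s * prodw l = prodw (l1 ++ l2).
Proof. by move=> hs hl; apply: strong_exchange; last exact: reflection_simple. Qed.

End CoxeterBasics.

Local Notation "x <=b y" := (bruhat_le x y) (at level 70, no associativity).

(** * Bruhat order *)

Section Bruhat.
Variable W : coxeterSystem.
Implicit Types (s t u v w x y z : W) (l : seq W) (J K : W -> Prop).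
Local Open Scope group_scope.

Definition ld s w : bool := (len (s * w) < len w)%N.
Definition rd s w : bool := (len (w * s) < len w)%N.

Lemma ld_len s w : simple W s -> ld s w -> len w = (len (s * w)).+1.
Proof. by move=> hs; rewrite /ld; case: (len_sl w hs) => ->; lia. Qed.

Lemma ldN_len s w : simple W s -> ~~ ld s w -> len (s * w) = (len w).+1.
Proof. by move=> hs; rewrite /ld; case: (len_sl w hs) => ->; lia. Qed.

Lemma ldM s w : simple W s -> ld s (s * w) = ~~ ld s w.
Proof.
move=> hs; rewrite /ld simpleK //.
by case: (len_sl w hs) => ->; [rewrite ltnSn|]; rewrite ?ltnn; lia.
Qed.

Lemma ldV s w : simple W s -> ld s w^-1 = rd s w.
Proof. by move=> hs; rewrite /ld /rd -lenV invMg invgK (simple_inv hs) lenV. Qed.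

Lemma rdV s w : simple W s -> rd s w^-1 = ld s w.
Proof. by move=> hs; rewrite -ldV // invgK. Qed.

Lemma rd_len s w : simple W s -> rd s w -> len w = (len (w * s)).+1.
Proof. by move=> hs; rewrite /rd; case: (len_sr w hs) => ->; lia. Qed.

Lemma rdN_len s w : simple W s -> ~~ rd s w -> len (w * s) = (len w).+1.
Proof. by move=> hs; rewrite /rd; case: (len_sr w hs) => ->; lia. Qed.

Lemma rdM s w : simple W s -> rd s (w * s) = ~~ rd s w.
Proof.
by move=> hs; rewrite -!ldV // invMg (simple_inv hs) ldM.
Qed.

Lemma ld1 s : ld s 1 = false.
Proof. by rewrite /ld len1. Qed.

Lemma rd1 s : rd s 1 = false.
Proof. by rewrite /rd len1. Qed.

Lemma ex_ld w : w <> 1 -> exists2 s, simple W s & ld s w.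
Proof.
have [[|s l] [hl <- hsz]] := reduced_word w; first by rewrite prodw_nil.
move=> _; case/sword_cons: hl => hs hl; exists s => //.
move: hsz; rewrite /ld prodw_cons simpleK //= => <-.
by rewrite ltnS; exact: len_word.
Qed.

Lemma ex_rd w : w <> 1 -> exists2 s, simple W s & rd s w.
Proof.
move=> h; have [|s hs] := @ex_ld w^-1; first by move=> e; apply: h; rewrite -(invgK w) e invg1.
by rewrite ldV //; exists s.
Qed.

Lemma br_refl u : u <=b u. Proof. exact: rt_refl. Qed.
Lemma br_trans v u w : u <=b v -> v <=b w -> u <=b w.
Proof. exact: rt_trans. Qed.

Lemma br_len u v : u <=b v -> u = v \/ (len u < len v)%N.
Proof.
elim=> {u v} [u v [t [_ _ h]]|u|u v w _ h1 _ h2]; [by right|by left|].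
case: h1 => [->//|h1]; right; case: h2 => [<-//|]; exact: ltn_trans h1.
Qed.

Lemma br_leq u v : u <=b v -> (len u <= len v)%N.
Proof. by case/br_len => [->|/ltnW]. Qed.

Lemma br_eq u v : u <=b v -> (len v <= len u)%N -> u = v.
Proof. by case/br_len => // h; rewrite leqNgt h. Qed.

Lemma br_anti u v : u <=b v -> v <=b u -> u = v.
Proof. by move=> h /br_leq; exact: br_eq. Qed.

Lemma br_ltn u v : u <=b v -> u <> v -> (len u < len v)%N.
Proof. by case/br_len. Qed.

Lemma br_inv u v : u <=b v -> u^-1 <=b v^-1.
Proof.
elim=> {u v} [u v [t [ht e h]]|u|u v w _ h1 _ h2]; last exact: br_trans h2.
  apply: rt_step; exists (cj u t); split; [exact: reflection_cj| |by rewrite !lenV].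
  by rewrite e invMg (reflection_inv ht) /cj !wmulA mulVg mul1g.
exact: br_refl.
Qed.

Lemma br_invE u v : (u^-1 <=b v^-1) <-> u <=b v.
Proof. by split=> /br_inv //; rewrite !invgK. Qed.

Lemma br_up s w : simple W s -> ~~ ld s w -> w <=b s * w.
Proof.
move=> hs h; apply: rt_step; exists (cj w^-1 s); split.
- exact/reflection_cj/reflection_simple.
- by rewrite /cj invgK !wmulA mulgV mul1g.
- by rewrite ldN_len.
Qed.

Lemma br_dn s w : simple W s -> ld s w -> s * w <=b w.
Proof.
move=> hs h; have := @br_up s (s * w) hs; rewrite simpleK //; apply.
by rewrite ldM // h.
Qed.

(** If the lengths of [s * u] and [s * v] are not in the right order, then [s :: l] is a reduced
    word of [v], and strong exchange deletes one of its letters to give [u]. Deleting a letter of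
    [l] would make [s * u] too short, so the deleted letter is the leading [s]. *)
Lemma step_mul s u v : simple W s -> bruhat_step u v ->
  s * u = v \/ bruhat_step (s * u) (s * v).
Proof.
move=> hs [t [ht e hlt]].
have [h|h] := ltnP (len (s * u)) (len (s * v)).
  by right; exists t; split=> //; rewrite e wmulA.
left; have [l [hl el sl]] := reduced_word (s * v).
have ev : v = prodw (s :: l) by rewrite prodw_cons el simpleK.
have hsl : sword (s :: l) by apply/sword_cons.
have eu : u = cj u t * v by rewrite e /cj wmulA mulgVK -wmulA (reflection_sqr ht) mulg1.
have odt : odd (len v) = ~~ odd (len u).
  by rewrite e len_odd_mul (reflection_odd ht) addbT.
have [lu|lu] := len_sl u hs; last by case: (len_sl v hs) => lv; lia.
have [lv|lv] := len_sl v hs; first by lia.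
have [|l1 [r [l2 [e1 e2]]]] := @strong_exchange _ _ (cj u t) hsl (reflection_cj _ ht).
  by rewrite -ev -eu.
rewrite -ev -eu in e2; case: l1 e1 e2 => [|r' l1] /= [e0 e1] e2.
  by rewrite e2 -e1 el simpleK.
move: hl; rewrite e1 => /sword_cat[h1 /sword_cons[_ h2]].
have := @len_word _ (l1 ++ l2); rewrite sword_cat => /(_ (conj h1 h2)).
have -> : prodw (l1 ++ l2) = s * u by rewrite e2 prodw_cons -e0 simpleK.
rewrite e1 /= in sl; move: sl; rewrite !size_cat /=; lia.
Qed.

(** This and the next lemma are the lifting property before descents are taken into account; the
    first alternative absorbs the exceptional case of [step_mul]. *)
Lemma br_lift_l s u v : simple W s -> u <=b v -> s * u <=b v \/ s * u <=b s * v.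
Proof.
move=> hs /clos_rt_rt1n_iff; elim=> {u v} [u|u u1 v h1 /clos_rt_rt1n_iff h2 IH].
  by right; exact: br_refl.
case: (step_mul hs h1) => [->|h]; first by left.
by case: IH => IH; [left|right]; apply: br_trans IH; exact: rt_step.
Qed.

Lemma br_lift_r s u v : simple W s -> u <=b v -> u <=b s * v \/ s * u <=b s * v.
Proof.
move=> hs /clos_rt_rtn1_iff; elim=> {v} [|v' v h1 /clos_rt_rtn1_iff h2 IH].
  by right; exact: br_refl.
case: (step_mul hs h1) => [<-|h]; first by left; rewrite simpleK.
by case: IH => IH; [left|right]; apply: br_trans IH _; exact: rt_step.
Qed.

Section Lifting.
Variables (s u v : W).
Hypotheses (hs : simple W s) (huv : u <=b v).

Lemma lift_le : ld s v -> s * u <=b v.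
Proof.
move=> h; case: (br_lift_l hs huv) => // h2; apply: br_trans h2 _; exact: br_dn.
Qed.

Lemma lift_up : ld s v -> ~~ ld s u -> u <=b s * v.
Proof.
move=> h hu; case: (br_lift_r hs huv) => // h2; apply: br_trans h2; exact: br_up.
Qed.

Lemma lift_dn : ld s v -> ld s u -> s * u <=b s * v.
Proof.
move=> h hu; case: (br_lift_r hs huv) => // h2; apply: br_trans h2; exact: br_dn.
Qed.

Lemma lift_both : ~~ ld s v -> s * u <=b s * v.
Proof.
move=> h; case: (br_lift_l hs huv) => // h2; apply: br_trans h2 _; exact: br_up.
Qed.
End Lifting.

Lemma br_rup s w : simple W s -> ~~ rd s w -> w <=b w * s.
Proof.
move=> hs h; apply/br_invE; rewrite invMg (simple_inv hs).
by apply: br_up => //; rewrite ldV.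
Qed.

Lemma br_rdn s w : simple W s -> rd s w -> w * s <=b w.
Proof.
move=> hs h; apply/br_invE; rewrite invMg (simple_inv hs).
by apply: br_dn => //; rewrite ldV.
Qed.

Section RightLifting.
Variables (s u v : W).
Hypotheses (hs : simple W s) (huv : u <=b v).

Lemma rlift_le : rd s v -> u * s <=b v.
Proof.
move=> h; apply/br_invE; rewrite invMg (simple_inv hs).
by apply: lift_le; rewrite ?ldV //; exact: br_inv.
Qed.

Lemma rlift_up : rd s v -> ~~ rd s u -> u <=b v * s.
Proof.
move=> h hu; apply/br_invE; rewrite invMg (simple_inv hs).
by apply: lift_up; rewrite ?ldV //; exact: br_inv.
Qed.

Lemma rlift_dn : rd s v -> rd s u -> u * s <=b v * s.
Proof.
move=> h hu; apply/br_invE; rewrite !invMg (simple_inv hs).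
by apply: lift_dn; rewrite ?ldV //; exact: br_inv.
Qed.

Lemma rlift_both : ~~ rd s v -> u * s <=b v * s.
Proof.
move=> h; apply/br_invE; rewrite !invMg (simple_inv hs).
by apply: lift_both; rewrite ?ldV //; exact: br_inv.
Qed.
End RightLifting.

Lemma br1 w : 1 <=b w.
Proof.
have [n] := ubnP (len w); elim: n w => // n IH w hn.
have [->|hw] := pselect (w = 1); first exact: br_refl.
have [s hs h] := ex_ld hw; apply: br_trans (br_dn hs h).
by apply: IH; move: h hn; rewrite /ld; lia.
Qed.

Definition reduced l := sword l /\ len (prodw l) = size l.

Lemma reduced_cons s l : reduced (s :: l) ->
  [/\ simple W s, reduced l & ~~ ld s (prodw l)].
Proof.
case=> /sword_cons[hs hl] /= e; have h := len_word hl.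
rewrite prodw_cons in e; split=> //; first split=> //.
  by have := len_sl (prodw l) hs; lia.
by rewrite /ld; lia.
Qed.

Lemma reduced_consI s l : simple W s -> reduced l -> ~~ ld s (prodw l) ->
  reduced (s :: l).
Proof.
move=> hs [hl e] h; split; first exact/sword_cons.
by rewrite prodw_cons ldN_len // e.
Qed.

Lemma exists_reduced w : exists2 l, reduced l & prodw l = w.
Proof. by have [l [h1 <- h3]] := reduced_word w; exists l. Qed.

Lemma br_subword l u : reduced l -> u <=b prodw l ->
  exists l', [/\ reduced l', subseq l' l & prodw l' = u].
Proof.
elim: l u => [|s l IH] u hl hu.
  exists [::]; split=> //; rewrite prodw_nil.
  by apply/esym/len_eq0/eqP; rewrite -leqn0 (leq_trans (br_leq hu)) // prodw_nil len1.
have [hs rl hd] := reduced_cons hl; rewrite prodw_cons in hu.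
have hd' : ld s (s * prodw l) by rewrite ldM.
have [h|h] := boolP (ld s u).
  have := lift_dn hs hu hd' h; rewrite simpleK // => /(IH _ rl)[l' [h1 h2 h3]].
  exists (s :: l'); split; rewrite /= ?eqxx //; last by rewrite prodw_cons h3 simpleK.
  by apply: reduced_consI => //; rewrite h3 ldM // h.
have := lift_up hs hu hd' h; rewrite simpleK // => /(IH _ rl)[l' [h1 h2 h3]].
by exists l'; split=> //; apply: subseq_trans h2 (subseq_cons _ _).
Qed.

Lemma subword_br l l' : reduced l -> subseq l' l -> prodw l' <=b prodw l.
Proof.
elim: l l' => [|s l IH] l' hl; first by rewrite subseq0 => /eqP->; exact: br_refl.
have [hs rl hd] := reduced_cons hl.
have up : prodw l <=b prodw (s :: l) by rewrite prodw_cons; exact: br_up.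
case: l' => [_|r l'] /=; first by rewrite prodw_nil; exact: br1.
case: eqP => [->|_] /(IH _ rl) h; last exact: br_trans up.
by rewrite !prodw_cons; exact: lift_both.
Qed.

(** The deletion property: when prepending a letter to a reduced word destroys reducedness, exchange
    removes that letter together with another one. *)
Lemma reduced_sub l : sword l ->
  exists l', [/\ reduced l', subseq l' l & prodw l' = prodw l].
Proof.
have [n] := ubnP (size l); elim: n l => // n IH [|s l] /= hn hl.
  by exists [::]; split=> //; split; rewrite // prodw_nil len1.
case/sword_cons: hl => hs hl; have [|l' [[h1 h1'] h2 h3]] := IH l _ hl; first by lia.
have [h|h] := boolP (ld s (prodw l')); last first.
  exists (s :: l'); split; rewrite /= ?eqxx ?prodw_cons ?h3 //.
  exact: reduced_consI.
have [l1 [r [l2 [e1 e2]]]] := exchange hs h1 h.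
have hs12 : subseq (l1 ++ l2) l'.
  by rewrite e1; apply: cat_subseq => //; exact: subseq_cons.
have [||l'' [g1 g2 g3]] := IH (l1 ++ l2).
- have := size_subseq h2; rewrite e1 !size_cat /=; lia.
- exact: sword_subseq hs12 h1.
exists l''; split=> //; last by rewrite g3 -e2 h3 prodw_cons.
rewrite -[X in is_true X]/(subseq l'' (s :: l)). apply: (subseq_trans (subseq_trans g2 (subseq_trans hs12 h2))).
exact: subseq_cons.
Qed.

Lemma supp_word l s : sword l -> simple W s -> s <=b prodw l -> s \in l.
Proof.
move=> hl hs; have [l' [h1 h2 <-]] := reduced_sub hl.
case/(br_subword h1) => [[|r [|? ?]] [[h3 h3'] h4 h5]].
- by case: (simple_neq1 hs); rewrite -h5 prodw_nil.
- rewrite -h5 prodw_seq1; apply: (mem_subseq h2); apply: (mem_subseq h4).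
  by rewrite inE.
- by rewrite h5 len_simple in h3'.
Qed.

Definition cov u v := u <=b v /\ len v = (len u).+1.

(** The Bruhat order is graded by length. With a left descent [s] of [v] shared by [u], a coatom of
    [s * v] above [s * u] is lifted back through [s]; if [s] is already a descent of that coatom,
    then [u] lies below [s * v], which is itself a coatom of [v]. *)
Lemma br_cov u v : u <=b v -> u <> v -> exists2 x, u <=b x & cov x v.
Proof.
have [n] := ubnP (len v); elim: n u v => // n IH u v hn huv ne.
have v1 : v <> 1 by move=> e; apply: ne; apply: br_eq huv _; rewrite e len1.
have [s hs h] := ex_ld v1; have lv := ld_len hs h.
have csv : cov (s * v) v by split=> //; exact: br_dn.
have [hd|hd] := boolP (ld s u); last by exists (s * v) => //; exact: lift_up.
have [e|ne'] := pselect (u <=b s * v); first by exists (s * v).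
have [|||x1 h1 [h2 h3]] := IH (s * u) (s * v).
- by lia.
- exact: lift_dn.
- by move=> e; apply: ne; rewrite -(simpleK hs u) e simpleK.
have [hx|hx] := boolP (ld s x1).
  by case: ne'; apply: br_trans h2; rewrite -(simpleK hs u); exact: lift_le.
exists (s * x1).
  by rewrite -(simpleK hs u); apply: lift_both.
split; last by rewrite ldN_len // lv h3.
by apply: lift_le => //; apply: br_trans h2 _; exact: br_dn.
Qed.

(** A coatom of [v] without the descent [s] lies below [s * v] by lifting, and has the same
    length. *)
Lemma cov_ld s u v : simple W s -> cov u v -> ld s v -> u <> s * v -> ld s u.
Proof.
move=> hs [h1 h2] h3 ne; apply/negPn/negP => h4; apply: ne.
by apply: br_eq (lift_up hs h1 h3 h4) _; have := ld_len hs h3; lia.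
Qed.

Lemma cov_ld' s u v : simple W s -> cov u v -> ~~ ld s u -> ld s v -> v = s * u.
Proof.
move=> hs huv h1 h2; have [->|ne] := pselect (u = s * v); first by rewrite simpleK.
by rewrite (cov_ld hs huv h2 ne) in h1.
Qed.

(** * Standard parabolic subgroups *)

(** The standard parabolic subgroup of the letters in [J]. Keeping [J] an arbitrary predicate allows
    properties of a matching, such as [lgood w M], to serve as letter sets. *)
Definition inW J b := exists l, [/\ sword l, (forall s, s \in l -> J s) & prodw l = b].

Lemma inW1 J : inW J 1.
Proof. by exists [::]; split=> //; rewrite prodw_nil. Qed.

Lemma inWM J b c : inW J b -> inW J c -> inW J (b * c).
Proof.
case=> l1 [h1 h2 <-] [l2 [h3 h4 <-]]; exists (l1 ++ l2); split.
- exact/sword_cat.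
- by move=> s; rewrite mem_cat => /orP[/h2|/h4].
- by rewrite prodw_cat.
Qed.

Lemma inWV J b : inW J b -> inW J b^-1.
Proof.
case=> l [h1 h2 <-]; exists (rev l); split; first exact/sword_rev.
  by move=> s; rewrite mem_rev => /h2.
exact: prodw_rev.
Qed.

Lemma inWVE J b : inW J b^-1 <-> inW J b.
Proof. by split=> /inWV //; rewrite invgK. Qed.

Lemma inWs J s : simple W s -> J s -> inW J s.
Proof.
move=> hs js; exists [:: s]; rewrite prodw_seq1; split=> // r; by rewrite inE => /eqP->.
Qed.

Lemma inW_red J b : inW J b ->
  exists l, [/\ reduced l, (forall s, s \in l -> J s) & prodw l = b].
Proof.
case=> l [h1 h2 <-]; have [l' [g1 g2 g3]] := reduced_sub h1.
by exists l'; split=> // s /(mem_subseq g2)/h2.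
Qed.

Lemma inW_le J u v : u <=b v -> inW J v -> inW J u.
Proof.
move=> huv /inW_red[l [h1 h2 e]]; rewrite -e in huv.
have [l' [g1 g2 <-]] := br_subword h1 huv.
by exists l'; split=> //; [case: g1|move=> s /(mem_subseq g2)/h2].
Qed.

Lemma inW_supp J s b : inW J b -> simple W s -> s <=b b -> J s.
Proof. by case=> l [h1 h2 <-] hs /(supp_word h1 hs)/h2. Qed.

Lemma inWP J b : (forall s, simple W s -> s <=b b -> J s) -> inW J b.
Proof.
have [l hl <-] := exists_reduced b => h; case: (hl) => h1 h2.
exists l; split=> // s sl; apply: h; first exact: h1.
by rewrite -(prodw_seq1 s); apply: subword_br => //; rewrite sub1seq.
Qed.

Lemma inW_sub J K b : (forall s, simple W s -> s <=b b -> J s -> K s) ->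
  inW J b -> inW K b.
Proof. by move=> h hb; apply: inWP => s hs hsb; apply: h => //; exact: inW_supp hb hs hsb. Qed.

Lemma simple_br s t : simple W s -> simple W t -> s <=b t -> s = t.
Proof. by move=> hs ht h; apply: br_eq => //; rewrite !len_simple. Qed.

Lemma supp_mul s x y : simple W s -> s <=b x * y -> s <=b x \/ s <=b y.
Proof.
move=> hs; have [l1 h1 <-] := exists_reduced x; have [l2 h2 <-] := exists_reduced y.
case: (h1) (h2) => g1 _ [g2 _].
rewrite -prodw_cat => /(supp_word _ hs); rewrite sword_cat => /(_ (conj g1 g2)).
rewrite mem_cat => /orP[h|h]; [left|right]; rewrite -(prodw_seq1 s); apply: subword_br => //;
  by rewrite sub1seq.
Qed.

Definition noJ J x := forall s, simple W s -> J s -> ~~ ld s x.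

Lemma ld_le s w : simple W s -> ld s w -> s <=b w.
Proof.
by move=> hs h; have := lift_le hs (br1 w) h; rewrite mulg1.
Qed.

Lemma rd_le s w : simple W s -> rd s w -> s <=b w.
Proof.
by move=> hs h; have := rlift_le hs (br1 w) h; rewrite mul1g.
Qed.

Lemma cat_delete (T : eqType) (l1 l2 m1 m2 : seq T) r : l1 ++ l2 = m1 ++ r :: m2 ->
  (exists k, l1 = m1 ++ r :: k /\ m2 = k ++ l2) \/
  (exists k, m1 = l1 ++ k /\ l2 = k ++ r :: m2).
Proof.
elim: l1 m1 => [|s l1 IH] [|q m1] /=; [by right; exists [::]|by right; exists (q :: m1)| |].
  by case=> <- <-; left; exists l1.
case=> <- /IH[[k [-> ->]]|[k [-> ->]]]; [left|right]; by exists k.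
Qed.

(** Otherwise exchange deletes a letter from a reduced word of [s * b] or from one of [x]. The first
    makes [b] shorter than it is, the second gives a shorter element in the coset of [x]. *)
Lemma coset_min J b x : (forall b, inW J b -> (len x <= len (b * x))%N) ->
  inW J b -> len (b * x) = (len b + len x)%N.
Proof.
move=> hx; have [n] := ubnP (len b); elim: n b => // n IH b hn hb.
have [->|ne] := pselect (b = 1); first by rewrite mul1g len1.
have [s hs h] := ex_ld ne; have js := inW_supp hb hs (ld_le hs h).
have hb' : inW J (s * b) by apply: inWM => //; exact: inWs.
have lb := ld_len hs h; have lb' : len (s * b * x) = (len (s * b) + len x)%N by apply: IH => //; lia.
suff : ~~ ld s (s * b * x).
  by move=> /(ldN_len hs); rewrite !wmulA simple_sqr // mul1g => ->; rewrite lb' lb.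
apply/negP => hd.
have [l1 [[r1 r1'] e1]] : exists l1, reduced l1 /\ prodw l1 = s * b.
  by have [l1] := exists_reduced (s * b); exists l1.
have [l2 [r2 r2'] e2] := exists_reduced x.
rewrite -e1 -e2 -prodw_cat in hd.
have h12 : sword (l1 ++ l2) by apply/sword_cat.
have [m1 [r [m2 [e3 e4]]]] := exchange hs h12 hd.
rewrite prodw_cat e1 e2 in e4.
case: (cat_delete e3) => [[k [e5 e6]]|[k [e5 e6]]].
  have : s * (s * b) = prodw (m1 ++ k).
    by apply: (mulIg x); rewrite -wmulA e4 e6 !prodw_cat e2 wmulA.
  rewrite simpleK // => eb; move: r1; rewrite e5 sword_cat sword_cons => -[g1 [_ g2]].
  have := @len_word _ (m1 ++ k); rewrite sword_cat => /(_ (conj g1 g2)).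
  rewrite -eb lb -e1 r1' e5 !size_cat /=; lia.
have e7 : (s * b)^-1 * (s * (s * b)) * x = prodw (k ++ m2).
  rewrite -wmulA -(wmulA s) e4 e5 -catA prodw_cat e1 mulKg //.
have := hx ((s * b)^-1 * (s * (s * b))); rewrite e7.
have hbb : inW J ((s * b)^-1 * (s * (s * b))).
  by apply: inWM; [exact: inWV|apply: inWM => //; exact: inWs].
move=> /(_ hbb); move: r2; rewrite -{1}e2 r2' e6 sword_cat sword_cons => -[g1 [_ g2]].
have := @len_word _ (k ++ m2); rewrite sword_cat => /(_ (conj g1 g2)).
rewrite !size_cat /=; lia.
Qed.

(** Let [b0 * x] be shortest in the coset. If [b0] is not 1, then by additivity a left descent of
    [b0^-1] is a left descent of [x]. *)
Lemma noJ_min J x : noJ J x ->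
  forall b, inW J b -> (len x <= len (b * x))%N.
Proof.
move=> hx.
have hex : exists n, `[< exists b, inW J b /\ len (b * x) = n >].
  by exists (len x); apply/asboolP; exists 1; split; [exact: inW1|rewrite mul1g].
case: (ex_minnP hex) => n /asboolP[b0 [hb0 e0]] hmin b hb.
have hm b' : inW J b' -> (len (b0 * x) <= len (b' * (b0 * x)))%N.
  move=> hb'; rewrite e0; apply: hmin; apply/asboolP; exists (b' * b0).
  by rewrite wmulA; split=> //; exact: inWM.
have h := @coset_min J b0^-1 (b0 * x) hm (inWV hb0).
rewrite mulKg in h.
have [e|ne] := pselect (b0^-1 = 1).
  have eb : b0 = 1 by rewrite -(invgK b0) e invg1.
  by move: (hm b hb); rewrite eb !mul1g.
have [s hs hd] := ex_ld ne.
have js : J s by apply: inW_supp (inWV hb0) hs (ld_le hs hd).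
case/negP: (hx s hs js); rewrite /ld h.
have := @coset_min J (s * b0^-1) (b0 * x) hm; rewrite -wmulA mulKg => ->.
  by rewrite ltn_add2r.
by apply: inWM; [exact: inWs|exact: inWV].
Qed.

Lemma coset_add J b x : noJ J x -> inW J b -> len (b * x) = (len b + len x)%N.
Proof. by move=> /noJ_min; exact: coset_min. Qed.

Lemma coset_dec J w : exists a x,
  [/\ inW J a, noJ J x, w = a * x & len w = (len a + len x)%N].
Proof.
have [n] := ubnP (len w); elim: n w => // n IH w hn.
have [h|] := pselect (noJ J w).
  by exists 1, w; rewrite mul1g len1; split=> //; exact: inW1.
move=> /existsNP[s /not_implyP[hs /not_implyP[js /negP/negPn hd]]].
have [|a [x [h1 h2 e l]]] := IH (s * w); first by have := ld_len hs hd; lia.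
have ha : inW J (s * a) by apply: inWM => //; exact: inWs.
exists (s * a), x; split=> //; first by rewrite -wmulA -e simpleK.
by rewrite -(coset_add h2 ha) -wmulA -e simpleK.
Qed.

Lemma coset_ld J b x s : noJ J x -> inW J b -> simple W s -> J s ->
  ld s (b * x) = ld s b.
Proof.
move=> hx hb hs js; have hsb := inWM (inWs hs js) hb.
by rewrite /ld wmulA (coset_add hx hsb) (coset_add hx hb) ltn_add2r.
Qed.

Definition rnoJ J x := forall s, simple W s -> J s -> ~~ rd s x.

Lemma rnoJV J x : rnoJ J x <-> noJ J x^-1.
Proof. by split=> h s hs js; [rewrite ldV|rewrite -ldV] => //; exact: h. Qed.

Lemma rcoset_dec J w : exists x a,
  [/\ inW J a, rnoJ J x, w = x * a & len w = (len x + len a)%N].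
Proof.
have [a [x [h1 h2 e l]]] := coset_dec J w^-1.
exists x^-1, a^-1; split; first exact: inWV.
- by apply/rnoJV; rewrite invgK.
- by rewrite -invMg -e invgK.
- by rewrite !lenV -(lenV w) l addnC.
Qed.

Lemma rcoset_add J b x : rnoJ J x -> inW J b -> len (x * b) = (len x + len b)%N.
Proof.
move=> /rnoJV hx hb; rewrite -lenV invMg (coset_add hx (inWV hb)) !lenV; exact: addnC.
Qed.

(** * Elements with the same coatoms *)

Definition dih a b : W -> Prop := inW (fun s => s = a \/ s = b).

Lemma dihC a b w : dih a b w -> dih b a w.
Proof. by apply: inW_sub => s _ _ [->|->]; [right|left]. Qed.

(** The only coatom of [u] without the left descent [s] is [s * u]. Write [v = a * x] with [a] in
    the subgroup of [s] and [t]. If [x] is not 1, shortening [x] or [a] on the right gives two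
    different coatoms of [v] without the descent [s], which is one too many. So [v] is in the
    dihedral subgroup, and so is [u] through the common coatom [s * u]. *)
Lemma same_coatoms_ld s u v : simple W s -> len u = len v -> (0 < len u)%N ->
  (forall c, cov c u <-> cov c v) -> ld s u -> ~~ ld s v ->
  exists2 t, simple W t & dih s t u /\ dih s t v.
Proof.
move=> hs elen u0 hc hu hv.
have v1 : v <> 1 by move=> e; rewrite elen e len1 in u0.
have [t ht hvt] := ex_ld v1; exists t => //.
have hsu : forall c, cov c u -> ~~ ld s c -> c = s * u.
  by move=> c h1; apply: contraNP => h2; exact: cov_ld h1 hu h2.
set J := fun r => r = s \/ r = t.
have [a [x [ha hx e l]]] := coset_dec J v.
have js : J s by left.
have hsa : ~~ ld s a by rewrite -(coset_ld hx ha hs js) -e.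
have a1 : a <> 1.
  by move=> ea; move: (hx t ht (or_intror erefl)); rewrite e ea mul1g in hvt; rewrite hvt.
suff x1 : x = 1.
  have dv : dih s t v by rewrite e x1 mulg1.
  split=> //; have /hc[h1 _] : cov (s * u) u by split; [exact: br_dn|exact: ld_len].
  rewrite -(simpleK hs u); apply: inWM; first exact: inWs.
  exact: inW_le h1 dv.
apply: contrapT => x1.
have [c hcs hcx] := ex_rd x1; have lx := rd_len hcs hcx.
have hx1 : noJ J (x * c).
  move=> r hr jr; apply/negP => hd; move: (hx r hr jr).
  rewrite /ld -leqNgt; have := len_sr (r * x) hcs.
  move: hd; rewrite /ld wmulA; have := len_sl x hr; move: lx; clear; lia.
have c1 : cov (a * (x * c)) v.
  have l1 := coset_add hx1 ha; split; last by rewrite l1 l lx addnS.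
  rewrite e wmulA; apply: br_rdn => //; rewrite /rd -wmulA l1 -e l lx; lia.
have [d hds hda] := ex_rd a1; have la := rd_len hds hda.
have jd : J d by apply: inW_supp ha hds (rd_le hds hda).
have had : inW J (a * d) by apply: inWM => //; exact: inWs.
have l2 := coset_add hx had.
have c2 : cov (a * d * x) v.
  split; last by rewrite l2 l la.
  apply: rt_step; exists (cj x^-1 d); split.
  - exact/reflection_cj/reflection_simple.
  - by rewrite /cj invgK !wmulA mulgK -(wmulA a) simple_sqr // mulg1 e.
  - by rewrite l2 l la.
have hsad : ~~ ld s (a * d).
  rewrite /ld -leqNgt; have := len_sr (s * a) hds; move: hsa; rewrite /ld wmulA.
  have := len_sl a hs; lia.
have h1 : ~~ ld s (a * (x * c)) by rewrite (coset_ld hx1 ha hs js).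
have h2 : ~~ ld s (a * d * x) by rewrite (coset_ld hx had hs js).
have : a * (x * c) = a * d * x.
  by rewrite (hsu _ ((hc _).2 c1) h1) (hsu _ ((hc _).2 c2) h2).
rewrite -(wmulA a d) => /mulgI e3.
have := coset_add hx (inWs hds jd); rewrite -e3 (len_simple hds) lx; clear; lia.
Qed.

(** If [u] and [v] share a left descent [s], then [s * u] is a coatom of [v] without that descent,
    hence equals [s * v]; only the situation of [same_coatoms_ld] remains. *)
Lemma same_coatoms u v : len u = len v -> (0 < len u)%N ->
  (forall c, cov c u <-> cov c v) -> u <> v ->
  exists a b, [/\ simple W a, simple W b, dih a b u & dih a b v].
Proof.
move=> elen u0 hc ne.
have u1 : u <> 1 by move=> e; rewrite e len1 in u0.
have [s hs hu] := ex_ld u1.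
have [hv|hv] := boolP (ld s v); last first.
  by have [t ht [h1 h2]] := same_coatoms_ld hs elen u0 hc hu hv; exists s, t.
case: ne; rewrite -(simpleK hs u) -(simpleK hs v); congr (_ * _).
have h : cov (s * u) u by split; [exact: br_dn|exact: ld_len].
apply: contrapT => ne; have := cov_ld hs ((hc _).1 h) hv ne.
by rewrite ldM // hu.
Qed.

End Bruhat.

Section Special.
Variable W : coxeterSystem.
Implicit Types (s t u v x y z f a b c d : W) (l : seq W).
Local Open Scope group_scope.

(** Take a left descent [p] of [f * x] and split [x = a * y] along the subgroup of [f] and [p]. Then
    [a^-1 * f * a] moves past [y] to become [t], so it is a letter [j] with [f * a = a * j]. Hence
    [p * a = p * (f * a) * j] is shorter than [a], and [p] is a descent of [x] too. *)
Lemma commuting_descents f t x : simple W f -> simple W t ->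
  ld f x -> rd t x -> f * x = x * t -> (1 < len x)%N ->
  exists p, [/\ simple W p, p <> f & ld p x].
Proof.
move=> hf ht df dt e l1.
have ne : f * x <> 1 by move=> e1; have := ld_len hf df; rewrite e1 len1 => l2; rewrite l2 in l1.
have [p hp dp] := ex_ld ne.
have pf : p <> f by move=> epf; move: dp; rewrite epf ldM // df.
exists p; split=> //; apply/negPn/negP => np.
set J := fun r => r = f \/ r = p.
have jf : J f by left.
have jp : J p by right.
have [a [y [ha hy exy lx]]] := coset_dec J x.
have eyt : y * t = (a^-1 * f * a) * y.
  apply: (mulgI a); rewrite wmulA -exy -e exy !wmulA mulgV mul1g //.
have hj : inW J (a^-1 * f * a).
  by apply: inWM => //; apply: inWM; [exact: inWV|exact: inWs].
have lj : len (a^-1 * f * a) = 1%N.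
  have := coset_add hy hj; rewrite -eyt; have := len_sr y ht.
  have : len (a^-1 * f * a) <> 0%N; last by lia.
  move=> /len_eq0 h; apply: (simple_neq1 hf); apply: (mulIg a).
  by rewrite mul1g -[RHS]mulg1 -h !wmulA mulgV mul1g.
set j := a^-1 * f * a in eyt hj lj.
have aj : a * j = f * a by rewrite /j !wmulA mulgV mul1g.
have dfa : ld f a by rewrite -(coset_ld hy ha hf jf) -exy.
have [e1|ne1] := pselect (f * a = 1).
  have ea : a = f by rewrite -[LHS](simpleK hf) e1 mulg1.
  by move: (hy p hp jp); rewrite exy ea simpleK // in dp; rewrite dp.
have [r hr dr] := ex_ld ne1.
have jr : J r by apply: inW_supp (inWM (inWs hf jf) ha) hr (ld_le hr dr).
case: jr => er; first by move: dr; rewrite er ldM // dfa.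
rewrite er in dr; case/negP: np; rewrite exy (coset_ld hy ha hp jp).
rewrite /ld (ld_len hf dfa); apply: leq_trans (ltnSn _).
have -> : p * a = p * (f * a) * j.
  by rewrite -aj -wmulA -(wmulA a) (simple_sqr (len_eq1 lj)) mulg1.
have := len_mul (p * (f * a)) j; rewrite lj; move: dr; rewrite /ld; clear; lia.
Qed.

Lemma commuting_descents_right f t x : simple W f -> simple W t ->
  ld f x -> rd t x -> f * x = x * t -> (1 < len x)%N ->
  exists p, [/\ simple W p, p <> t & rd p x].
Proof.
move=> hf ht df dt e l1.
have [||||p [hp ne dp]] := @commuting_descents t f x^-1 ht hf.
- by rewrite ldV.
- by rewrite rdV.
- by rewrite -{1}(simple_inv ht) -invMg -e invMg (simple_inv hf).
- by rewrite lenV.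
by exists p; split=> //; rewrite -ldV.
Qed.

(** * Dihedral subgroups *)

Fixpoint alt a b n : seq W := if n is n'.+1 then a :: alt b a n' else [::].

Lemma size_alt a b n : size (alt a b n) = n.
Proof. by elim: n a b => //= n IH a b; rewrite IH. Qed.

Lemma reduced_alt a b l : reduced l -> (forall r, r \in l -> r = a \/ r = b) ->
  l = alt a b (size l) \/ l = alt b a (size l).
Proof.
elim: l => [|r l IH] hl hr; first by left.
have [hs rl hd] := reduced_cons hl.
have hr' : forall q, q \in l -> q = a \/ q = b.
  by move=> q ql; apply: hr; rewrite inE ql orbT.
have ne c d : l = alt c d (size l) -> r = c -> l = [::].
  case: (l) hd rl => [|q m] //= hd rl [eq _] er.
  have [hq _ hm] := reduced_cons rl.
  by move: hd; rewrite prodw_cons er -eq ldM // hm.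
case: (IH rl hr') => e; case: (hr r (mem_head _ _)) => er.
- by left; rewrite (ne _ _ e er) er.
- by right; rewrite /= -e er.
- by left; rewrite /= -e er.
- by right; rewrite (ne _ _ e er) er.
Qed.

Lemma dih_alt a b x : dih a b x ->
  x = prodw (alt a b (len x)) \/ x = prodw (alt b a (len x)).
Proof.
case/inW_red => l [hl h <-]; rewrite (proj2 hl).
by case: (reduced_alt hl h) => <-; [left|right].
Qed.

(** The shorter alternating word is a prefix of the longer one or of its tail. *)
Lemma dih_le a b x y : dih a b x -> dih a b y -> (len x < len y)%N -> x <=b y.
Proof.
move=> hx hy; wlog ey : a b hx hy / exists2 l, reduced l & l = alt a b (len y) /\ y = prodw l.
  move=> hw; case/inW_red: (hy) => l [hl h ey].
  have sl : size l = len y by rewrite -ey (proj2 hl).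
  case: (reduced_alt hl h) => el.
    by apply: (hw a b) => //; exists l; rewrite // -{1}sl.
  by apply: (hw b a); [exact: dihC|exact: dihC|exists l; rewrite // -{1}sl].
case: ey => l hl [el ->]; rewrite (proj2 hl) el size_alt => hlt.
rewrite el in hl.
have hsub n m c d : (n <= m)%N -> subseq (alt c d n) (alt c d m).
  elim: n m c d => [|n IH] [|m] c d //=.
  by rewrite eqxx ltnS => /IH.
have hsub' n m c d : (n < m)%N -> subseq (alt d c n) (alt c d m).
  case: m => // m; rewrite ltnS => /(@hsub _ _ d c) h.
  exact: subseq_trans h (subseq_cons _ _).
case: (dih_alt hx) => ->; apply: subword_br => //; [apply: hsub; exact: ltnW|exact: hsub'].
Qed.

(* All that is used of the bounds [m(a, b) <= 4]. *)
Definition dl4 := forall a b x y : W, simple W a -> simple W b ->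
  dih a b x -> dih a b y -> len x = len y -> (4 <= len x)%N -> x = y.

Lemma prodw2 a b : prodw [:: a; b] = a * b.
Proof. by rewrite prodw_cons prodw_seq1. Qed.

Lemma dih_len1 a b x : dih a b x -> len x = 1%N -> x = a \/ x = b.
Proof. by move=> /dih_alt h e; move: h; rewrite e /= !prodw_seq1. Qed.

Lemma dih_len2 a b x : dih a b x -> len x = 2 -> x = a * b \/ x = b * a.
Proof. by move=> /dih_alt h e; move: h; rewrite e /= !prodw2. Qed.

Lemma dih_len3 a b x : dih a b x -> len x = 3 -> x = a * b * a \/ x = b * a * b.
Proof. by move=> /dih_alt h e; move: h; rewrite e /= !prodw_cons !prodw_nil !mulg1 !wmulA. Qed.

Lemma dih_gen a b : simple W a -> simple W b -> dih a b a /\ dih a b b.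
Proof. by move=> ha hb; split; apply: inWs => //; [left|right]. Qed.

Lemma len2 a b : simple W a -> simple W b -> a <> b -> len (a * b) = 2.
Proof.
move=> ha hb ne; case: (len_sl b ha); rewrite (len_simple hb) // => -[/esym/len_eq0 e].
by case: ne; rewrite -(simple_inv ha); apply: mulg1_eq.
Qed.

(** * Special matchings *)

(* Special matchings of the lower interval [1, w]; the values of [M] outside this
   interval are irrelevant. *)
Record special (w : W) (M : W -> W) : Prop := Special {
  sm_le : forall u, u <=b w -> M u <=b w;
  sm_K : forall u, u <=b w -> M (M u) = u;
  sm_cov : forall u, u <=b w -> cov u (M u) \/ cov (M u) u;
  sm_sp : forall u v, v <=b w -> cov u v -> M u <> v -> M u <=b M v
}.

Definition up (M : W -> W) u : bool := (len u < len (M u))%N.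

Section OneMatching.
Variables (w : W) (M : W -> W).
Hypothesis HM : special w M.

Lemma up_cov u : u <=b w -> up M u -> cov u (M u).
Proof. by move=> /(sm_cov HM)[] // [h1 h2]; rewrite /up h2; clear; lia. Qed.

Lemma dn_cov u : u <=b w -> ~~ up M u -> cov (M u) u.
Proof. by move=> /(sm_cov HM)[] // [h1 h2]; rewrite /up h2; clear; lia. Qed.

Lemma upM u : u <=b w -> up M (M u) = ~~ up M u.
Proof.
move=> hu; rewrite /up (sm_K HM) //; case: (sm_cov HM hu) => [[_ ->]|[_ ->]].
  by clear; lia.
by clear; lia.
Qed.

Lemma sm_w : ~~ up M w.
Proof.
have h := br_refl w; apply/negP => /(up_cov h)[_ e].
by have := br_leq (sm_le HM h); rewrite e ltnn.
Qed.

(** The lifting property for special matchings: descend from [y] along covers, with [sm_sp] in the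
    place of [step_mul]. *)
Lemma sm_lift_l x y : y <=b w -> x <=b y -> M x <=b y \/ M x <=b M y.
Proof.
have [n] := ubnP (len y); elim: n y => // n IH y hn hy hxy.
have [->|ne] := pselect (x = y); first by right; exact: br_refl.
have [y' h1 h2] := br_cov hxy ne; have hy' := br_trans (proj1 h2) hy.
case: (IH y' _ hy' h1) => [|h|h]; first by case: h2 => _; lia.
  by left; apply: br_trans (proj1 h2).
have [e|ne'] := pselect (M y' = y); first by left; rewrite -e.
by right; apply: br_trans h (sm_sp HM hy h2 ne').
Qed.

Lemma sm_lift_r x y : y <=b w -> x <=b y -> x <=b M y \/ M x <=b M y.
Proof.
have [n] := ubnP (len y); elim: n y => // n IH y hn hy hxy.
have [->|ne] := pselect (x = y); first by right; exact: br_refl.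
have [y' h1 h2] := br_cov hxy ne; have hy' := br_trans (proj1 h2) hy.
have [e|ne'] := pselect (M y' = y).
  by left; rewrite -e (sm_K HM).
case: (IH y' _ hy' h1) => [|h|h]; first by case: h2 => _; lia.
  by left; apply: br_trans h (sm_sp HM hy h2 ne').
by right; apply: br_trans h (sm_sp HM hy h2 ne').
Qed.

Section Lift.
Variables (x y : W).
Hypotheses (hy : y <=b w) (hxy : x <=b y).
Let hx : x <=b w := br_trans hxy hy.

Lemma sm_up : up M y -> M x <=b M y.
Proof.
move=> /(up_cov hy)[h _]; case: (sm_lift_l hy hxy) => // h2; exact: br_trans h.
Qed.

Lemma sm_dn_le : ~~ up M y -> M x <=b y.
Proof.
move=> /(dn_cov hy)[h _]; case: (sm_lift_l hy hxy) => // h2; exact: br_trans h.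
Qed.

Lemma sm_dn_up : ~~ up M y -> up M x -> x <=b M y.
Proof.
move=> /(dn_cov hy)[h _] /(up_cov hx)[h' _].
by case: (sm_lift_r hy hxy) => // h2; exact: br_trans h2.
Qed.

Lemma sm_dn_dn : ~~ up M y -> ~~ up M x -> M x <=b M y.
Proof.
move=> /(dn_cov hy)[h _] /(dn_cov hx)[h' _].
by case: (sm_lift_r hy hxy) => // h2; apply: br_trans h2.
Qed.
End Lift.

Lemma special_res v : v <=b w -> ~~ up M v -> special v M.
Proof.
move=> hv dv; split=> [u hu|u hu|u hu|u z hz].
- exact: sm_dn_le.
- by apply: (sm_K HM); exact: br_trans hv.
- by apply: (sm_cov HM); exact: br_trans hv.
- by apply: (sm_sp HM); exact: br_trans hv.
Qed.

Lemma M1_simple : w <> 1 -> simple W (M 1).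
Proof.
move=> ne; apply: len_eq1; case: (sm_cov HM (br1 w)) => [[_]|[_]]; rewrite len1 //.
Qed.

Lemma M1_le : M 1 <=b w. Proof. exact/(sm_le HM)/br1. Qed.

Lemma up_M1 : up M 1.
Proof.
by case: (sm_cov HM (br1 w)) => [[_]|[_]]; rewrite /up len1 // => ->.
Qed.

Lemma up_M1_le u : u <=b w -> up M u -> M 1 <=b M u.
Proof. by move=> hu; apply: sm_up => //; exact: br1. Qed.

End OneMatching.

(** Inversion preserves the order and exchanges left and right, so statements about right
    multiplications follow from those about left ones. *)
Lemma special_inv w M : special w M -> special w^-1 (fun u => (M u^-1)^-1).
Proof.
have hi u v : u <=b v^-1 -> u^-1 <=b v by move/br_inv; rewrite invgK.
have ci u v : cov u v -> cov u^-1 v^-1.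
  by case=> h e; split; [exact: br_inv|rewrite !lenV].
move=> HM; split=> [u /hi hu|u /hi hu|u /hi hu|u v /hi hv /ci h ne].
- by apply/br_inv/(sm_le HM).
- by rewrite invgK (sm_K HM) // invgK.
- by case: (sm_cov HM hu) => /ci; rewrite invgK; [left|right].
- apply: br_inv; apply: (sm_sp HM) => // e; apply: ne.
  by rewrite e invgK.
Qed.

Lemma special_left s w : simple W s -> ld s w -> special w (mulg s).
Proof.
move=> hs dw; split=> [u hu|u hu|u hu|u v hv h ne].
- exact: lift_le.
- exact: simpleK.
- have [h|h] := boolP (ld s u); [right|left]; split.
  + exact: br_dn.
  + exact: ld_len.
  + exact: br_up.
  + exact: ldN_len.
- have [d|d] := boolP (ld s v); last by apply: lift_both => //; case: h.
  have [d'|d'] := boolP (ld s u); first by apply: lift_dn => //; case: h.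
  by case: ne; rewrite (cov_ld' hs h d' d).
Qed.

End Special.

(** * Matchings commuting with multiplications *)

Section Commutation.
Variable W : coxeterSystem.
Implicit Types (s t u v x y z f g a b c d : W) (l : seq W).
Local Open Scope group_scope.

(** A coatom of [M x] other than [x] is sent below [x] by [sm_sp]; comparing lengths, [M] must go
    down from it, onto a coatom of [x]. *)
Lemma coatom_M w M x c : special w M -> x <=b w -> up M x -> cov c (M x) ->
  c = x \/ exists c', [/\ c = M c', cov c' x & up M c'].
Proof.
move=> HM hx ux h; have [->|ne] := pselect (c = x); [by left|right].
have hMx := sm_le HM hx; have hc := br_trans (proj1 h) hMx.
have ne' : M c <> M x by move=> e; apply: ne; rewrite -(sm_K HM hc) e (sm_K HM).
have := sm_sp HM hMx h ne'; rewrite (sm_K HM) // => hcx.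
have [_ lx] := up_cov HM hx ux; case: h => _ lc; rewrite lx in lc; case: lc => lc.
case: (sm_cov HM hc) => [[_ l]|[h1 l]].
  by have := br_leq hcx; rewrite l lc ltnn.
exists (M c); split; first by rewrite (sm_K HM).
  by split=> //; rewrite lc.
by rewrite /up (sm_K HM) // l.
Qed.

Section Good.
Variables (w : W) (M : W -> W).
Hypotheses (HM : special w M) (w1 : w <> 1) (D4 : dl4 W).

(* Obvious necessary conditions for [M] to commute with left multiplication by [f];
   [lgood_comm] shows that they are sufficient. *)
Definition lgood f := [/\ simple W f,
  f <> M 1 -> f <=b w -> M f = f * M 1 &
  f = M 1 -> forall b, simple W b -> b * f <> f * b -> M b = b * f ->
    f * b <=b w -> M (f * b) = f * b * f].

Section LeftCommutation.
Variable f : W.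
Hypothesis Hf : lgood f.
Let hf : simple W f. Proof. by case: Hf. Qed.
Let hs : simple W (M 1) := M1_simple HM w1.

(** By induction [M (f * u)] and [f * M u] have the same coatoms. If they differ, they lie in a
    common dihedral subgroup and [dl4] bounds the length of [u] by one; the two conditions in
    [lgood] settle lengths zero and one. *)
Lemma lgood_aux n u : (len u < n)%N -> ~~ ld f u -> f * u <=b w ->
  M (f * u) = f * M u.
Proof.
elim: n u => // n IH u hn du hfu.
have cu : cov u (f * u) by split; [exact: br_up|exact: ldN_len].
have hu : u <=b w := br_trans (proj1 cu) hfu.
have IH' v : (len v <= len u)%N -> v <=b w -> ld f v -> M v = f * M (f * v).
  move=> hv hvw dv; rewrite -[in LHS](simpleK hf v); apply: IH.
  - by have := ld_len hf dv; lia.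
  - by rewrite ldM // dv.
  - by rewrite simpleK.
(* Where [M] goes down from [u], the claim follows from the one at the shorter element [v = M u];
   that [f] is a descent of [v] is impossible by length. *)
have [uu|nu] := boolP (up M u); last first.
  have [h l] := dn_cov HM hu nu; set v := M u in h l.
  have hv : v <=b w := br_trans h hu.
  have eu : M v = u by rewrite (sm_K HM).
  have [dv|dv] := boolP (ld f v).
    have e := IH' v _ hv dv; rewrite eu in e.
    have : len (f * u) = len (M (f * v)) by rewrite (e _) ?simpleK //; lia.
    rewrite (ldN_len hf du); have := ld_len hf dv.
    have hfv : f * v <=b w by apply: br_trans (br_dn hf dv) hv.
    by case: (sm_cov HM hfv) => [[_ ->]|[_]]; lia.
  have e : M (f * v) = f * u.
    rewrite IH ?eu //; first by lia.
    by apply: br_trans hfu; apply: lift_both.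
  rewrite -e (sm_K HM) //; apply: br_trans hfu; exact: lift_both.
have [e|ne] := pselect (M u = f * u); first by rewrite -e (sm_K HM) // e simpleK.
have [huM lu] := up_cov HM hu uu.
have hMu := sm_le HM hu.
set X := M (f * u); set Y := f * M u.
have hX : X <=b w := sm_le HM hfu.
have hMuX : M u <=b X := sm_sp HM hfu cu ne.
have ufu : up M (f * u).
  rewrite /up -/X; have := br_leq hMuX; rewrite lu -(ldN_len hf du) -/X.
  by case: (sm_cov HM hfu) => [[_]|[_]]; rewrite -/X; lia.
have [hfX lX] := up_cov HM hfu ufu; rewrite -/X in hfX lX.
have dMu : ~~ ld f (M u) by apply/negP => d; apply: ne; exact: cov_ld' hf (conj huM lu) du d.
have lY : len Y = len X by rewrite lX (ldN_len hf dMu) (ldN_len hf du) lu.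
have hMuY : M u <=b Y by exact: br_up.
have dY : ld f Y by rewrite ldM.
have covX c : c <=b Y -> cov c X -> cov c Y by move=> h [_ l]; split; rewrite // lY.
have covY c : c <=b X -> cov c Y -> cov c X by move=> h [_ l]; split; rewrite // -lY.
apply: contrapT => neXY.
(* [coatom_M] describes the coatoms of [X] through those of [f * u], and those of [Y] through those
   of [M u]; induction moves [f] across [M] on these shorter elements. *)
have coat c : cov c X <-> cov c Y.
  split=> hc.
    apply: (covX) => //; case: (coatom_M HM hfu ufu hc) => [->|[c' [ec hc' uc']]].
      by apply: lift_le => //; exact: br_trans hMuY.
    have [ec'|nec'] := pselect (c' = u); first by rewrite ec ec'.
    have dfu : ld f (f * u) by rewrite ldM.
    have dc' : ld f c' by apply: cov_ld hf hc' dfu _; rewrite simpleK.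
    have lc' : len c' = len u by case: hc' => _; rewrite (ldN_len hf du) => -[].
    have hc'w : c' <=b w := br_trans (proj1 hc') hfu.
    have e := IH' c' (eq_leq lc') hc'w dc'; set v := f * c' in e.
    have hvu : cov v u.
      split; first by rewrite -(simpleK hf u); apply: lift_dn => //; case: hc'.
      by rewrite -lc' (ld_len hf dc').
    have hvw := br_trans (proj1 hvu) hu.
    have [_ lc] := up_cov HM hc'w uc'; rewrite e in lc.
    have uv : up M v.
      rewrite /up; have := len_sl (M v) hf; have [_] := hvu; rewrite -lc'.
      by case: (sm_cov HM hvw) => [[_]|[_]]; lia.
    have [eMv|neMv] := pselect (M v = u).
      by rewrite ec e eMv; apply: lift_le => //; apply: br_trans hMuY.
    rewrite ec e; apply: lift_le => //; apply: br_trans hMuY.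
    exact (sm_sp HM hu hvu neMv).
  apply: (covY) => //.
  have [->//|nec] := pselect (c = M u).
  have dc : ld f c by apply: cov_ld hf hc dY _; rewrite /Y simpleK.
  set x := f * c; have ec : c = f * x by rewrite /x simpleK.
  have hx : cov x (M u).
    split; first by rewrite -(simpleK hf (M u)); apply: lift_dn => //; case: hc.
    by case: hc; rewrite (ld_len hf dc) (ldN_len hf dMu) => _ [].
  case: (coatom_M HM hu uu hx) => [ex|[v [ex hv uv]]]; first by rewrite ec ex.
  have hvw := br_trans (proj1 hv) hu.
  have [dv|dv] := boolP (ld f v).
    have lv : (len v <= len u)%N by case: hv => _ ->.
    have e := IH' v lv hvw dv; rewrite -ex in e.
    have hfv : f * v <=b w by apply: br_trans (br_dn hf dv) hvw.
    have [_ l1] := up_cov HM hvw uv; rewrite -ex in l1.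
    have l2 := ld_len hf dv; have l3 := ld_len hf dc; rewrite -/x in l3.
    have e' : c = M (f * v) by rewrite ec e simpleK.
    by case: (sm_cov HM hfv) => [[_]|[_]]; rewrite -e'; lia.
  have hfvfu : f * v <=b f * u.
    by apply: lift_le; rewrite ?ldM //; apply: br_trans (proj1 cu); case: hv.
  have lv : (len v < n)%N by case: hv => _ lv; rewrite ltnS lv in hn; lia.
  have e := IH v lv dv (br_trans hfvfu hfu); rewrite -ex -ec in e.
  have cfv : cov (f * v) (f * u).
    by split=> //; rewrite (ldN_len hf du) (ldN_len hf dv); case: hv => _ ->.
  have [e2|ne2] := pselect (M (f * v) = f * u); first by rewrite -e e2.
  by rewrite -e; exact (sm_sp HM hfu cfv ne2).
have X0 : (0 < len X)%N by rewrite lX.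
have [a [b [ha hb dX dYd]]] := same_coatoms (esym lY) X0 coat neXY.
have sX : M 1 <=b X := up_M1_le HM hfu ufu.
have fX : f <=b X by apply: br_trans hfX; apply: ld_le; rewrite ?ldM.
have uX : u <=b X := br_trans (proj1 cu) hfX.
(* [X] has length [len u + 2], so the threshold 4 of [dl4] is reached as soon as [len u] is 2. *)
have lu' : (len u < 2)%N.
  rewrite ltnNge; apply/negP => l2; apply: neXY.
  apply: (D4 ha hb dX dYd) => //; rewrite lX (ldN_len hf du); lia.
case: Hf => _ Hf1 Hf2.
case elu : (len u) lu' => [|[|//]] _.
  have eu := len_eq0 elu; rewrite eu in ne hfu; rewrite mulg1 in ne hfu.
  by apply: neXY; rewrite /X /Y eu mulg1; apply: Hf1 => // ef; apply: ne.
have su := len_eq1 elu.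
have us : u <> M 1.
  by move=> e; move: uu; rewrite e (upM HM (br1 w)) (up_M1 HM).
have fu : f <> u by move=> e; move: du; rewrite -e /ld simple_sqr // len1 len_simple.
have inab r : simple W r -> r <=b X -> r = a \/ r = b.
  by move=> hr hrX; exact: inW_supp dX hr hrX.
have hs1 := hs.
(* The letters [f], [u] and [M 1] all lie below [X], which involves only two letters, and [u]
   differs from both others. *)
have efs : f = M 1.
  apply: contrapT => nf.
  case: (inab _ hf fX) => e1; case: (inab _ hs1 sX) => e2;
    case: (inab _ su uX) => e3; by [case: nf; rewrite e1 e2|case: fu; rewrite e1 e3
      |case: us; rewrite e2 e3].
have dX' : dih f u X.
  apply: inW_sub dX => r hr hrX rab.
  have [ef|eu] : (f = a /\ u = b) \/ (f = b /\ u = a).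
    case: (inab _ hf fX) => e1; case: (inab _ su uX) => e3; by [left|right|case: fu; rewrite e1 e3].
  - by case: ef => -> ->.
  - by case: eu => -> ->; case: rab; [right|left].
have dM : M u = f * u \/ M u = u * f.
  by apply: dih_len2; [apply: inW_le hMuX dX'|rewrite lu elu].
case: dM => // eMu; apply: neXY; rewrite /X /Y eMu wmulA.
apply: Hf2 => // e; by case: ne; rewrite eMu e.
Qed.

Lemma lgood_comm u : u <=b w -> f * u <=b w -> M (f * u) = f * M u.
Proof.
move=> hu hfu; have [d|d] := boolP (ld f u); last exact: (lgood_aux (ltnSn _)).
have := @lgood_aux (len (f * u)).+1 (f * u) (ltnSn _).
by rewrite ldM // d simpleK // => -> //; rewrite simpleK.
Qed.
End LeftCommutation.
End Good.
End Commutation.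

(** * Subwords in few letters, and the action of a special matching on letters *)

Section Letters.
Variable W : coxeterSystem.
Implicit Types (s t u v x y z f g a b c d : W) (l : seq W).
Local Open Scope group_scope.

Lemma uniq_reduced l : sword l -> uniq l -> reduced l.
Proof.
elim: l => [|s l IH] hl; first by split=> //; rewrite prodw_nil len1.
case/sword_cons: hl => hs hl /andP[sl ul].
apply: reduced_consI => //; first exact: IH.
by apply/negP => /(ld_le hs)/(supp_word hl hs) h; rewrite h in sl.
Qed.

Lemma ldN_mul a b : simple W a -> simple W b -> a * b <> b * a -> ~~ ld a (b * a).
Proof.
move=> ha hb ne; apply/negP => h.
have nab : a <> b by move=> e; apply: ne; rewrite e.
have hba : b <=b b * a.
  by apply: br_rup => //; apply/negP => /(rd_le ha)/(simple_br ha hb).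
apply: ne; apply: br_eq (lift_le ha hba h) _.
by rewrite !len2 // => e; apply: nab.
Qed.

Lemma rdN_mul a b : simple W a -> simple W b -> a * b <> b * a -> ~~ rd a (a * b).
Proof.
move=> ha hb ne; rewrite -ldV // invMg (simple_inv ha) (simple_inv hb).
exact: ldN_mul.
Qed.

Lemma inW_one s x : simple W s -> inW (fun q => q = s) x -> x = 1 \/ x = s.
Proof.
move=> hs /inW_red[[|a [|b l]] [h1 h2 <-]]; [left|right|].
- exact: prodw_nil.
- by rewrite prodw_seq1; apply: h2; rewrite inE.
have [_ h3 /negP[]] := reduced_cons h1.
have [hb _ h4] := reduced_cons h3.
rewrite (h2 a) ?inE ?eqxx // -(h2 b) ?inE ?eqxx ?orbT //.
by rewrite prodw_cons ldM.
Qed.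

Lemma subseq_two (T : eqType) (l : seq T) (x y z : T) : x != y -> x != z -> y != z ->
  subseq [:: x; z] l -> subseq [:: y; z] l ->
  subseq [:: x; y; z] l \/ subseq [:: y; x; z] l.
Proof.
move=> xy xz yz; elim: l => // a l IH.
have [<-|xa] := eqVneq x a.
  by rewrite [subseq [:: y; z] _]/= eq_sym (negbTE xy) => _ h; left; rewrite /= eqxx.
have [<-|ya] := eqVneq y a.
  rewrite [subseq [:: x; z] _]/= (negbTE xy) => h _; right; by rewrite /= eqxx.
by rewrite /= (negbTE xa) (negbTE ya).
Qed.

Lemma br2_subseq l a b : reduced l -> simple W a -> simple W b ->
  a * b <> b * a -> a * b <=b prodw l -> subseq [:: a; b] l.
Proof.
move=> hl ha hb ne /(br_subword hl)[l' [h1 h2 e]].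
have nab : a <> b by move=> eab; apply: ne; rewrite eab.
have sz : size l' = 2 by rewrite -(proj2 h1) e len2.
have hin : forall r, r \in l' -> r = a \/ r = b.
  move=> r rl; have hd : dih a b (prodw l').
    by rewrite e; apply: inWM; [exact: (dih_gen ha hb).1|exact: (dih_gen ha hb).2].
  have hr := proj1 h1 r rl; apply: inW_supp hd hr _.
  by rewrite -(prodw_seq1 r); apply: subword_br => //; rewrite sub1seq.
case: (reduced_alt h1 hin); rewrite sz /= => el; first by rewrite -el.
by case: ne; rewrite -e el prodw2.
Qed.

(** As [a] and [b] do not commute with [s], the hypotheses say that in a reduced word of [w] each of
    them precedes some [s]; both then precede its last [s]. *)
Lemma two_before a b s w : simple W a -> simple W b -> simple W s -> a <> b ->
  a * s <> s * a -> b * s <> s * b -> a * s <=b w -> b * s <=b w ->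
  a * b * s <=b w \/ b * a * s <=b w.
Proof.
move=> ha hb hs nab nas nbs; have [l hl <-] := exists_reduced w.
move=> /(br2_subseq hl ha hs nas) h1 /(br2_subseq hl hb hs nbs) h2.
have e3 p q r : p * q * r = prodw [:: p; q; r] by rewrite prodw_cons prodw2 wmulA.
have [|||h|h] := subseq_two _ _ _ h1 h2.
- exact/eqP.
- by apply/eqP => e; apply: nas; rewrite e.
- by apply/eqP => e; apply: nbs; rewrite e.
- by left; rewrite e3; exact: subword_br.
- by right; rewrite e3; exact: subword_br.
Qed.

Lemma special_inv1 w M : special w M -> w <> 1 -> (M 1^-1)^-1 = M 1 :> W.
Proof. by move=> HM w1; rewrite invg1; apply/simple_inv/(M1_simple HM w1). Qed.

Section Matching.
Variables (w : W) (M : W -> W).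
Hypotheses (HM : special w M) (w1 : w <> 1) (D4 : dl4 W).
Local Notation s := (M 1).

Definition rgood f := [/\ simple W f,
  f <> M 1 -> f <=b w -> M f = M 1 * f &
  f = M 1 -> forall b, simple W b -> b * f <> f * b -> M b = f * b ->
    b * f <=b w -> M (b * f) = f * b * f].

Let hs : simple W s := M1_simple HM w1.

Lemma rgood_comm f u : rgood f -> u <=b w -> u * f <=b w -> M (u * f) = M u * f.
Proof.
case=> hf h1 h2 hu huf; have HM' := special_inv HM.
have es := special_inv1 HM w1.
have w1' : w^-1 <> 1 by move=> e; apply: w1; rewrite -(invgK w) e invg1.
have iV a b : simple W a -> simple W b -> (a * b)^-1 = b * a.
  by move=> ha hb; rewrite invMg !simple_inv.
have hg : lgood w^-1 (fun u => (M u^-1)^-1) f.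
  split=> //; rewrite es.
    move=> ne /br_inv; rewrite invgK (simple_inv hf) => hfw.
    by rewrite h1 // iV.
  move=> ef b hb ne; rewrite (simple_inv hb) => eb /br_inv.
  rewrite invgK iV // => hbf; rewrite h2 //; last first.
    by rewrite -(invgK (M b)) eb iV.
  by rewrite !invMg !simple_inv // wmulA.
have := lgood_comm HM' w1' D4 hg (u := u^-1).
rewrite !invMg !invgK (simple_inv hf) => h.
apply: invg_inj; rewrite h; first by rewrite invMg (simple_inv hf).
  exact: br_inv.
by rewrite -{1}(simple_inv hf) -invMg; exact: br_inv.
Qed.

(** Additivity of the lengths keeps the intermediate products below [w], so the letters of [b] can
    be taken out of [M] one at a time. *)
Lemma rgood_mul x b : inW rgood b -> len (x * b) = (len x + len b)%N ->
  x * b <=b w -> M (x * b) = M x * b.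
Proof.
have [n] := ubnP (len b); elim: n b => // n IH b hn hb hl hxb.
have [->|ne] := pselect (b = 1); first by rewrite !mulg1.
have [f hf df] := ex_rd ne; have lb := rd_len hf df.
have gf : rgood f by apply: inW_supp hb hf (rd_le hf df).
have eb : b = b * f * f by rewrite -wmulA simple_sqr // mulg1.
have hxf : x * (b * f) <=b w.
  apply: br_trans hxb; rewrite wmulA; apply: br_rdn => //.
  by rewrite /rd hl lb -wmulA; have := len_mul x (b * f); lia.
have hl' : len (x * (b * f)) = (len x + len (b * f))%N.
  by have := len_mul x (b * f); have := len_sr (x * b) hf; rewrite hl lb -wmulA; lia.
have e := IH (b * f) _ (inWM hb (inWs hf gf)) hl' hxf.
rewrite {1}eb wmulA rgood_comm //; last by rewrite -wmulA -eb.
rewrite e; first by rewrite -!wmulA simple_sqr // mulg1.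
by lia.
Qed.

Lemma lgood_mul x b : inW (lgood w M) b -> len (b * x) = (len b + len x)%N ->
  b * x <=b w -> M (b * x) = b * M x.
Proof.
have [n] := ubnP (len b); elim: n b => // n IH b hn hb hl hxb.
have [->|ne] := pselect (b = 1); first by rewrite !mul1g.
have [f hf df] := ex_ld ne; have lb := ld_len hf df.
have gf : lgood w M f by apply: inW_supp hb hf (ld_le hf df).
have eb : b = f * (f * b) by rewrite simpleK.
have hxf : f * b * x <=b w.
  apply: br_trans hxb; rewrite -wmulA; apply: br_dn => //.
  by rewrite /ld hl lb wmulA; have := len_mul (f * b) x; lia.
have hl' : len (f * b * x) = (len (f * b) + len x)%N.
  by have := len_mul (f * b) x; have := len_sl (b * x) hf; rewrite hl lb wmulA; lia.
have e := IH (f * b) _ (inWM (inWs hf gf) hb) hl' hxf.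
rewrite {1}eb -wmulA (lgood_comm HM w1 D4 gf) //; last by rewrite wmulA -eb.
rewrite e; first by rewrite wmulA simpleK.
by lia.
Qed.

(** For a letter [c] other than [s], commutation of [M] with left multiplication by [c] at 1 reads
    [M c = c * s]. So [isJ] gives the candidates for left multiplications and [isK] those for right
    ones; [s] and the letters below [w] commuting with [s] satisfy both. *)
Definition isJ c := c = s \/ M c = c * s.
Definition isK c := c = s \/ M c = s * c.
(* [Kp] and [Jp] are the complements of [isJ] and [isK] among the letters of [w]:
   [M c] is [s * c] or [c * s] for every letter [c <> s]. *)
Definition Kp c := [/\ simple W c, c <=b w, c <> s, M c = s * c & s * c <> c * s].
Definition Jp c := [/\ simple W c, c <=b w, c <> s, M c = c * s & s * c <> c * s].

(** [M] introduces no letter except [s]: from any other letter [r] it goes up, so [r] below [M u]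
    lifts to [r] below [u]. *)
Lemma M_dih b u : simple W b -> u <=b w -> dih s b u -> dih s b (M u).
Proof.
move=> hb hu du; have [uu|nu] := boolP (up M u); last first.
  by apply: inW_le du; case: (dn_cov HM hu nu).
apply: inWP => r hr hrM; have [->|rs] := pselect (r = s); first by left.
have hMu := sm_le HM hu.
have rw := br_trans hrM hMu.
have ur : up M r.
  apply/negPn/negP => /(dn_cov HM rw)[_]; rewrite len_simple // => -[/esym/len_eq0 e].
  by apply: rs; rewrite -(sm_K HM rw) e.
have dMu : ~~ up M (M u) by rewrite (upM HM) // uu.
have := sm_dn_up HM hMu hrM dMu ur; rewrite (sm_K HM) // => hru.
exact: inW_supp du hr hru.
Qed.

Lemma up_letter c : simple W c -> c <=b w -> c <> s -> up M c.
Proof.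
move=> hc cw cs; apply/negPn/negP => /(dn_cov HM cw)[_].
rewrite len_simple // => -[/esym/len_eq0 e].
by apply: cs; rewrite -(sm_K HM cw) e.
Qed.

Lemma M_letter c : simple W c -> c <=b w -> c <> s -> M c = s * c \/ M c = c * s.
Proof.
move=> hc cw cs; have [_ l] := up_cov HM cw (up_letter hc cw cs).
apply: dih_len2; last by rewrite l len_simple.
by apply: M_dih => //; exact: (dih_gen hs hc).2.
Qed.

Lemma isJP c : simple W c -> c <=b w -> isJ c \/ Kp c.
Proof.
move=> hc cw; have [e|ne] := pselect (c = s); first by left; left.
have [e|ne'] := pselect (s * c = c * s).
  by left; right; case: (M_letter hc cw ne); rewrite ?e.
by case: (M_letter hc cw ne) => e; [right|left; right].
Qed.

Lemma isKP c : simple W c -> c <=b w -> isK c \/ Jp c.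
Proof.
move=> hc cw; have [e|ne] := pselect (c = s); first by left; left.
have [e|ne'] := pselect (s * c = c * s).
  by left; right; case: (M_letter hc cw ne); rewrite ?e.
by case: (M_letter hc cw ne) => e; [left; right|right].
Qed.

Lemma Kp_isJ c : Kp c -> ~ isJ c.
Proof. by case=> _ _ h1 h2 h3 [//|e]; apply: h3; rewrite -h2. Qed.

Lemma KpJp r c : Kp r -> Jp c -> r <> c.
Proof. by move=> /Kp_isJ h [_ _ _ e _] erc; apply: h; right; rewrite erc. Qed.

(** If [M] went down from [s * c] it would reach [s] or [c], whose partners are already 1 and
    [c * s]. *)
Lemma M2_J c : simple W c -> s * c <> c * s -> M c = c * s -> s * c <=b w ->
  dih s c (M (s * c)) /\ len (M (s * c)) = 3.
Proof.
move=> hc ne e scw; have [ds dc] := dih_gen hs hc.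
have dm : dih s c (M (s * c)) by apply: M_dih => //; exact: inWM.
split=> //; have nsc : s <> c by move=> h; apply: ne; rewrite -h.
case: (sm_cov HM scw) => [[_ ->]|[_]]; rewrite len2 // => -[/esym l].
have cw : c <=b w by apply: br_trans scw; apply: br_up => //;
  apply/negP => /(ld_le hs)/(simple_br hs hc).
case: (dih_len1 dm l) => h; move: (sm_K HM scw); rewrite h.
  rewrite (sm_K HM (br1 w)) => e1; have := len2 hs hc nsc.
  by rewrite -e1 len1.
by rewrite e => e1; case: ne.
Qed.

Lemma M2_K c : simple W c -> s * c <> c * s -> M c = s * c -> c * s <=b w ->
  dih s c (M (c * s)) /\ len (M (c * s)) = 3.
Proof.
move=> hc ne e scw; have [ds dc] := dih_gen hs hc.
have dm : dih s c (M (c * s)) by apply: M_dih => //; exact: inWM.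
split=> //; have nsc : c <> s by move=> h; apply: ne; rewrite -h.
case: (sm_cov HM scw) => [[_ ->]|[_]]; rewrite len2 // => -[/esym l].
have cw : c <=b w by apply: br_trans scw; apply: br_rup => //;
  apply/negP => /(rd_le hs)/(simple_br hs hc)/esym.
case: (dih_len1 dm l) => h; move: (sm_K HM scw); rewrite h.
  rewrite (sm_K HM (br1 w)) => e1; have := len2 hc hs nsc.
  by rewrite -e1 len1.
by rewrite e => e1; case: ne.
Qed.

(* The letters for which [M], restricted to the dihedral subgroup of [s] and [d],
   is neither a left nor a right multiplication. *)
Definition twistedK d := [/\ Kp d, d * s <=b w, M (d * s) = d * s * d &
  d * s * d <> s * d * s].
Definition twistedJ c := [/\ Jp c, s * c <=b w, M (s * c) = c * s * c &
  c * s * c <> s * c * s].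

(** For [f = s] the second condition of [lgood] asks for [M (s * c) = s * c * s]. The only other
    element of length three available in the dihedral subgroup is [c * s * c], and that value is
    what [twistedJ] records. *)
Lemma lgood_J f : simple W f -> isJ f -> (f = s -> forall c, ~ twistedJ c) ->
  lgood w M f.
Proof.
move=> hf jf nB; split=> // [ne _|ef b hb ne eb fbw]; first by case: jf.
subst f; have [dm l] := M2_J hb (nesym ne) eb fbw.
case: (dih_len3 dm l) => // e; apply: contrapT => ne'; apply: (nB erefl b).
split=> //; last by move=> e'; apply: ne'; rewrite e e'.
have nsb : s <> b by move=> h; apply: ne; rewrite -h.
split=> //; first last; first by apply: nesym.
- by apply: nesym.
- apply: br_trans fbw; apply: br_up => //.
  by apply/negP => /(ld_le hf)/(simple_br hf hb).
Qed.

Lemma rgood_K f : simple W f -> isK f -> (f = s -> forall c, ~ twistedK c) ->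
  rgood f.
Proof.
move=> hf jf nA; split=> // [ne _|ef b hb ne eb fbw]; first by case: jf.
subst f; have [dm l] := M2_K hb (nesym ne) eb fbw.
case: (dih_len3 dm l) => // e; apply: contrapT => ne'; apply: (nA erefl b).
split=> //; last by move=> e'; apply: ne'; rewrite e e'.
have nsb : s <> b by move=> h; apply: ne; rewrite -h.
split=> //; first last; first by apply: nesym.
- by apply: nesym.
- apply: br_trans fbw; apply: br_rup => //.
  by apply/negP => /(rd_le hf)/(simple_br hf hb).
Qed.

End Matching.
End Letters.

(** * Configurations of letters that a special matching excludes *)

Section Exclusion.
Variable W : coxeterSystem.
Implicit Types (s t u v x y z f g a b c d q r : W) (l : seq W).
Local Open Scope group_scope.

Lemma supp2 q a b : simple W q -> simple W a -> simple W b -> q <=b a * b ->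
  q = a \/ q = b.
Proof.
by move=> hq ha hb /(supp_mul hq)[/(simple_br hq ha)|/(simple_br hq hb)]; [left|right].
Qed.

Lemma supp3 q a b c : simple W q -> simple W a -> simple W b -> simple W c ->
  q <=b a * b * c -> [\/ q = a, q = b | q = c].
Proof.
move=> hq ha hb hc /(supp_mul hq)[/(supp2 hq ha hb)[]|/(simple_br hq hc)] ->;
  by [constructor 1|constructor 2|constructor 3].
Qed.

Lemma letter_le l r : reduced l -> r \in l -> r <=b prodw l.
Proof.
move=> hl rl; rewrite -[X in X <=b _]prodw_seq1; apply: subword_br => //.
by rewrite sub1seq.
Qed.

Lemma reduced3 a b c : simple W a -> simple W b -> simple W c ->
  a <> b -> a <> c -> b <> c -> reduced [:: a; b; c].
Proof.
move=> ha hb hc ab ac bc; apply: uniq_reduced.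
  by move=> r; rewrite !inE => /or3P[]/eqP->.
by rewrite /= !inE negb_or andbT; apply/andP; split; [apply/andP; split|]; apply/eqP.
Qed.

Lemma subseq13 (T : eqType) (a b c : T) : subseq [:: a; c] [:: a; b; c].
Proof. by rewrite /= eqxx; case: eqP => // _; rewrite eqxx. Qed.

Lemma prodw3 a b c : prodw [:: a; b; c] = a * b * c.
Proof. by rewrite prodw_cons prodw2 wmulA. Qed.

Section Word3.
Variables (r s c : W).
Hypotheses (hr : simple W r) (hs : simple W s) (hc : simple W c)
  (rc : r <> c) (sr : s * r <> r * s) (sc : s * c <> c * s).
Let rs : r <> s. Proof. by move=> e; apply: sr; rewrite e. Qed.
Let cs : s <> c. Proof. by move=> e; apply: sc; rewrite e. Qed.

Lemma word3_len : len (r * s * c) = 3.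
Proof. by rewrite -prodw3 (proj2 (reduced3 hr hs hc rs rc cs)). Qed.

Lemma word3_rd : rd c (r * s * c).
Proof. by rewrite /rd word3_len simpleKr // (len2 hr hs rs). Qed.

Lemma word3_ld : ld r (r * s * c).
Proof. by rewrite /ld word3_len -(wmulA r) simpleK // (len2 hs hc cs). Qed.

Lemma word3_ldP q : simple W q -> ld q (r * s * c) -> q = r.
Proof.
move=> hq d; have hl := reduced3 hr hs hc rs rc cs.
case: (supp3 hq hr hs hc (ld_le hq d)) => // e; rewrite e in d.
  have h : r <=b r * s * c := ld_le hr word3_ld.
  have nc : ~~ rd c (s * r).
    by apply/negP => /(rd_le hc)/(supp2 hc hs hr)[] e'; [apply: cs|apply: rc].
  have := rlift_up hc (lift_le hs h d) word3_rd nc; rewrite simpleKr // => /br_eq e'.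
  by case: sr; apply: e'; rewrite !len2 //; exact: nesym.
have h : s <=b r * s * c.
  by rewrite -prodw3; apply: letter_le => //; rewrite !inE eqxx orbT.
have nr : ~~ ld r (c * s).
  by apply/negP => /(ld_le hr)/(supp2 hr hc hs)[] e'; [apply: rc|apply: rs].
have := lift_up hr (lift_le hc h d) word3_ld nr; rewrite -(wmulA r) simpleK // => /br_eq e'.
by case: sc; apply/esym/e'; rewrite !len2 //; exact: nesym.
Qed.
End Word3.

Lemma word3_rdP r s c q : simple W r -> simple W s -> simple W c ->
  r <> c -> s * r <> r * s -> s * c <> c * s -> simple W q ->
  rd q (r * s * c) -> q = c.
Proof.
move=> hr hs hc rc sr sc hq; rewrite -ldV // !invMg !simple_inv // wmulA.
by apply: word3_ldP => //; exact: nesym.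
Qed.

Section Matching.
Variables (w : W) (M : W -> W).
Hypotheses (HM : special w M) (w1 : w <> 1) (D4 : dl4 W).
Local Notation s := (M 1).
Local Notation Kp := (Kp w M).
Local Notation Jp := (Jp w M).
Local Notation twistedK := (twistedK w M).
Let hs : simple W s := M1_simple HM w1.

(** [M (r * s * c)] has length 4 and lies above [X = M (r * s)] and [Y = M (s * c)], both of length
    3. It has [s] as a descent on neither side, which forces it to be [r * Y] and [X * c]. Then
    [Y * c = r * X] lies in two dihedral subgroups that share only 1 and [s], too small for [Y]. *)
Lemma no_Kp_s_Jp r c : Kp r -> Jp c -> r * s * c <=b w -> False.
Proof.
move=> kr jc hu; have rc := KpJp kr jc.
case: kr => hr rw rs er sr; case: jc => hc cw cs ec sc.
have cs' := nesym cs; have hl := reduced3 hr hs hc rs rc cs'.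
set u := r * s * c in hu; have lu : len u = 3 by exact: word3_len.
have hrs : r * s <=b u by rewrite /u -prodw3 -prodw2; apply: subword_br => //=; rewrite ?eqxx.
have hsc : s * c <=b u.
  by rewrite /u -prodw3 -prodw2; apply: subword_br => //; exact: subseq_cons.
have [dX lX] := M2_K HM w1 hr sr er (br_trans hrs hu).
have [dY lY] := M2_J HM w1 hc sc ec (br_trans hsc hu).
set X := M (r * s) in dX lX; set Y := M (s * c) in dY lY.
have nX q : simple W q -> q <> s -> q <> r -> ~ q <=b X.
  by move=> hq n1 n2 /(inW_supp dX hq)[].
have nY q : simple W q -> q <> s -> q <> c -> ~ q <=b Y.
  by move=> hq n1 n2 /(inW_supp dY hq)[].
have cu : c <=b u by apply: rd_le => //; exact: word3_rd.
have ru : r <=b u by apply: ld_le => //; exact: word3_ld.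
have uu : up M u.
  apply/negPn/negP => d; have h : X <=b u := sm_dn_le HM hu hrs d.
  by apply: (nX c) => //; [exact: nesym|rewrite (br_eq h) // lX lu].
set z := M u; have [huz lz] := up_cov HM hu uu; rewrite -/z lu in huz lz.
have hX : X <=b z := sm_up HM hu hrs uu.
have hY : Y <=b z := sm_up HM hu hsc uu.
have covu : cov u z by split; rewrite // lz lu.
have ldu q : simple W q -> ld q u -> q = r by exact: word3_ldP.
have rdu q : simple W q -> rd q u -> q = c by exact: word3_rdP.
have ru' : r * u = s * c by rewrite /u -(wmulA r) simpleK.
have cu' : u * c = r * s by rewrite /u simpleKr.
have ldzs : ~~ ld s z.
  apply/negP => d; have ez : z = s * u.
    by apply: (cov_ld' hs covu) => //; apply/negP => /(ldu _ hs)/esym.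
  have dsu : ld s (s * u) by rewrite -ez.
  have [Y' [hY' l' e']] : exists Y', [/\ Y' <=b u, dih s c Y' & Y' = Y \/ Y' = s * Y].
    have ds := (dih_gen hs hc).1.
    have [dsY|dsY] := boolP (ld s Y); [exists (s * Y)|exists Y]; split; try by [right|left].
    - by rewrite -[u](simpleK hs) -ez; apply: lift_dn.
    - exact: inWM.
    - by rewrite -[u](simpleK hs) -ez; apply: lift_up.
    - exact: dY.
  have nr : ~~ ld r Y'.
    by apply/negP => /(ld_le hr) /(inW_supp l' hr)[].
  have := lift_up hr hY' (word3_ld hr hs hc rc sr sc) nr; rewrite ru' => h.
  have := br_leq h; rewrite (len2 hs hc cs') => l2.
  case: e' => e; rewrite e in h l2; first by rewrite lY in l2.
  have l3 : (2 <= len (s * Y))%N by have := len_sl Y hs; rewrite lY; lia.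
  have : s * Y = s * c by apply: br_eq h _; rewrite len2.
  by move=> /mulgI e4; move: lY; rewrite e4 len_simple.
have rdzs : ~~ rd s z.
  apply/negP => d; have ez : z = u * s.
    have [e|ne] := pselect (u = z * s); first by rewrite e simpleKr.
    exfalso; have : rd s u; last by move/(rdu _ hs) => e; case: cs.
    apply/negPn/negP => nd; apply: ne; apply: br_eq (rlift_up hs huz d nd) _.
    by have := rd_len hs d; rewrite lz lu => -[<-].
  have zu : z * s = u by rewrite ez simpleKr.
  have [X' [hX' l' e']] : exists X', [/\ X' <=b u, dih s r X' & X' = X \/ X' = X * s].
    have ds := (dih_gen hs hr).1.
    have [dsY|dsY] := boolP (rd s X); [exists (X * s)|exists X]; split; try by [right|left].
    - by rewrite -zu; apply: rlift_dn.
    - exact: inWM.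
    - by rewrite -zu; apply: rlift_up.
    - exact: dX.
  have nr : ~~ rd c X'.
    by apply/negP => /(rd_le hc) /(inW_supp l' hc)[] // e; apply: rc.
  have := rlift_up hc hX' (word3_rd hr hs hc rc sr sc) nr; rewrite cu' => h.
  have := br_leq h; rewrite (len2 hr hs rs) => l2.
  case: e' => e; rewrite e in h l2; first by rewrite lX in l2.
  have l3 : (2 <= len (X * s))%N by have := len_sr X hs; rewrite lX; lia.
  have : X * s = r * s by apply: br_eq h _; rewrite len2.
  by move=> /mulIg e4; move: lX; rewrite e4 len_simple.
have z1 : z <> 1 by move=> e; rewrite e len1 in lz.
have ez1 : z = r * Y.
  have [q hq dq] := ex_ld z1.
  have qs : q <> s by move=> e; rewrite e (negbTE ldzs) in dq.
  have [eq|qr] := pselect (q = r).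
    rewrite eq in dq; have h : ~~ ld r Y by apply/negP => /(ld_le hr)/(nY _ hr); apply.
    have -> : Y = r * z; last by rewrite simpleK.
    apply: br_eq (lift_up hr hY dq h) _.
    by have := ld_len hr dq; rewrite lz lY => -[<-].
  exfalso; have ez : z = q * u.
    by apply: (cov_ld' hq covu) => //; apply/negP => /(ldu _ hq).
  have h : ~~ ld q X by apply/negP => /(ld_le hq)/(nX _ hq); apply.
  have := lift_up hq hX dq h; rewrite ez simpleK // => /br_eq e.
  by apply: (nX c) => //; [exact: nesym|rewrite e // lX lu].
have ez2 : z = X * c.
  have [q hq dq] := ex_rd z1.
  have qs : q <> s by move=> e; rewrite e (negbTE rdzs) in dq.
  have [eq|qc] := pselect (q = c).
    rewrite eq in dq; have h : ~~ rd c X.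
      by apply/negP => /(rd_le hc)/(nX _ hc); apply => //; exact: nesym.
    have -> : X = z * c; last by rewrite simpleKr.
    apply: br_eq (rlift_up hc hX dq h) _.
    by have := rd_len hc dq; rewrite lz lX => -[<-].
  exfalso; have ez : u = z * q.
    apply: br_eq (rlift_up hq huz dq _) _; last by have := rd_len hq dq; rewrite lz lu => -[<-].
    by apply/negP => /(rdu _ hq).
  have h : ~~ rd q Y by apply/negP => /(rd_le hq)/(nY _ hq); apply.
  have := rlift_up hq hY dq h; rewrite -ez => /br_eq e.
  by apply: (nY r) => //; rewrite e // lY lu.
have eYX : Y * c = r * X.
  by apply: (mulgI r); rewrite simpleK // wmulA -ez1 ez2 simpleKr.
have : inW (fun q => q = s) (Y * c).
  have h1 : dih s c (Y * c) by apply: inWM => //; exact: (dih_gen hs hc).2.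
  have h2 : dih s r (Y * c) by rewrite eYX; apply: inWM => //; exact: (dih_gen hs hr).2.
  apply: inWP => q hq hqY; case: (inW_supp h1 hq hqY) => // e1.
  by case: (inW_supp h2 hq hqY) => // e2; case: rc; rewrite -e1 -e2.
case/(inW_one hs) => e; move: lY; rewrite -(simpleKr hc Y) e.
  by rewrite mul1g len_simple.
by rewrite len2.
Qed.

(** A letter count: some [u] of length 3 lies above [d * s] and [g * s], so [M u], of length 4, lies
    above [d * s * d] and above an element of length 3 in the letters [s] and [g]. A reduced word of
    [M u] would need two letters [d] and three others. *)
Lemma Kp_s_unique d g : twistedK d -> Kp g -> g <> d -> g * s <=b w -> False.
Proof.
case=> -[hd dw ds ed sd] hds eds ne [hg gw gs eg sg] gd hgs.
have [u hu [hdsu gu lu]] : exists2 u, u <=b w & [/\ d * s <=b u, g * s <=b u & len u = 3].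
  have [h|h] := two_before hg hd hs gd (nesym sg) (nesym sd) hgs hds.
    exists (g * d * s) => //; have hl := reduced3 hg hd hs gd gs ds.
    rewrite -prodw3 -!prodw2 (proj2 hl); split=> //; apply: subword_br => //.
      exact: subseq_cons.
    exact: subseq13.
  exists (d * g * s) => //; have hl := reduced3 hd hg hs (nesym gd) ds gs.
  rewrite -prodw3 -!prodw2 (proj2 hl); split=> //; apply: subword_br => //.
    exact: subseq13.
  exact: subseq_cons.
have [dX lX] := M2_K HM w1 hg sg eg (br_trans gu hu).
have [dY lY] := M2_K HM w1 hd sd ed hds.
have guu : g <=b u.
  apply: br_trans gu; apply: br_rup => //.
  by apply/negP => /(rd_le hs)/(simple_br hs hg)/esym.
have uu : up M u.
  apply/negPn/negP => d'; have h := sm_dn_le HM hu hdsu d'.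
  have e := br_eq h; rewrite lu lY in e; rewrite -(e erefl) in guu.
  by case: (inW_supp dY hg guu).
set z := M u; have [huz lz] := up_cov HM hu uu; rewrite -/z lu in huz lz.
have hX : M (g * s) <=b z := sm_up HM hu gu uu.
have hY : M (d * s) <=b z := sm_up HM hu hdsu uu.
have [l hl el] := exists_reduced z; rewrite -el in hX hY.
have sl : size l = 4 by rewrite -(proj2 hl) el.
have hin c x l' : simple W c -> reduced l' -> dih s c x -> prodw l' = x ->
    forall r, r \in l' -> r = s \/ r = c.
  move=> hc hl' dx ex r rl; have hr := proj1 hl' r rl.
  apply: inW_supp dx hr _; rewrite -ex -(prodw_seq1 r).
  by apply: subword_br => //; rewrite sub1seq.
have [l1 [r1 s1 e1]] := br_subword hl hX.
have [l2 [r2 s2 e2]] := br_subword hl hY.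
have z1 : size l1 = 3 by rewrite -(proj2 r1) e1.
have z2 : size l2 = 3 by rewrite -(proj2 r2) e2.
have c2 : (2 <= count_mem d l2)%N.
  case: (reduced_alt r2 (hin _ _ _ hd r2 dY e2)); rewrite z2 /= => el2.
    by case: ne; rewrite -eds -e2 el2 prodw3.
  by rewrite el2 /= !eqxx; case: (_ == d).
have c1 : (3 <= count (fun r => (r == s) || (r == g)) l1)%N.
  rewrite -z1 leq_eqVlt eq_sym -all_count; apply/orP; left.
  by apply/allP => r /(hin _ _ _ hg r1 dX e1)[]->; rewrite eqxx ?orbT.
have h := leq_add (leq_trans c2 (leq_count_subseq _ s2)) (leq_trans c1 (leq_count_subseq _ s1)).
have : (count_mem d l + count (fun r => (r == s) || (r == g)) l <= size l)%N.
  have -> : count (fun r => (r == s) || (r == g)) l =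
      count (predI (fun r => (r == s) || (r == g)) (predC (pred1 d))) l.
    apply: eq_count => r /=; case: (eqVneq r d) => [->|]; last by rewrite andbT.
    rewrite andbF; apply/negbTE/norP.
    by split; apply/eqP => // e; apply: gd.
  rewrite -(count_predC (pred1 d) l) leq_add2l.
  by apply: sub_count => r /andP[].
by rewrite sl => /(leq_trans h).
Qed.

End Matching.
End Exclusion.

(** * Additive products, and elements without left descents of type [isJ] *)

Section Structure.
Variable W : coxeterSystem.
Implicit Types (s t u v x y z f g a b c d q r e : W) (l : seq W).
Local Open Scope group_scope.

Lemma reduced_cat l1 l2 : reduced (l1 ++ l2) ->
  [/\ reduced l1, reduced l2 & len (prodw l1 * prodw l2) = (len (prodw l1) + len (prodw l2))%N].
Proof.
case=> /sword_cat[h1 h2]; rewrite prodw_cat size_cat => e.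
have := len_mul (prodw l1) (prodw l2); have := len_word h1; have := len_word h2.
by rewrite e => a b c; split; rewrite ?e //; try split=> //; lia.
Qed.

Lemma ld_prefix f x y : len (x * y) = (len x + len y)%N -> ld f x -> ld f (x * y).
Proof. by rewrite /ld => -> h; have := len_mul (f * x) y; rewrite wmulA; lia. Qed.

Lemma rd_suffix f x y : len (x * y) = (len x + len y)%N -> rd f y -> rd f (x * y).
Proof. by rewrite /rd => -> h; have := len_mul x (y * f); rewrite wmulA; lia. Qed.

Lemma br_mull b x y : len (b * y) = (len b + len y)%N -> x <=b y -> b * x <=b b * y.
Proof.
have [n] := ubnP (len b); elim: n b => // n IH b hn hl hxy.
have [->|ne] := pselect (b = 1); first by rewrite !mul1g.
have [f hf df] := ex_ld ne; have lb := ld_len hf df.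
have eb : b = f * (f * b) by rewrite simpleK.
have l1 : len (f * b * y) = (len (f * b) + len y)%N.
  by have := len_mul (f * b) y; have := len_sl (b * y) hf; rewrite hl lb wmulA; lia.
rewrite eb -!(wmulA f (f * b)); apply: lift_both => //.
  by apply: IH => //; lia.
by rewrite /ld wmulA -eb hl l1 lb; lia.
Qed.

Lemma br_prefix x y : len (x * y) = (len x + len y)%N -> x <=b x * y.
Proof. by move=> h; have := br_mull h (br1 y); rewrite mulg1. Qed.

Lemma br_suffix x y : len (x * y) = (len x + len y)%N -> y <=b x * y.
Proof.
move=> h; apply/br_invE; rewrite invMg; apply: br_prefix.
by rewrite -invMg !lenV h addnC.
Qed.

Lemma cov_rd' t u v : simple W t -> cov u v -> ~~ rd t u -> rd t v -> v = u * t.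
Proof.
move=> ht [h l] nu dv; have -> : u = v * t; last by rewrite simpleKr.
by apply: br_eq (rlift_up ht h dv nu) _; have := rd_len ht dv; rewrite l => -[<-].
Qed.

Lemma commute_of_descent d x : simple W d -> ~ d <=b x -> ld d (x * d) -> d * x = x * d.
Proof.
move=> hd nd dd; have nld : ~~ ld d x by apply/negP => /(ld_le hd).
have nrd : ~~ rd d x by apply/negP => /(rd_le hd).
by apply/esym/(cov_ld' hd) => //; split; [exact: br_rup|rewrite rdN_len].
Qed.

Section Matching.
Variables (w : W) (M : W -> W).
Hypotheses (HM : special w M) (w1 : w <> 1) (D4 : dl4 W).
Local Notation s := (M 1).
Local Notation Kp := (Kp w M).
Local Notation Jp := (Jp w M).
Local Notation isJ := (isJ M).
Let hs : simple W s := M1_simple HM w1.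

(** Let [c0] be the first letter of type [Jp] in a reduced word of [v] and [Q] the prefix before it.
    A descent of [v] is of type [Kp], so [s] cannot occur in [Q], by [no_Kp_s_Jp]. Hence [Q]
    consists of good letters and [M Q = s * Q]. Then [M (Q * c0)] lies above [s * Q] and [c0 * s],
    and none of its possible left descents is compatible with both. *)
Lemma no_J_below v c : v <=b w -> (forall f, simple W f -> ld f v -> ~ isJ f) ->
  Jp c -> c <=b v -> False.
Proof.
move=> hv hJ jc cv.
have v1 : v <> 1.
  by move=> e; case: jc => hc *; have := br_leq cv; rewrite e len1 len_simple.
have [r hr dr] := ex_ld v1.
have kr : Kp r.
  have rw := br_trans (ld_le hr dr) hv.
  by case: (isJP HM w1 hr rw) => // /(hJ r hr dr).
have nsJ c' : Jp c' -> ~ s * c' <=b v.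
  move=> jc' h; apply: (no_Kp_s_Jp HM w1 kr jc'); apply: br_trans hv.
  by rewrite -wmulA; exact: lift_le.
have [l hl el] := exists_reduced v.
have [q [c0 [l' [e1 j0 hq]]]] : exists (q : seq W) c0 l', [/\ l = q ++ c0 :: l', Jp c0 &
    forall r, r \in q -> ~ Jp r].
  have cl : c \in l by apply: supp_word (proj1 hl) _ _; rewrite ?el //; case: jc.
  elim: (l) cl => // a m IH; rewrite inE; have [ja _|nja] := pselect (Jp a).
    by exists [::], a, m.
  case/orP => [/eqP e|/IH[q [c0 [l' [-> j0 hq]]]]]; first by case: nja; rewrite -e.
  by exists (a :: q), c0, l'; split=> // r'; rewrite inE => /orP[/eqP->|/hq].
case: (j0) => hc0 cw0 cs0 ec0 sc0.
have := hl; rewrite e1 -cat1s catA => hl'.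
have [hqc hl2 ladd] := reduced_cat hl'; have [hqr _ lq] := reduced_cat hqc.
rewrite !prodw_cat prodw_seq1 in ladd lq; rewrite (len_simple hc0) addn1 in lq.
set Q := prodw q in ladd lq.
have ev : v = Q * c0 * prodw l' by rewrite -el e1 -cat1s catA !prodw_cat prodw_seq1.
have qcv : Q * c0 <=b v.
  have := br_mull (y := prodw l') ladd (br1 _); by rewrite mulg1 -ev.
have qcw := br_trans qcv hv.
have Qqc : Q <=b Q * c0 by apply: br_rup => //; rewrite /rd lq; lia.
have Qw := br_trans Qqc qcw.
have inq f : simple W f -> f <=b Q -> f \in q by move=> hf /(supp_word (proj1 hqr) hf).
have nJQ f : simple W f -> f <=b Q -> ~ Jp f by move=> hf /(inq f hf)/hq.
have c0qc : c0 <=b Q * c0.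
  by apply: rd_le => //; rewrite /rd simpleKr // lq.
have nsQ : ~ s <=b Q.
  move=> sQ; apply: (nsJ c0 j0); apply: br_trans qcv.
  by apply: rlift_both => //; rewrite /rd lq; lia.
have nsqc : ~ s <=b Q * c0.
  by move=> /(supp_mul hs)[//|/(simple_br hs hc0)/esym].
have dqc f : ld f (Q * c0) -> ld f v by rewrite ev; exact: ld_prefix.
have gQ : inW (rgood w M) Q.
  apply: inWP => f hf fQ; apply: rgood_K => //.
    by case: (isKP HM w1 hf (br_trans fQ Qw)) => // /(nJQ f hf fQ).
  by move=> ef; case: nsQ; rewrite -ef.
have eMQ : M Q = s * Q.
  by have := rgood_mul HM w1 D4 (x := 1) gQ; rewrite !mul1g len1; apply.
have nsQd : ~~ ld s Q by apply/negP => /(ld_le hs).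
have lsQ := ldN_len hs nsQd.
have covQ : cov Q (Q * c0) by split.
have nMQ : M Q <> Q * c0.
  by move=> e; apply: nsqc; rewrite -e eMQ; apply: ld_le; rewrite ?ldM.
have hz := sm_sp HM qcw covQ nMQ; rewrite eMQ in hz.
set z := M (Q * c0) in hz.
have uqc : up M (Q * c0).
  rewrite /up -/z lq; have := br_leq hz; rewrite lsQ => h.
  by case: (sm_cov HM qcw) => [[_]|[_]]; rewrite -/z lq; lia.
have cz : cov (Q * c0) z := up_cov HM qcw uqc.
have lz : len z = (len Q).+2 by case: cz => _ ->; rewrite lq.
have csz : c0 * s <=b z by rewrite -ec0; exact: (sm_up HM qcw c0qc uqc).
have c0s : c0 <=b c0 * s.
  by apply: br_rup => //; apply/negP => /(rd_le hs)/(simple_br hs hc0)/esym.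
have scs : s <=b c0 * s.
  by apply: rd_le => //; rewrite /rd simpleKr // len2 // len_simple.
have z1 : z <> 1 by move=> e; rewrite e len1 in lz.
have [f hf df] := ex_ld z1.
have [efs|nfs] := pselect (f = s).
  rewrite efs in df; have ez : z = s * (Q * c0).
    by apply: (cov_ld' hs cz) => //; apply/negP => /(ld_le hs).
  have := lift_up hs csz df (ldN_mul hs hc0 sc0); rewrite ez simpleK // => h.
  by apply: nsqc; exact: br_trans h.
have [dfq|ndfq] := boolP (ld f (Q * c0)); last first.
  have ez := cov_ld' hf cz ndfq df.
  have : s <=b f * (Q * c0) by rewrite -ez; apply: br_trans csz.
  by case/(supp_mul hs) => [/(simple_br hs hf)/esym|].
have fv := dqc f dfq.
have kf : Kp f.
  have fw := br_trans (ld_le hf fv) hv.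
  by case: (isJP HM w1 hf fw) => // /(hJ f hf fv).
case: (kf) => _ _ _ _ sf.
have [dfs|ndfs] := boolP (ld f (s * Q)).
  have ssQ : s <=b s * Q by apply: ld_le; rewrite ?ldM.
  have dsQ : ld s (s * Q) by rewrite ldM.
  have := lift_up hs (lift_le hf ssQ dfs) dsQ (ldN_mul hs hf sf).
  rewrite simpleK // => h; apply: nsQ; apply: br_trans h.
  by apply: rd_le => //; rewrite /rd simpleKr // len2 // len_simple.
have : s * Q = f * z.
  apply: br_eq (lift_up hf hz df ndfs) _.
  by have := ld_len hf df; rewrite lz lsQ => -[<-].
move=> e; have ez : z = f * (s * Q) by rewrite e simpleK.
have : c0 <=b f * (s * Q) by rewrite -ez; exact: br_trans csz.
case/(supp_mul hc0) => [/(simple_br hc0 hf) ecf|/(supp_mul hc0)[/(simple_br hc0 hs)//|h]].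
  by apply: (KpJp kf j0).
exact: nJQ h j0.
Qed.

End Matching.
End Structure.

Local Opaque len.

(** * Elements with unique left descent [d] and unique right descent [s] *)

Section MiddleFactor.
Variable W : coxeterSystem.
Implicit Types (s t u v x y z f g a b c d q r e : W) (l : seq W).
Local Open Scope group_scope.
Variables (w : W) (M : W -> W).
Hypotheses (HM : special w M) (w1 : w <> 1) (D4 : dl4 W).
Local Notation s := (M 1).
Local Notation isK := (isK M).
Local Notation twistedK := (twistedK w M).
Local Notation twistedJ := (twistedJ w M).
Variable d : W.
Hypotheses (Ad : twistedK d) (nB : forall c, ~ twistedJ c).
Let hs : simple W s := M1_simple HM w1.
Let hd : simple W d. Proof. by case: Ad => -[]. Qed.
Let sd : s * d <> d * s. Proof. by case: Ad => -[]. Qed.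
Let ds : d <> s. Proof. by case: Ad => -[]. Qed.
Let eds : M (d * s) = d * s * d. Proof. by case: Ad. Qed.
Let nsds : d * s * d <> s * d * s. Proof. by case: Ad. Qed.
Let edM : M d = s * d. Proof. by case: Ad => -[]. Qed.
Let dsw : d * s <=b w. Proof. by case: Ad. Qed.

Definition comm_letter r := r <> s /\ s * r = r * s.
Definition comm_letter1 r := r = s \/ s * r = r * s.

Let sE1 r : comm_letter r -> comm_letter1 r. Proof. by case=> _; right. Qed.
Let nEd : ~ comm_letter d. Proof. by case. Qed.
Let sE1s : comm_letter1 s. Proof. by left. Qed.

Let lds : len (d * s) = 2. Proof. exact: len2. Qed.

Let lsds : len (s * d * s) = 3.
Proof. by rewrite -(wmulA s) ldN_len ?lds // ldN_mul. Qed.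

Let ldsd : len (d * s * d) = 3.
Proof. by rewrite -(wmulA d) ldN_len ?len2 //; [exact: nesym|rewrite ldN_mul //; exact: nesym]. Qed.

Lemma rd_s_ds : rd s (d * s).
Proof. by rewrite /rd simpleKr // lds len_simple. Qed.

Lemma ld_s_ds : ~~ ld s (d * s). Proof. exact: ldN_mul. Qed.

Lemma ld_s_dsd : ~~ ld s (d * s * d).
Proof.
apply/negP => h; have h2 : d * s <=b d * s * d by apply: br_rup; rewrite // rdN_mul //; exact: nesym.
have := lift_le hs h2 h; rewrite wmulA => /br_eq e.
by apply: nsds; rewrite e // lsds ldsd.
Qed.

Lemma rd_s_dsd : ~~ rd s (d * s * d).
Proof.
apply/negP => h; have h2 : s * d <=b d * s * d.
  by rewrite -wmulA; apply: br_up; rewrite // ldN_mul //; exact: nesym.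
have := rlift_le hs h2 h => /br_eq e.
by apply: nsds; rewrite e // lsds ldsd.
Qed.

Lemma ld_d_sds : ~~ ld d (s * d * s).
Proof.
apply/negP => h; have h2 : s * d <=b s * d * s by apply: br_rup; rewrite // rdN_mul.
have := lift_le hd h2 h; rewrite wmulA => /br_eq e.
by apply: nsds; rewrite e // lsds ldsd.
Qed.

Lemma noE_dih x : dih s d x -> noJ comm_letter x.
Proof.
move=> dx q hq eq; apply/negP => /(ld_le hq)/(inW_supp dx hq)[e|e].
  by case: eq.
by rewrite e in eq; exact: nEd.
Qed.

Lemma noE1_ds : noJ comm_letter1 (d * s).
Proof.
move=> q hq [->|e]; first exact: ld_s_ds.
have [->|ne] := pselect (q = s); first exact: ld_s_ds.
apply: noE_dih => //; by apply: inWM; apply: inWs => //; [right|left].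
Qed.

Lemma noE1_dsd : noJ comm_letter1 (d * s * d).
Proof.
move=> q hq [->|e]; first exact: ld_s_dsd.
have [->|ne] := pselect (q = s); first exact: ld_s_dsd.
by apply: noE_dih => //; do 2?apply: inWM; apply: inWs => //; [right|left|right].
Qed.

Lemma lgood_E1 r : simple W r -> comm_letter1 r -> r <=b w -> lgood w M r.
Proof.
move=> hr er rw; apply: lgood_J => //; case: er => [->|e]; first by left.
by case: (isJP HM w1 hr rw) => // -[_ _ _ _]; rewrite e.
Qed.

Lemma rgood_E r : simple W r -> r <> s -> isK r -> rgood w M r.
Proof. by move=> hr ne kr; apply: rgood_K. Qed.

Lemma isK_E r : simple W r -> comm_letter r -> r <=b w -> isK r.
Proof.
move=> hr [_ e] rw; by case: (isKP HM w1 hr rw) => // -[_ _ _ _]; rewrite e.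
Qed.

Lemma comm_s x : inW comm_letter x -> s * x = x * s.
Proof.
case/inW_red => l [_ h <-]; elim: l h => [|a l IH] h.
  by rewrite prodw_nil mulg1 mul1g.
have [_ e] := h a (mem_head _ _).
rewrite prodw_cons wmulA e -wmulA IH ?wmulA // => r rl.
by apply: h; rewrite inE rl orbT.
Qed.

(** A right descent of [x * s] other than [s] commutes with [s], so it can be moved to the end of
    [x] and would be a second right descent. *)
Lemma E1_part x : inW comm_letter1 x -> (forall f, simple W f -> rd f x -> f = s) ->
  x = 1 \/ x = s.
Proof.
move=> hx hd'; have [|ne] := pselect (x = 1); [by left|right].
have [f hf df] := ex_rd ne; have ef := hd' f hf df; rewrite ef in df.
have lx := rd_len hs df.
suff : x * s = 1 by move=> e; rewrite -(simpleKr hs x) e mul1g.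
apply: contrapT => ne'; have [g hg dg] := ex_rd ne'.
have gx : g <=b x by apply: br_trans (rd_le hg dg) (br_rdn hs df).
have ng : g <> s by move=> e; move: dg; rewrite e rdM // df.
case: (inW_supp hx hg gx) => [//|e]; apply: ng; apply: hd' => //.
have l2 := rd_len hg dg; rewrite /rd lx l2.
have -> : x * g = x * s * g * s by rewrite -!wmulA (wmulA s) e -wmulA simple_sqr // mulg1.
by have := len_mul (x * s * g) s; rewrite (len_simple hs); lia.
Qed.

(** [M v] lies above the images of the coatoms [d * v] and [v * s], which are [eta * (d * s * d)]
    and [s * d * eta * d]. Each possible left descent of [M v] would then force [s] to occur in
    [d * eta * d]. *)
Lemma no_middle0 eta : inW comm_letter eta -> eta <> 1 ->
  len (d * eta * d * s) = (len eta + 3)%N -> d * eta * d * s <=b w ->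
  (forall f, simple W f -> ld f (d * eta * d * s) -> f = d) ->
  (forall f, simple W f -> rd f (d * eta * d * s) -> f = s) -> False.
Proof.
move=> he ne lv hv hl hr; set v := d * eta * d * s in lv hv hl hr.
have nse : ~ s <=b eta by move=> /(inW_supp he hs)[].
have he1 : inW comm_letter1 eta by apply: inW_sub he => r _ _; exact: sE1.
have ldsE : len (eta * (d * s)) = (len eta + 2)%N by rewrite (coset_add noE1_ds he1) lds.
have edv : d * v = eta * (d * s) by rewrite /v !wmulA simple_sqr // mul1g.
have evs : v * s = d * eta * d by rewrite /v simpleKr.
have vn1 : v <> 1 by move=> e; rewrite e len1 in lv; lia.
have dv : ld d v by have [f hf df] := ex_ld vn1; rewrite -(hl f hf df).
have rv : rd s v by have [f hf df] := ex_rd vn1; rewrite -(hr f hf df).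
have nsd' : ~ s <=b d * eta * d.
  by move=> /(supp_mul hs)[/(supp_mul hs)[]|] // /(simple_br hs hd)/esym.
have dvw : eta * (d * s) <=b w by rewrite -edv; apply: br_trans (br_dn hd dv) hv.
have eM1 : M (eta * (d * s)) = eta * (d * s * d).
  rewrite (lgood_mul HM w1 D4) ?eds ?lds //.
  apply: inW_sub he => r hr' rE [n e]; apply: lgood_E1 => //; first by right.
  by apply: br_trans rE _; apply: br_trans dvw; rewrite -{1}(mulg1 eta);
    apply: br_mull; [rewrite ldsE lds|exact: br1].
have lY1 : len (eta * (d * s * d)) = (len eta + 3)%N by rewrite (coset_add noE1_dsd he1) ldsd.
have covdv : cov (eta * (d * s)) v.
  by split; [rewrite -edv; exact: br_dn|rewrite lv ldsE addnS].
have nMv : M (eta * (d * s)) <> v.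
  move=> e; apply: ds; apply: hr => //.
  rewrite -e eM1 /rd lY1 -!wmulA simple_sqr // mulg1 ldsE; lia.
have hY1 := sm_sp HM hv covdv nMv; rewrite eM1 in hY1.
set z := M v in hY1.
have uv : up M v.
  rewrite /up -/z lv; have := br_leq hY1; rewrite lY1 => h.
  by case: (sm_cov HM hv) => [[_]|[_]]; rewrite -/z lv; lia.
have cz : cov v z := up_cov HM hv uv.
have lz : len z = (len eta + 4)%N by case: cz => _ ->; rewrite lv; lia.
have lvs : len (d * eta * d) = (len eta + 2)%N.
  by rewrite -evs; have := rd_len hs rv; rewrite lv; lia.
have led : len (eta * d) = (len eta).+1.
  have := len_mul d (eta * d); have := len_sr eta hd.
  by rewrite wmulA lvs (len_simple hd); lia.
have vsv : d * eta * d <=b v by rewrite -evs; exact: br_rdn.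
have vsw := br_trans vsv hv.
have eM2 : M (d * eta * d) = s * d * eta * d.
  rewrite -!wmulA (rgood_mul HM w1 D4) ?edM ?wmulA //; last first.
  - by rewrite led lvs (len_simple hd); lia.
  apply: inWM; last by apply: inWs => //; apply: rgood_E => //; right.
  move: (he); apply: inW_sub => r hr' rE [n e]; apply: rgood_E => //; apply: isK_E => //.
  apply: br_trans rE _; apply: br_trans vsw; apply: (@br_trans _ (d * eta)).
    by apply: br_up => //; apply/negP => /(ld_le hd)/(inW_supp he hd).
  by apply: br_rup => //; rewrite /rd lvs; have := len_mul d eta; rewrite (len_simple hd); lia.
have hY2 : s * d * eta * d <=b z by rewrite -eM2; exact: (sm_up HM hv vsv uv).
have eY2 : s * d * eta * d = s * (d * eta * d) by rewrite !wmulA.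
rewrite eY2 in hY2.
have nds : ~~ ld s (d * eta * d) by apply/negP => /(ld_le hs).
have lY2 : len (s * (d * eta * d)) = (len eta + 3)%N by rewrite ldN_len // lvs; lia.
have dY2 : ld s (s * (d * eta * d)) by rewrite ldM.
have sY2 : s <=b s * (d * eta * d) by apply: ld_le.
have sds : s <=b d * s by apply: rd_le => //; rewrite /rd simpleKr // lds len_simple.
have zn1 : z <> 1 by move=> e; rewrite e len1 in lz; lia.
have [q hq dq] := ex_ld zn1.
have rvM a : simple W a -> ~~ ld a v -> rd s (a * v).
  move=> ha na; rewrite /rd (ldN_len ha na) -wmulA; have := len_mul a (v * s).
  by rewrite evs lvs lv (len_simple ha); lia.
have [eqd|nqd] := pselect (q = d).
  rewrite eqd in dq.
  have nd2 : ~~ ld d (s * (d * eta * d)).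
    apply/negP => h; have := lift_up hs (lift_le hd sY2 h) dY2 ld_s_ds.
    by rewrite simpleK // => h2; apply: nsd'; exact: br_trans h2.
  have ez : s * (d * eta * d) = d * z.
    apply: br_eq (lift_up hd hY2 dq nd2) _.
    by have := ld_len hd dq; rewrite lz lY2; lia.
  have := lift_dn hd (proj1 cz) dq dv; rewrite -ez edv => h.
  have nse' : ~~ ld s (eta * (d * s)).
    rewrite (coset_ld noE1_ds he1 hs sE1s).
    by apply/negP => /(ld_le hs).
  have := lift_up hs h dY2 nse'; rewrite simpleK // => h2.
  apply: nsd'; apply: br_trans h2; apply: br_trans sds _.
  by apply: br_suffix; rewrite ldsE lds.
have [dqv|nqv] := boolP (ld q v); first by case: nqd; exact: hl.
have ez := cov_ld' hq cz nqv dq.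
have rz : rd s z by rewrite ez; exact: rvM.
have ezs : z * s = q * (d * eta * d) by rewrite ez -wmulA evs.
have [eqs|nqs] := pselect (q = s).
  rewrite eqs in ezs; have nr1 : ~~ rd s (eta * (d * s * d)).
    have dd := dih_gen hs hd; have h4 : dih s d (d * s * d).
      by do 2?apply: inWM; by [case: dd].
    rewrite /rd lY1 -(wmulA eta) (coset_add _ he); last first.
      by apply: noE_dih; apply: inWM; [|case: dd].
    by rewrite ltn_add2l -ldsd; exact: rd_s_dsd.
  have h := rlift_up hs hY1 rz nr1; rewrite ezs in h.
  have nl1 : ~~ ld s (eta * (d * s * d)).
    by rewrite (coset_ld noE1_dsd he1 hs sE1s); apply/negP => /(ld_le hs).
  have := lift_up hs h dY2 nl1; rewrite simpleK // => h2.
  apply: nsd'; apply: br_trans h2; apply: (@br_trans _ (d * s)) => //.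
  apply: (@br_trans _ (d * s * d)); last by apply: br_suffix; rewrite lY1 ldsd.
  by apply: br_rup; rewrite // rdN_mul //; exact: nesym.
have nr2 : ~~ rd s (s * (d * eta * d)).
  apply/negP => h; have dY : d <=b s * (d * eta * d).
    apply: (@br_trans _ (d * eta * d)); last exact: br_up.
    by apply: rd_le => //; rewrite /rd simpleKr // lvs; have := len_mul d eta;
      have := len_sr (d * eta) hd; rewrite lvs (len_simple hd); lia.
  have := lift_up hs (rlift_le hs dY h) dY2 ld_s_ds; rewrite simpleK // => h2.
  by apply: nsd'; exact: br_trans h2.
have := rlift_up hs hY2 rz nr2; rewrite ezs => /(br_trans sY2).
by case/(supp_mul hs) => [/(simple_br hs hq)/esym|].
Qed.

(** Again [M v] lies above the images of the two coatoms [d * v] and [v * s]. The left descent [d]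
    of [M v] would make [d] commute with [eta]; any other left descent [q] gives
    [q * (d * s) = d * s * d], hence [q = s] and a braid relation that [twistedK] excludes. *)
Lemma no_middle1 eta : inW comm_letter eta -> eta <> 1 ->
  len (d * s * eta * d * s) = (len eta + 4)%N -> d * s * eta * d * s <=b w ->
  (forall f, simple W f -> ld f (d * s * eta * d * s) -> f = d) ->
  (forall f, simple W f -> rd f (d * s * eta * d * s) -> f = s) -> False.
Proof.
move=> he ne lv hv hl hr; set v := d * s * eta * d * s in lv hv hl hr.
have ces := comm_s he.
have nse : ~ s <=b eta by move=> /(inW_supp he hs)[].
have nde : ~ d <=b eta by move=> /(inW_supp he hd).
have he1 : inW comm_letter1 eta by move: (he); apply: inW_sub => r _ _; exact: sE1.
have hes : inW comm_letter1 (eta * s) by apply: inWM => //; apply: inWs.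
have les : len (eta * s) = (len eta).+1.
  by rewrite rdN_len //; apply/negP => /(rd_le hs).
have dd := dih_gen hs hd; have [dhs dhd] := dd.
have dds : dih s d (d * s) by exact: inWM.
have ddsds : dih s d (d * s * d * s) by apply: inWM => //; exact: inWM.
(* If [d] commuted with [eta], then [eta] could be moved to the front and its left descents would be
   left descents of [v]. *)
have nde' : d * eta <> eta * d.
  move=> e; have [f hf df] := ex_ld ne.
  have [nf ef] := inW_supp he hf (ld_le hf df).
  have ev : v = eta * (d * s * d * s).
    by rewrite /v -(wmulA d) ces !wmulA e.
  have : ld f v.
    by rewrite ev (coset_ld (noE_dih ddsds) he hf) //; split.
  by move/(hl f hf) => efd; apply: nEd; rewrite -efd; split.
have ldsE : len (eta * s * (d * s)) = (len eta + 3)%N.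
  by rewrite (coset_add noE1_ds hes) lds les; lia.
have edv : d * v = eta * s * (d * s).
  by rewrite /v !wmulA simple_sqr // mul1g ces.
have evs : v * s = d * s * eta * d by rewrite /v simpleKr.
have vn1 : v <> 1 by move=> e; rewrite e len1 in lv; lia.
have dv : ld d v by have [f hf df] := ex_ld vn1; rewrite -(hl f hf df).
have rv : rd s v by have [f hf df] := ex_rd vn1; rewrite -(hr f hf df).
have dvw : eta * s * (d * s) <=b w by rewrite -edv; apply: br_trans (br_dn hd dv) hv.
have eM1 : M (eta * s * (d * s)) = eta * s * (d * s * d).
  rewrite (lgood_mul HM w1 D4) ?eds //; last by rewrite ldsE lds les; lia.
  move: (hes); apply: inW_sub => r hr' rE er; apply: lgood_E1 => //.
  apply: br_trans rE _; apply: br_trans dvw; apply: br_prefix.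
  by rewrite ldsE lds les; lia.
have lY1 : len (eta * s * (d * s * d)) = (len eta + 4)%N.
  by rewrite (coset_add noE1_dsd hes) ldsd les; lia.
have covdv : cov (eta * s * (d * s)) v.
  by split; [rewrite -edv; exact: br_dn|rewrite lv ldsE; lia].
have eY1d : eta * s * (d * s * d) * d = eta * s * (d * s).
  by rewrite -!wmulA simple_sqr // mulg1.
have rdY1 : rd d (eta * s * (d * s * d)) by rewrite /rd lY1 eY1d ldsE; lia.
have nMv : M (eta * s * (d * s)) <> v.
  by move=> e; apply: ds; apply: hr => //; rewrite -e eM1.
have hY1 := sm_sp HM hv covdv nMv; rewrite eM1 in hY1.
set z := M v in hY1.
have uv : up M v.
  rewrite /up -/z lv; have := br_leq hY1; rewrite lY1 => h.
  by case: (sm_cov HM hv) => [[_]|[_]]; rewrite -/z lv; lia.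
have cz : cov v z := up_cov HM hv uv.
have lz : len z = (len eta + 5)%N by case: cz => _ ->; rewrite lv; lia.
have lvs : len (d * s * eta * d) = (len eta + 3)%N.
  by rewrite -evs; have := rd_len hs rv; rewrite lv; lia.
have led : len (eta * d) = (len eta).+1.
  by rewrite rdN_len //; apply/negP => /(rd_le hd).
have vsv : d * s * eta * d <=b v by rewrite -evs; exact: br_rdn.
have vsw := br_trans vsv hv.
have evs2 : d * s * eta * d = d * s * (eta * d) by rewrite !wmulA.
have ladd : len (d * s * (eta * d)) = (len (d * s) + len (eta * d))%N.
  by rewrite -evs2 lvs lds led; lia.
have eM2 : M (d * s * eta * d) = d * s * d * (eta * d).
  rewrite evs2 (rgood_mul HM w1 D4) ?eds // -?evs2 //.
  apply: inWM; last by apply: inWs => //; apply: rgood_E => //; right.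
  move: (he); apply: inW_sub => r hr' rE [n e]; apply: rgood_E => //; apply: isK_E => //.
  apply: br_trans rE _; apply: br_trans vsw; apply: (@br_trans _ (eta * d)).
    by apply: br_prefix; rewrite led (len_simple hd); lia.
  by rewrite evs2; exact: br_suffix.
have hY2 : d * s * d * (eta * d) <=b z by rewrite -eM2; exact: (sm_up HM hv vsv uv).
set y := d * (eta * d) in hY2 *.
have nsy : ~ s <=b y.
  move=> /(supp_mul hs)[/(simple_br hs hd)/esym//|/(supp_mul hs)[//|]].
  by move=> /(simple_br hs hd)/esym.
have ndy : ~~ ld d (eta * d).
  by apply/negP => h; apply: nde'; exact: commute_of_descent.
have ly : len y = (len eta + 2)%N by rewrite /y ldN_len // led; lia.
have nsy' : ~~ ld s y by apply/negP => /(ld_le hs).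
have lsy : len (s * y) = (len eta + 3)%N by rewrite ldN_len // ly; lia.
have dsy : ld s (s * y) by rewrite ldM.
have ssy : s <=b s * y by apply: ld_le.
have sds : s <=b d * s by apply: rd_le => //; rewrite /rd simpleKr // lds len_simple.
have ddsy : ~~ ld d (s * y).
  apply/negP => h; have := lift_up hs (lift_le hd ssy h) dsy ld_s_ds.
  by rewrite simpleK // => h2; apply: nsy; exact: br_trans h2.
have eY2 : d * s * d * (eta * d) = d * (s * y) by rewrite /y !wmulA.
rewrite eY2 in hY2.
have lY2 : len (d * (s * y)) = (len eta + 4)%N by rewrite ldN_len // lsy; lia.
have dY2 : ld d (d * (s * y)) by rewrite ldM.
have zn1 : z <> 1 by move=> e; rewrite e len1 in lz; lia.
have [q hq dq] := ex_ld zn1.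
have [eqd|nqd] := pselect (q = d).
  rewrite eqd in dq.
  have hdE : rd s (eta * s) by rewrite /rd simpleKr // les.
  have nrde : ~~ rd d (d * eta).
    apply/negP => h; have nd : ~~ ld d eta by apply/negP => /(ld_le hd).
    apply: nde'; apply: (cov_rd' hd _ _ h); last by apply/negP => /(rd_le hd).
    by split; [exact: br_up|exact: ldN_len].
  have nsde : ~~ rd s (d * eta).
    by apply/negP => /(rd_le hs)/(supp_mul hs)[/(simple_br hs hd)/esym|].
  have rsY : rd s (eta * s * (d * s)).
    have h : len (eta * s * (d * s)) = (len (eta * s) + len (d * s))%N.
      by rewrite ldsE les lds addSnnS.
    exact: rd_suffix h rd_s_ds.
  have nd1 : ~~ ld d (eta * s * (d * s * d)).
    apply/negP => h.
    have h1 : eta * d <=b eta * s * (d * s * d).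
      rewrite -wmulA; apply: br_mull; last first.
        rewrite (wmulA s); apply: (@br_trans _ (d * s * d)); last first.
          by rewrite -(wmulA s); apply: br_up; rewrite // ld_s_dsd.
        by rewrite -wmulA; apply: br_prefix; rewrite wmulA ldsd len2 ?len_simple //; exact: nesym.
      by rewrite wmulA lY1 ldN_len ?ldsd ?ld_s_dsd //; clear; lia.
    have := rlift_dn hd (lift_le hd h1 h) rdY1.
    rewrite eY1d wmulA simpleKr //.
    have -> : rd d (d * eta * d) by rewrite rdM // nrde.
    move=> /(_ isT) h2.
    have := rlift_up hs h2 rsY nsde; rewrite wmulA simpleKr // => h3.
    have rdd : rd d (eta * s * d).
      rewrite rdM //; apply/negP => /(rd_le hd)/(supp_mul hd)[//|].
      by move/(simple_br hd hs).
    have := rlift_up hd h3 rdd nrde; rewrite simpleKr // => h4.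
    have h5 : d <=b d * eta.
      by apply: ld_le; rewrite // ldM //; apply/negP => /(ld_le hd).
    have := br_trans h5 h4.
    by case/(supp_mul hd) => // /(simple_br hd hs).
  have ez : eta * s * (d * s * d) = d * z.
    apply: br_eq (lift_up hd hY1 dq nd1) _.
    by have := ld_len hd dq; rewrite lz lY1; clear; lia.
  have h := lift_dn hd hY2 dq dY2; rewrite simpleK // -ez in h.
  have esyd : s * y * d = s * (d * eta).
    by rewrite /y -!wmulA simple_sqr // mulg1.
  have rdy : rd d (s * y).
    rewrite /rd lsy esyd; have := len_mul s (d * eta); have := len_mul d eta.
    by rewrite (len_simple hs) (len_simple hd); clear; lia.
  have h2 := rlift_dn hd h rdY1 rdy; rewrite eY1d esyd in h2.
  have ld1 : ld s (eta * s * (d * s)).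
    rewrite (coset_ld noE1_ds hes hs sE1s) -ces ldM //.
    by apply/negP => /(ld_le hs).
  have ld2 : ld s (s * (d * eta)).
    by rewrite ldM //; apply/negP => /(ld_le hs)/(supp_mul hs)[/(simple_br hs hd)/esym|].
  have h3 := lift_dn hs h2 ld1 ld2.
  rewrite simpleK // -ces -(wmulA s) simpleK // in h3.
  have rd1 : rd s (eta * (d * s)).
    apply: (@rd_suffix _ s eta (d * s)); last exact: rd_s_ds.
    exact: coset_add noE1_ds he1.
  have := rlift_up hs h3 rd1 nsde; rewrite wmulA simpleKr // => h4.
  apply: nde'; apply: br_eq h4 _; rewrite led ldN_len //.
  by apply/negP => /(ld_le hd).
have [dqv|nqv] := boolP (ld q v); first by case: nqd; exact: hl.
have ez := cov_ld' hq cz nqv dq.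
have ezs : z * s = q * (d * s * eta * d) by rewrite ez -wmulA evs.
have rz : rd s z.
  rewrite ez /rd (ldN_len hq nqv) -wmulA; have := len_mul q (v * s).
  by rewrite evs lvs lv (len_simple hq); clear; lia.
have nr1 : ~~ rd s (s * y).
  apply/negP => h; have dY : d <=b s * y.
    by apply: (@br_trans _ y); [apply: ld_le; rewrite // /y ldM|exact: br_up].
  have := lift_up hs (rlift_le hs dY h) dsy ld_s_ds; rewrite simpleK // => h2.
  by apply: nsy; exact: br_trans h2.
have nr2 : ~~ rd s (d * (s * y)).
  apply/negP => h; have e : d * (s * y) = s * y * s.
    apply: (cov_rd' hs _ nr1 h); split; first exact: br_up.
    by rewrite ldN_len.
  have ls2 : ld s (d * (s * y)).
    have e3 : s * (d * (s * y)) = y * s by rewrite e -(wmulA s) simpleK.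
    rewrite /ld e3 lY2.
    by have := len_mul y s; rewrite ly (len_simple hs); clear; lia.
  have sY2 : d * s <=b d * (s * y) by apply: lift_both.
  have := lift_le hs sY2 ls2; rewrite wmulA => h2.
  have := lift_up hd h2 dY2 ld_d_sds; rewrite simpleK // => h3.
  have := lift_dn hs h3 dsy; rewrite simpleK // -(wmulA s) simpleK //.
  have -> : ld s (s * (d * s)) by rewrite ldM // ld_s_ds.
  by move=> /(_ isT) h4; apply: nsy; exact: br_trans h4.
have := rlift_up hs hY2 rz nr2; rewrite ezs => h.
have e : d * (s * y) = q * (d * s * eta * d).
  by apply: br_eq h _; rewrite lY2; have := len_mul q (d * s * eta * d); rewrite (len_simple hq) lvs; clear; lia.
have e2 : d * s * d = q * (d * s).
  by apply: (mulIg (eta * d)); rewrite eY2 e !wmulA.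
have : q <=b d * s * d.
  by apply: ld_le; rewrite // e2 ldM //; apply/negP => h2; have := ldsd; rewrite e2; have := ld_len hq h2; rewrite lds; clear; lia.
have ddsd : dih s d (d * s * d) by exact: inWM.
case/(inW_supp ddsd hq) => // eqs; apply: nsds.
by rewrite e2 eqs wmulA.
Qed.

(* By induction [d * v = x * (d * s)] with [x] in the subgroup generated by [s]
   and the letters commuting with it; the two lemmas above force [x = 1]. *)
Lemma middle_factor v : v <=b w -> v <> 1 ->
  (forall r, simple W r -> r <=b v -> r = d \/ comm_letter1 r) ->
  (forall f, simple W f -> ld f v -> f = d) ->
  (forall f, simple W f -> rd f v -> f = s) -> v = d * s.
Proof.
have [n] := ubnP (len v); elim: n v => // n IH v hn hv vn1 hsup hl hr.
have dv : ld d v by have [f hf df] := ex_ld vn1; rewrite -(hl f hf df).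
have lv := ld_len hd dv.
have ev : v = d * (d * v) by rewrite simpleK.
have rdv f : simple W f -> rd f (d * v) -> f = s.
  move=> hf df; apply: hr => //; rewrite ev; apply: rd_suffix => //.
  by rewrite -ev lv (len_simple hd) add1n.
have [a [x [ha hx e l]]] := coset_dec comm_letter1 (d * v).
have lx : (len x <= len (d * v))%N by rewrite l leq_addl.
have xv : x <=b v.
  by apply: br_trans (br_dn hd dv); rewrite e; apply: br_suffix; rewrite -e.
have lxd f : simple W f -> ld f x -> f = d.
  move=> hf df; case: (hsup f hf (br_trans (ld_le hf df) xv)) => // ef.
  by case/negP: (hx f hf ef).
have rxs f : simple W f -> rd f x -> f = s.
  by move=> hf df; apply: rdv => //; rewrite e; apply: rd_suffix; rewrite // -e.
have [x1|nx1] := pselect (x = 1).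
  rewrite x1 mulg1 in e.
  have ras f : simple W f -> rd f a -> f = s by rewrite -e; exact: rdv.
  case: (E1_part ha ras) => ea; rewrite ev e ea //.
  by case: ds; apply: hr => //; rewrite ev e ea mulg1 /rd simple_sqr // len1 len_simple.
have ex : x = d * s.
  apply: IH => //; first by lia.
  - exact: br_trans hv.
  - by move=> r hr' rx; apply: hsup => //; exact: br_trans xv.
rewrite ex lds in l; rewrite ex in e.
(* Splitting off the commuting letters on the right leaves a factor [y] whose only possible right
   descent is [s], so it is 1 or [s]. These two values lead to [no_middle0] and [no_middle1]. *)
have [y [eta [he hy ea la]]] := rcoset_dec comm_letter a.
have yE1 : inW comm_letter1 y.
  have -> : y = a * eta^-1 by rewrite ea mulgK.
  apply: inWM => //; apply: inWV; move: (he); apply: inW_sub => r _ _; exact: sE1.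
have ry f : simple W f -> rd f y -> f = s.
  move=> hf df; apply: contrapT => nf.
  have fE : comm_letter1 f by apply: inW_supp yE1 hf (rd_le hf df).
  by case: fE => // fE; case/negP: (hy f hf (conj nf fE)).
have ces := comm_s he.
case: (E1_part yE1 ry) => ey; rewrite ey in ea la.
  rewrite mul1g in ea; rewrite len1 add0n in la.
  have [e1|ne1] := pselect (eta = 1).
    have es : v = s by rewrite ev e ea e1 mul1g simpleK.
    by case: ds; apply/esym/hl => //; rewrite es /ld simple_sqr // len1 len_simple.
  have ev' : v = d * eta * d * s by rewrite ev e ea !wmulA.
  exfalso; apply: (no_middle0 he ne1); rewrite -?ev' //.
  by rewrite lv l la; lia.
rewrite (len_simple hs) in la.
have ev' : v = d * s * eta * d * s by rewrite ev e ea !wmulA.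
have lv4 : len v = (len eta + 4)%N by rewrite lv l la; lia.
have [e1|ne1] := pselect (eta = 1); last first.
  by exfalso; apply: (no_middle1 he ne1); rewrite -?ev'.
(* Here [v] would be [d s d s]. It has length 4, and so has [s d s d], so [dl4] identifies them and
   [s] becomes a left descent of [v]. *)
rewrite e1 mulg1 in ev'; rewrite e1 len1 add0n in lv4.
have edv : d * v = s * d * s by rewrite ev' !wmulA simple_sqr // mul1g.
have sdsw : s * (d * s) <=b w.
  by rewrite wmulA -edv; apply: br_trans hv; exact: br_dn.
have gs : lgood w M s by apply: lgood_J => //; left.
have eM : M (s * (d * s)) = s * (d * s * d) by rewrite (lgood_comm HM w1 D4 gs) ?eds.
have [dhs dhd] := dih_gen hs hd.
have dv4 : dih s d v by rewrite ev'; do 3?apply: inWM.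
have d4 : dih s d (s * (d * s * d)) by do 3?apply: inWM.
have l4 : len (s * (d * s * d)) = 4 by rewrite ldN_len ?ld_s_dsd // ldsd.
have ev2 : v = s * (d * s * d) by apply: (D4 hs hd dv4 d4); rewrite lv4 // l4.
case: ds; apply/esym/hl => //.
by rewrite ev2 ldM // ld_s_dsd.
Qed.
End MiddleFactor.

(** * Existence of a multiplication that commutes with [M] and differs from it at [w] *)

Section Partner.
Variable W : coxeterSystem.
Implicit Types (s t u v w x y z f g a b c d q r e p : W) (l : seq W) (M : W -> W).
Local Open Scope group_scope.

Definition partner w M :=
  (exists f, [/\ simple W f, ld f w, f * w <> M w & lgood w M f]) \/
  (exists t, [/\ simple W t, rd t w, w * t <> M w & rgood w M t]).

Definition invM M u : W := (M u^-1)^-1.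

Lemma invMK M : invM (invM M) = M.
Proof. by apply: funext => u; rewrite /invM !invgK. Qed.

Lemma br_invl u v : u <=b v^-1 -> u^-1 <=b v.
Proof. by move/br_inv; rewrite invgK. Qed.

Lemma inv2 a b : simple W a -> simple W b -> (a * b)^-1 = b * a.
Proof. by move=> ha hb; rewrite invMg (simple_inv ha) (simple_inv hb). Qed.

Lemma inv3 a b c : simple W a -> simple W b -> simple W c ->
  (a * b * c)^-1 = c * b * a.
Proof. by move=> ha hb hc; rewrite invMg inv2 // (simple_inv hc) wmulA. Qed.

Section Inverse.
Variables (w : W) (M : W -> W).
Hypotheses (HM : special w M) (w1 : w <> 1).
Let hs : simple W (M 1) := M1_simple HM w1.

Lemma invM1 : invM M 1 = M 1. Proof. exact: special_inv1 HM w1. Qed.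

Lemma invMs a : simple W a -> invM M a = (M a)^-1.
Proof. by move=> ha; rewrite /invM (simple_inv ha). Qed.

Lemma lgood_inv f : lgood w M f -> rgood w^-1 (invM M) f.
Proof.
case=> hf h1 h2; split=> //; rewrite invM1.
  move=> ne /br_invl; rewrite (simple_inv hf) => fw.
  by rewrite (invMs hf) h1 // inv2.
move=> e b hb ne; rewrite invMs // => eb /br_invl; rewrite inv2 // => bfw.
rewrite /invM inv2 // h2 ?inv3 //.
by rewrite -[M b]invgK eb inv2.
Qed.

Lemma rgood_inv f : rgood w M f -> lgood w^-1 (invM M) f.
Proof.
case=> hf h1 h2; split=> //; rewrite invM1.
  move=> ne /br_invl; rewrite (simple_inv hf) => fw.
  by rewrite (invMs hf) h1 // inv2.
move=> e b hb ne; rewrite invMs // => eb /br_invl; rewrite inv2 // => bfw.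
rewrite /invM inv2 // h2 ?inv3 //.
by rewrite -[M b]invgK eb inv2.
Qed.

Lemma partner_inv : partner w M -> partner w^-1 (invM M).
Proof.
case=> [[f [hf df ne gf]]|[f [hf df ne gf]]]; [right|left]; exists f; split=> //.
- by rewrite rdV.
- rewrite /invM invgK => e; apply: ne.
  by apply: invg_inj; rewrite -e invMg (simple_inv hf).
- exact: lgood_inv.
- by rewrite ldV.
- rewrite /invM invgK => e; apply: ne.
  by apply: invg_inj; rewrite -e invMg (simple_inv hf).
- exact: rgood_inv.
Qed.

Lemma twistedK_inv d : twistedK w M d -> twistedJ w^-1 (invM M) d.
Proof.
case=> -[hd dw ds ed sd] dsw eds ne; split; rewrite ?invM1.
- split; rewrite ?invM1 //; first by rewrite -(simple_inv hd); exact: br_inv.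
  by rewrite invMs // ed inv2.
- by rewrite -inv2 //; exact: br_inv.
- by rewrite /invM inv2 // eds inv3.
- by [].
Qed.

Lemma twistedJ_inv d : twistedJ w M d -> twistedK w^-1 (invM M) d.
Proof.
case=> -[hd dw ds ed sd] dsw eds ne; split; rewrite ?invM1.
- split; rewrite ?invM1 //; first by rewrite -(simple_inv hd); exact: br_inv.
  by rewrite invMs // ed inv2.
- by rewrite -inv2 //; exact: br_inv.
- by rewrite /invM inv2 // eds inv3.
- by [].
Qed.

Lemma isJ_inv c : simple W c -> isJ (invM M) c -> isK M c.
Proof.
move=> hc; rewrite /isJ /isK invM1 invMs // => -[e|e]; [by left|right].
by rewrite -[M c]invgK e inv2.
Qed.

End Inverse.

Section Existence.
Variables (w : W) (M : W -> W).
Hypotheses (HM : special w M) (w1 : w <> 1) (D4 : dl4 W).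
Hypothesis (nd : forall a b, simple W a -> simple W b -> ~ dih a b w).
Local Notation s := (M 1).
Let hs : simple W s := M1_simple HM w1.

Lemma nondih_len : (1 < len w)%N.
Proof.
rewrite ltnNge; apply/negP => h; case e : (len w) h => [|[|//]] _.
  by apply: w1; exact: len_eq0.
have hw := len_eq1 e; apply: (nd hw hw); apply: inWs => //; by left.
Qed.

Lemma M1_le_w : s <=b w. Proof. exact: M1_le HM. Qed.

(** If both good multiplications agree with [M] at [w], then [f * w = w * t], and
    [commuting_descents] supplies a second descent on each side. A second descent differs from [M]
    at [w] automatically, and the last hypothesis makes one of the two good. *)
Lemma partner_from_both f t : simple W f -> ld f w -> lgood w M f ->
  simple W t -> rd t w -> rgood w M t ->
  (forall p p', simple W p -> ld p w -> simple W p' -> rd p' w ->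
     lgood w M p \/ rgood w M p') -> partner w M.
Proof.
move=> hf df gf ht dt gt h.
have [e1|ne] := pselect (f * w = M w); last by left; exists f.
have [e2|ne] := pselect (w * t = M w); last by right; exists t.
have e : f * w = w * t by rewrite e1 e2.
have [p [hp np dp]] := commuting_descents hf ht df dt e nondih_len.
have [p' [hp' np' dp']] := commuting_descents_right hf ht df dt e nondih_len.
case: (h p p' hp dp hp' dp') => g; [left; exists p|right; exists p']; split=> //.
- by rewrite -e1 => /mulIg.
- by rewrite -e2 => /mulgI.
Qed.

(** A descent of type [Kp] is excluded by [no_Kp_s_Jp]. If [s] were a descent, some [u = s * y] of
    length 4 would have [M u] of length 5 above [c * s * c] and above an element of length 4 in the
    letters [s] and [d]: six letters are needed. *)
Lemma twistedKJ_ld d c f : twistedK w M d -> twistedJ w M c -> simple W f -> ld f w ->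
  isJ M f /\ f <> s.
Proof.
move=> Ad Bc hf df; have fw := ld_le hf df.
case: (Bc) => jc scw esc ncsc; case: (Ad) => kd dsw eds nsds.
split.
  case: (isJP HM w1 hf fw) => // kf; exfalso.
  by apply: (no_Kp_s_Jp HM w1 kf jc); rewrite -wmulA; exact: lift_le.
move=> e; rewrite e in df.
have dc := KpJp kd jc.
case: (jc) => hc cw cs ec sc; case: (kd) => hd dw ds ed sd.
have csw : c * s <=b w by rewrite -ec; exact: (sm_le HM cw).
have [y [hyw ly cy dsy nsy]] : exists y, [/\ y <=b w, len y = 3, c <=b y, d * s <=b y & ~~ ld s y].
  have hh a b : simple W a -> simple W b -> a <> b -> s * a <> a * s -> s * b <> b * s ->
      [/\ len (a * b * s) = 3, rd s (a * b * s) & ~~ ld s (a * b * s)].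
    move=> ha hb nab sa sb.
    have as_ : a <> s by move=> e2; apply: sa; rewrite e2.
    have bs_ : b <> s by move=> e2; apply: sb; rewrite e2.
    have l3 : len (a * b * s) = 3.
      by rewrite -prodw3 (proj2 (reduced3 ha hb hs nab as_ bs_)).
    have rs : rd s (a * b * s) by rewrite /rd l3 simpleKr // len2.
    split=> //; apply/negP => h.
    have ay : a <=b a * b * s.
      rewrite -prodw3; apply: letter_le; last by rewrite inE eqxx.
      exact: (reduced3 ha hb hs nab as_ bs_).
    have := rlift_up hs (lift_le hs ay h) rs (rdN_mul hs ha sa).
    rewrite simpleKr // => /(br_trans _) h2.
    have : s <=b a * b.
      by apply: h2; apply: ld_le; rewrite // ldM //; apply/negP => /(ld_le hs)/(simple_br hs ha)/esym.
    by case/(supp2 hs ha hb) => /esym.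
  have red3 a b : simple W a -> simple W b -> a <> b -> a <> s -> b <> s ->
      reduced [:: a; b; s] by move=> *; exact: reduced3.
  have [h|h] := two_before hd hc hs dc (nesym sd) (nesym sc) dsw csw.
    have [l3 rs ns] := hh d c hd hc dc sd sc.
    exists (d * c * s); split=> //.
      rewrite -prodw3; apply: letter_le; last by rewrite !inE eqxx orbT.
      exact: red3.
    by rewrite -prodw3 -prodw2; apply: subword_br; [exact: red3|exact: subseq13].
  have [l3 rs ns] := hh c d hc hd (nesym dc) sc sd.
  exists (c * d * s); split=> //.
    rewrite -prodw3; apply: letter_le; last by rewrite !inE eqxx.
    by apply: red3 => //; exact: nesym.
  rewrite -prodw3 -prodw2; apply: subword_br; last exact: subseq_cons.
  by apply: red3 => //; exact: nesym.
set u := s * y; have hu : u <=b w by exact: lift_le.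
have lu : len u = 4 by rewrite ldN_len // ly.
have scu : s * c <=b u by exact: lift_both.
have sdsu : s * (d * s) <=b u by exact: lift_both.
have cu : c <=b u by apply: br_trans cy _; exact: br_up.
have [dhs dhd] := dih_gen hs hd; have [chs chc] := dih_gen hs hc.
have dsds : dih s d (s * (d * s)) by do 2?apply: inWM.
have sdsw := br_trans sdsu hu.
have dM := M_dih HM hd sdsw dsds.
have lsds : len (s * (d * s)) = 3.
  by rewrite ldN_len ?len2 // ldN_mul.
have lM : len (M (s * (d * s))) = 4.
  case: (sm_cov HM sdsw) => [[_ ->]|[_]]; rewrite lsds // => -[/esym l2].
  case: (dih_len2 dM l2) => e3; have := sm_K HM sdsw; rewrite e3.
    rewrite -ed (sm_K HM) // => e4; have := lsds; rewrite -e4 len_simple //.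
  by rewrite eds wmulA => e4; case: nsds.
have uu : up M u.
  apply/negPn/negP => du; have h : M (s * (d * s)) <=b u := sm_dn_le HM hu sdsu du.
  have e3 : M (s * (d * s)) = u by apply: br_eq h _; rewrite lM lu.
  by rewrite e3 in dM; case: (inW_supp dM hc cu) => // e4; apply: dc.
set z := M u; have [_ lz] := up_cov HM hu uu; rewrite -/z lu in lz.
have hX : M (s * (d * s)) <=b z := sm_up HM hu sdsu uu.
have hY : M (s * c) <=b z := sm_up HM hu scu uu.
have [dY lY] := M2_J HM w1 hc sc ec scw.
have [l hl el] := exists_reduced z; rewrite -el in hX hY.
have sl : size l = 5 by rewrite -(proj2 hl) el.
have hin a x (l' : seq W) : simple W a -> reduced l' -> dih s a x -> prodw l' = x ->
    forall r, r \in l' -> r = s \/ r = a.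
  move=> ha hl' dx ex r rl; have hr := proj1 hl' r rl.
  by apply: inW_supp dx hr _; rewrite -ex; exact: letter_le.
have [l1 [r1 s1 e1]] := br_subword hl hX.
have [l2 [r2 s2 e2]] := br_subword hl hY.
have z1 : size l1 = 4 by rewrite -(proj2 r1) e1.
have z2 : size l2 = 3 by rewrite -(proj2 r2) e2.
have c2 : (2 <= count_mem c l2)%N.
  case: (reduced_alt r2 (hin _ _ _ hc r2 dY e2)); rewrite z2 /= => el2.
    by case: ncsc; rewrite -esc -e2 el2 prodw3.
  by rewrite el2 /= !eqxx; case: (_ == c).
have c1 : (4 <= count (fun r => (r == s) || (r == d)) l1)%N.
  rewrite -z1 leq_eqVlt eq_sym -all_count; apply/orP; left.
  by apply/allP => r /(hin _ _ _ hd r1 dM e1)[]->; rewrite eqxx ?orbT.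
have h := leq_add (leq_trans c2 (leq_count_subseq _ s2)) (leq_trans c1 (leq_count_subseq _ s1)).
have : (count_mem c l + count (fun r => (r == s) || (r == d)) l <= size l)%N.
  have -> : count (fun r => (r == s) || (r == d)) l =
      count (predI (fun r => (r == s) || (r == d)) (predC (pred1 c))) l.
    apply: eq_count => r /=; case: (eqVneq r c) => [->|]; last by rewrite andbT.
    rewrite andbF; apply/negbTE/norP.
    by split; apply/eqP => // e3; apply: dc.
  rewrite -(count_predC (pred1 c) l) leq_add2l.
  by apply: sub_count => r /andP[].
by rewrite sl => /(leq_trans h).
Qed.

(** Otherwise [no_J_below] makes all letters of [w] good on the right, so [M w = s * w], and [s]
    itself is a descent satisfying [isJ]. *)
Lemma isJ_descent : (forall d, ~ twistedK w M d) -> exists f, [/\ simple W f, ld f w & isJ M f].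
Proof.
move=> nA; apply: contrapT => nJ.
have hJ f : simple W f -> ld f w -> ~ isJ M f by move=> hf df jf; apply: nJ; exists f.
have gw : inW (rgood w M) w.
  apply: inWP => f hf fw; apply: rgood_K => //.
  by case: (isKP HM w1 hf fw) => // jf; case: (no_J_below HM w1 D4 (br_refl w) hJ jf fw).
have := rgood_mul HM w1 D4 (x := 1) gw; rewrite !mul1g len1 add0n => /(_ erefl (br_refl w)) e.
have := dn_cov HM (br_refl w) (sm_w HM); rewrite e => -[_ l].
by apply: (hJ s hs); [rewrite /ld l|left].
Qed.

(** Suppose there is no partner, so every good multiplication by a descent agrees with [M] at [w].
    Factor [w = a * v * g] with [a] made of letters good on the left, [g] of letters good on the
    right, and [v = d * s] by [middle_factor]. The agreements then force [a = 1] and leave only 1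
    and [d] for [g], so [w] would be dihedral. *)
Lemma partner_twistedK d : twistedK w M d -> (forall c, ~ twistedJ w M c) -> partner w M.
Proof.
move=> Ad nB; apply: contrapT => nh.
have [kd dsw eds nsds] := Ad; have [hd dw ds ed sd] := kd.
have HL f : simple W f -> ld f w -> isJ M f -> f * w = M w.
  move=> hf df jf; apply: contrapT => ne; apply: nh; left; exists f; split=> //.
  by apply: lgood_J.
have HR t : simple W t -> rd t w -> t <> s -> w * t = M w.
  move=> ht dt ts; apply: contrapT => ne; apply: nh; right; exists t; split=> //.
  apply: rgood_K => //; have tw := rd_le ht dt.
  case: (isKP HM w1 ht tw) => // jt; exfalso; apply: (no_Kp_s_Jp HM w1 kd jt).
  exact: rlift_le.
have [a [x [ha hx ew lw]]] := coset_dec (isJ M) w.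
have xw : x <=b w by rewrite ew; apply: br_suffix; rewrite -ew.
have aw : a <=b w by rewrite ew; apply: br_prefix; rewrite -ew.
have ga : inW (lgood w M) a.
  move: (ha); apply: inW_sub => r hr ra jr; exact: lgood_J.
have eMw : M w = a * M x.
  have e := lgood_mul HM w1 D4 ga (x := x); rewrite -ew in e.
  exact: e lw (br_refl w).
have hxJ f : simple W f -> ld f x -> ~ isJ M f.
  by move=> hf df jf; case/negP: (hx f hf jf).
have nJx f : simple W f -> f <=b x -> ~ Jp w M f.
  by move=> hf fx jf; exact: (no_J_below HM w1 D4 xw hxJ jf fx).
have lda f : simple W f -> ld f a -> f * a * x = a * M x.
  move=> hf df; rewrite -wmulA -ew -eMw; apply: HL => //.
    by rewrite ew; apply: ld_prefix; rewrite // -ew.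
  exact: inW_supp ha hf (ld_le hf df).
have dsdw : d * s * d <=b w by rewrite -eds; exact: (sm_le HM dsw).
(* If [s] does not occur in [x], then [M x = s * x], and the agreements at the descents of [a] leave
   only [a = s]. But [d * s * d] below [s * x] lifts to [d * s * d] below [x]. *)
have [sx|nsx] := pselect (s <=b x); last first.
  have gx : inW (rgood w M) x.
    apply: inWP => f hf fx; apply: rgood_K => //; last by move=> e; case: nsx; rewrite -e.
    by case: (isKP HM w1 hf (br_trans fx xw)) => // /(nJx f hf fx).
  have eMx : M x = s * x.
    by have := rgood_mul HM w1 D4 (x := 1) gx; rewrite !mul1g len1 add0n; apply.
  have [a1|na1] := pselect (a = 1).
    rewrite a1 mul1g in ew; rewrite a1 mul1g in eMw; have := dn_cov HM (br_refl w) (sm_w HM).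
    rewrite eMw eMx -ew => -[_ l].
    by apply: (hxJ s hs); [rewrite -ew /ld l|left].
  have [f hf df] := ex_ld na1.
  have efa : f * a = a * s.
    by apply: (mulIg x); rewrite lda // eMx wmulA.
  have rsa : rd s a by rewrite /rd -efa.
  have la : ~ (1 < len a)%N.
    move=> l; have [p [hp np dp]] := commuting_descents hf hs df rsa efa l.
    by apply: np; apply: (mulIg a); apply: (mulIg x); rewrite !lda.
  have ea : a = s.
    have la1 : len (a * s) = 0%N.
      by have := rd_len hs rsa; have := la; clear; lia.
    by rewrite -(simpleKr hs a) (len_eq0 la1) mul1g.
  have dsw' : ld s w.
    by rewrite ew ea ldM //; apply/negP => /(ld_le hs).
  have := lift_up hs dsdw dsw' (ld_s_dsd HM w1 Ad); rewrite ew ea simpleK // => h.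
  apply: nsx; apply: br_trans h; apply: (@br_trans _ (d * s)).
    by apply: rd_le => //; exact: (rd_s_ds HM w1 Ad).
  by apply: br_rup; rewrite // rdN_mul //; exact: nesym.
have Kd f : simple W f -> f <=b x -> ~ isJ M f -> Kp w M f.
  by move=> hf fx njf; case: (isJP HM w1 hf (br_trans fx xw)).
have lxd f : simple W f -> ld f x -> f = d.
  move=> hf df; apply: contrapT => ne.
  apply: (Kp_s_unique HM w1 Ad (Kd f hf (ld_le hf df) (hxJ f hf df)) ne).
  by apply: br_trans xw; exact: lift_le.
have [v [g [hg hv ex lx]]] := rcoset_dec (fun r => isK M r /\ r <> s) x.
have vx : v <=b x by rewrite ex; apply: br_prefix; rewrite -ex.
have gx : g <=b x by rewrite ex; apply: br_suffix; rewrite -ex.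
have vn1 : v <> 1.
  move=> e; rewrite ex e mul1g in sx.
  by case: (inW_supp hg hs sx).
have rvs f : simple W f -> rd f v -> f = s.
  move=> hf df; apply: contrapT => ne; have fx := br_trans (rd_le hf df) vx.
  case: (isKP HM w1 hf (br_trans fx xw)) => [kf|/(nJx f hf fx)//].
  by case/negP: (hv f hf (conj kf ne)).
have rsv : rd s v by have [f hf df] := ex_rd vn1; rewrite -(rvs f hf df).
have ev : v = d * s.
  apply: (middle_factor HM w1 D4 Ad nB (br_trans vx xw) vn1) => //.
    move=> r hr rv; have rx := br_trans rv vx.
    have [->|nrs] := pselect (r = s); first by right; left.
    have [e|ne] := pselect (s * r = r * s); first by right; right.
    case: (isKP HM w1 hr (br_trans rx xw)) => [[//|kr]|/(nJx r hr rx)//].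
    left; apply: contrapT => nrd; apply: (Kp_s_unique HM w1 Ad _ nrd).
      by split=> //; exact: br_trans xw.
    by apply: br_trans (br_trans vx xw); exact: rlift_le.
  by move=> f hf df; apply: lxd => //; rewrite ex; apply: ld_prefix; rewrite // -ex.
have gg : inW (rgood w M) g.
  by move: (hg); apply: inW_sub => r hr _ [kr nr]; exact: rgood_K.
have eMx : M x = d * s * d * g.
  by rewrite {1}ex ev (rgood_mul HM w1 D4 gg) ?eds // -ev -ex.
have [a1|na1] := pselect (a = 1); last first.
  (* The agreement at a descent [f] of [a] reads [j * (d * s) = d * s * d], so [j] is a letter. It
     cannot be [s], by the twist, nor [d], which is not of type [isJ]. *)
  have [f hf df] := ex_ld na1; set j := a^-1 * f * a.
  have jf : isJ M f := inW_supp ha hf (ld_le hf df).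
  have hj : inW (isJ M) j by apply: inWM => //; apply: inWM; [exact: inWV|exact: inWs].
  have ej : j * (d * s) = d * s * d.
    apply: (mulIg g); apply: (mulgI a).
    by rewrite /j !wmulA mulgV mul1g -!wmulA (wmulA d s) -ev -ex wmulA lda // eMx !wmulA.
  have nJds : noJ (isJ M) (d * s).
    move=> r hr jr; apply/negP => h; apply: (hxJ r hr) => //.
    by rewrite ex ev; apply: ld_prefix; rewrite // -ev -ex.
  have lj : len j = 1%N.
    have := coset_add nJds hj; rewrite ej (len2 hd hs ds) -(wmulA d) ldN_len //.
      by rewrite len2 //; [clear; lia|exact: nesym].
    by rewrite ldN_mul //; exact: nesym.
  have sj := len_eq1 lj.
  have jdsd : j <=b d * s * d.
    by apply: ld_le; rewrite // -ej ldM //; apply: (nJds j sj (inW_supp hj sj (br_refl j))).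
  have ddsd : dih s d (d * s * d).
    by have [? ?] := dih_gen hs hd; do 2?apply: inWM.
  case: (inW_supp ddsd sj jdsd) => e.
    by apply: nsds; rewrite -ej e wmulA.
  apply: (Kp_isJ kd); rewrite -e; exact: inW_supp hj sj (br_refl j).
rewrite a1 mul1g in ew; rewrite a1 mul1g in eMw; have ewx : w = d * s * g by rewrite ew ex ev.
have lwg : len (d * s * g) = (len (d * s) + len g)%N by rewrite -ev -ex.
have [dhs dhd] := dih_gen hs hd.
have [g1|ng1] := pselect (g = 1).
  by apply: (nd hs hd); rewrite ewx g1 mulg1; exact: inWM.
(* Thus all right descents of [g] coincide, while [commuting_descents_right] would give two of them
   if [g] were longer than a letter. *)
have rgt t : simple W t -> rd t g -> d * g = g * t.
  move=> ht dt; have : w * t = M w.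
    apply: HR => //; first by rewrite ewx; exact: rd_suffix.
    by case: (inW_supp hg ht (rd_le ht dt)).
  by rewrite eMw eMx ewx -!wmulA => /mulgI/mulgI.
have [t ht dt] := ex_rd ng1; have e := rgt t ht dt.
have ldg : ld d g by rewrite /ld e.
have lg : ~ (1 < len g)%N.
  move=> l; have [p [hp np dp]] := commuting_descents_right hd ht ldg dt e l.
  by apply: np; apply: (mulgI g); rewrite -!rgt.
have lg0 : len (d * g) = 0%N by have := ld_len hd ldg; have := lg; clear; lia.
have eg : g = d by rewrite -(simpleK hd g) (len_eq0 lg0) mulg1.
by apply: (nd hs hd); rewrite ewx eg; do 2?apply: inWM.
Qed.

End Existence.

Lemma nondih_inv w : (forall a b, simple W a -> simple W b -> ~ dih a b w) ->
  forall a b, simple W a -> simple W b -> ~ dih a b w^-1.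
Proof. by move=> h a b ha hb /inWVE; exact: h. Qed.

(** With twisted letters of both kinds, all descents on both sides are good. With one kind,
    [partner_twistedK] applies, up to inversion. With none, [isJ_descent] gives good descents on
    both sides, and for any further descents [p] and [p'] one is good, since [p * s * p'] below [w]
    violates [no_Kp_s_Jp] otherwise. *)
Lemma partner_exists w M : special w M -> dl4 W ->
  (forall a b, simple W a -> simple W b -> ~ dih a b w) -> w <> 1 -> partner w M.
Proof.
move=> HM D4 nd w1; have HM' := special_inv HM; rewrite -/(invM M) in HM'.
have nd' := nondih_inv nd.
have w1' : w^-1 <> 1 by move=> e; apply: w1; rewrite -(invgK w) e invg1.
have iK : (w^-1)^-1 = w by rewrite invgK.
have [[d Ad]|nA] := pselect (exists d, twistedK w M d).
  have [[c Bc]|nB] := pselect (exists c, twistedJ w M c); last first.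
    by apply: partner_twistedK Ad _ => // c Bc; apply: nB; exists c.
  have Bd := twistedK_inv HM w1 Ad; have Ac := twistedJ_inv HM w1 Bc.
  have gl f : simple W f -> ld f w -> lgood w M f.
    by move=> hf df; have [jf nf] := twistedKJ_ld HM w1 Ad Bc hf df; exact: lgood_J.
  have gr t : simple W t -> rd t w -> rgood w M t.
    move=> ht; rewrite -ldV // => dt.
    have [jt] := twistedKJ_ld HM' w1' Ac Bd ht dt; rewrite (invM1 HM w1) => nt.
    by apply: rgood_K => //; exact: (isJ_inv HM w1 ht jt).
  have [f hf df] := ex_ld w1; have [t ht dt] := ex_rd w1.
  apply: (partner_from_both w1 nd hf df (gl f hf df) ht dt (gr t ht dt)).
  by move=> p p' hp dp _ _; left; exact: gl.
have [[c Bc]|nB] := pselect (exists c, twistedJ w M c).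
  have : partner w^-1 (invM M).
    apply: partner_twistedK (twistedJ_inv HM w1 Bc) _ => // c' Bc'.
    have := twistedJ_inv HM' w1' Bc'; rewrite invgK invMK => Ac'.
    by apply: nA; exists c'.
  by move/(partner_inv HM' w1'); rewrite invgK invMK.
have nA' d : ~ twistedK w M d by move=> h; apply: nA; exists d.
have nB' d : ~ twistedJ w M d by move=> h; apply: nB; exists d.
have [f [hf df jf]] := isJ_descent HM w1 D4 nA'.
have [|t [ht dt jt]] := isJ_descent HM' w1' D4.
  by move=> d /(twistedK_inv HM' w1'); rewrite invgK invMK; exact: nB'.
rewrite ldV // in dt; have kt := isJ_inv HM w1 ht jt.
have gl p : simple W p -> isJ M p -> lgood w M p by move=> hp jp; exact: lgood_J.
have gr p : simple W p -> isK M p -> rgood w M p by move=> hp jp; exact: rgood_K.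
apply: (partner_from_both w1 nd hf df (gl f hf jf) ht dt (gr t ht kt)).
move=> p p' hp dp hp' dp'.
have [/(gl p hp)|kp] := isJP HM w1 hp (ld_le hp dp); first by left.
have [/(gr p' hp')|jp] := isKP HM w1 hp' (rd_le hp' dp'); first by right.
exfalso; apply: (no_Kp_s_Jp HM w1 kp jp); rewrite -wmulA; apply: lift_le => //.
by apply: rlift_le => //; exact: M1_le_w HM.
Qed.

End Partner.

(** * Dihedral subgroups with m at most 4 *)

Section DoublyLaced.
Variable W : coxeterSystem.
Implicit Types (a b x y : W).
Local Open Scope group_scope.

Lemma take_alt a b m n : (m <= n)%N -> take m (alt a b n) = alt a b m.
Proof.
by elim: m n a b => [|m IH] [|n] a b //=; rewrite ltnS => /IH ->.
Qed.

(** In the prefix of length k + 1 the tail can be replaced by the alternating word that starts with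
    [a], so two letters [a] meet and cancel. *)
Lemma alt_not_reduced a b k n : prodw (alt a b k) = prodw (alt b a k) ->
  (0 < k < n)%N -> ~ reduced (alt a b n).
Proof.
case: k => // k e /andP[_ kn] hn.
have hk : reduced (alt a b k.+2).
  rewrite -(take_alt a b kn).
  have := hn; rewrite -{1}(cat_take_drop k.+2 (alt a b n)) => h.
  by have [] := reduced_cat h.
have [ha rk /negP[]] := reduced_cons hk.
have rk' : reduced (alt a b k.+1).
  split; last by rewrite e (proj2 rk); exact: etrans (size_alt b a k.+1) (esym (size_alt a b k.+1)).
  move=> r; rewrite -(take_alt a b (ltnW kn)) => /mem_take.
  exact: (proj1 hn).
have [_ _ h] := reduced_cons rk'.
by rewrite -e /= prodw_cons ldM.
Qed.

Lemma alt_braid a b n : simple W a -> simple W b ->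
  (a * b) ^+ n = 1 -> (2 <= n <= 4)%N ->
  prodw (alt a b n) = prodw (alt b a n).
Proof.
move=> ha hb e hn.
case: n hn e => [|[|[|[|[|]]]]] //= _;
  rewrite ?expgS expg0 ?mulg1 !prodw_cons !prodw_nil ?mulg1 ?wmulA => e.
- have h : a * b * (a * b) = 1 by rewrite wmulA.
  by have := mulg1_eq h; rewrite inv2.
- have h : a * b * a * (b * a * b) = 1 by rewrite !wmulA.
  by have := mulg1_eq h; rewrite inv3.
- have h : a * b * a * b * (a * b * a * b) = 1 by rewrite !wmulA.
  by have := mulg1_eq h; rewrite invMg inv3 // (simple_inv hb) !wmulA.
Qed.

(** Lengths in the dihedral subgroup are at most m(a, b), so length 4 is reached only for m(a, b) =
    4, and there the braid relation identifies the two alternating words. *)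
Lemma doubly_laced_dl4 : doubly_laced W -> dl4 W.
Proof.
move=> hdl a b x y ha hb dx dy exy lx.
have nab : a <> b.
  move=> e; rewrite e in dx; have dx' : inW (fun q => q = b) x.
    by apply: inW_sub dx => r _ _ [].
  by case: (inW_one hb dx') => ex; rewrite ex ?len1 ?len_simple in lx.
have [n hn n4] := hdl a b ha hb.
have n2 : (2 <= n)%N.
  case: n hn {n4} => [|[|//]] hn; first by case: (coxeter_matrix_neq0 ha hb).
  by case: nab; apply/(coxeter_matrix_diag ha hb).
have e : prodw (alt a b n) = prodw (alt b a n).
  by apply: alt_braid; rewrite ?n2 //; exact: relator_prod.
have bound z : dih a b z -> (len z <= n)%N.
  move=> dz; rewrite leqNgt; apply/negP => ln.
  have [l [hl hin el]] := inW_red dz.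
  have sl : size l = len z by rewrite -el (proj2 hl).
  have hk : (0 < n < size l)%N by rewrite sl ln (leq_trans _ n2).
  case: (reduced_alt hl hin) => el'; rewrite el' in hl.
    exact: alt_not_reduced e hk hl.
  exact: alt_not_reduced (esym e) hk hl.
have ln : len x = n by apply/eqP; rewrite eqn_leq bound //= (leq_trans n4).
have := dih_alt dx; have := dih_alt dy; rewrite -exy ln -e.
by case=> -> [] ->.
Qed.

Lemma dihedral_dih : dihedral W -> exists a b : W, forall w : W, dih a b w.
Proof.
case/card_set_bijP => f [f1 f2 f3].
have [a ha ea] := f3 0%N isT; have [b hb eb] := f3 1%N isT.
exists a, b => w; apply: inWP => s hs _.
have : f s = 0%N \/ f s = 1%N by have := f1 s hs; rewrite /= ; case: (f s) => [|[|]]; [left|right|].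
by case=> e; [left|right]; apply: f2; rewrite ?inE // e.
Qed.
End DoublyLaced.

Import GRing.Theory.
Local Open Scope ring_scope.

(** * Ordinary R-polynomials *)

Section RPolynomials.
Variable W : coxeterSystem.
Implicit Types (s t u v w x y z f : W) (l : seq W) (M N : W -> W) (h g : W -> {poly int}).

(* The recursion for R-polynomials reads [R _ w = Tmat M (R _ (M w))], where [M] is
   left multiplication by a left descent of [w]. *)
Definition Tmat M h u : {poly int} :=
  if up M u then ('X - 1) * h u + 'X * h (M u) else h (M u).

Lemma eq_Tmat M h g u : h u = g u -> h (M u) = g (M u) -> Tmat M h u = Tmat M g u.
Proof. by rewrite /Tmat => -> ->. Qed.

(** The orbit of [u] under [M] and [N] is a square, or a pair if [M u = N u]. In a square the
    operators commute as soon as opposite edges point in the same direction. *)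
Lemma Tmat_comm M N h u : M (M u) = u -> N (N u) = u -> M (N u) = N (M u) ->
  (M u <> N u -> up M (N u) = up M u /\ up N (M u) = up N u) ->
  Tmat M (Tmat N h) u = Tmat N (Tmat M h) u.
Proof.
move=> hM hN hMN hup; have [e|ne] := pselect (M u = N u).
  have eu : up M u = up N u by rewrite /up e.
  have hv : N (M u) = u by rewrite e.
  have hv' : M (N u) = u by rewrite -e.
  have eu' : up M (N u) = up N (M u) by rewrite /up hv hv' e.
  by rewrite /Tmat eu eu' hv hv' e; case: (up N u).
have [e1 e2] := hup ne.
rewrite /Tmat e1 e2 hMN; case: (up M u); case: (up N u) => //; ring.
Qed.

(* For a left multiplication [M], [Lmat M] is ['X] times the inverse of [Tmat M].
   It maps delta functions to delta functions on length-increasing steps, so the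
   braid relations are immediate for it; those for [Tmat M] follow by inversion. *)
Definition Lmat M h u : {poly int} :=
  if up M u then 'X * h (M u) else h (M u) - ('X - 1) * h u.

Lemma Lmat_comm M N h u : M (M u) = u -> N (N u) = u -> M (N u) = N (M u) ->
  (M u <> N u -> up M (N u) = up M u /\ up N (M u) = up N u) ->
  Lmat M (Lmat N h) u = Lmat N (Lmat M h) u.
Proof.
move=> hM hN hMN hup; have [e|ne] := pselect (M u = N u).
  have eu : up M u = up N u by rewrite /up e.
  have hv : N (M u) = u by rewrite e.
  have hv' : M (N u) = u by rewrite -e.
  have eu' : up M (N u) = up N (M u) by rewrite /up hv hv' e.
  by rewrite /Lmat eu eu' hv hv' e; case: (up N u).
have [e1 e2] := hup ne.
rewrite /Lmat e1 e2 hMN; case: (up M u); case: (up N u) => //; ring.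
Qed.

Local Notation lmul s := (fun u : W => (s * u)%g).
Local Notation rmul t := (fun u : W => (u * t)%g).

Lemma up_lmul s u : simple W s -> up (lmul s) u = ~~ ld s u.
Proof.
by move=> hs; rewrite /up /ld; case: (len_sl u hs) => ->; rewrite -leqNgt ?leqnSn //; lia.
Qed.

Lemma up_rmul t u : simple W t -> up (rmul t) u = ~~ rd t u.
Proof.
by move=> hs; rewrite /up /rd; case: (len_sr u hs) => ->; rewrite -leqNgt ?leqnSn //; lia.
Qed.

(** The condition on opposite edges for a left and a right multiplication: a left descent gained in
    passing from [v] up to [v * t] means [v * t = s * v]. *)
Lemma ld_rmul s t u : simple W s -> simple W t -> (s * u <> u * t)%g ->
  ld s (u * t)%g = ld s u.
Proof.
move=> hs ht.
have H v : ~~ rd t v -> (s * v <> v * t)%g -> ld s (v * t)%g = ld s v.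
  move=> nr ne; apply/idP/idP => h.
    apply/negPn/negP => nd; apply: ne; apply/esym/(cov_ld' hs) => //.
    by split; [exact: br_rup|rewrite rdN_len].
  have e : len (v * t)%g = (len v + len t)%N by rewrite (rdN_len ht nr) (len_simple ht) addn1.
  exact: (ld_prefix e h).
have [r ne|r ne] := boolP (rd t u); last exact: H.
have := H (u * t)%g; rewrite simpleKr // rdM // r => -> //.
by move=> e; apply: ne; rewrite -{2}e wmulA simpleKr.
Qed.

Lemma rd_lmul s t u : simple W s -> simple W t -> (s * u <> u * t)%g ->
  rd t (s * u)%g = rd t u.
Proof.
move=> hs ht ne; rewrite -!ldV // invMg (simple_inv hs) ld_rmul // => e; apply: ne.
by apply: invg_inj; rewrite !invMg (simple_inv hs) (simple_inv ht).
Qed.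

Section LeftRight.
Variables (s t : W).
Hypotheses (hs : simple W s) (ht : simple W t).

Lemma Tmat_lr h : Tmat (lmul s) (Tmat (rmul t) h) = Tmat (rmul t) (Tmat (lmul s) h).
Proof.
apply: funext => u; apply: Tmat_comm; rewrite ?simpleK ?simpleKr ?wmulA //.
by move=> ne; rewrite !up_lmul // !up_rmul // ld_rmul // rd_lmul.
Qed.

Lemma Lmat_lr h : Lmat (lmul s) (Lmat (rmul t) h) = Lmat (rmul t) (Lmat (lmul s) h).
Proof.
apply: funext => u; apply: Lmat_comm; rewrite ?simpleK ?simpleKr ?wmulA //.
by move=> ne; rewrite !up_lmul // !up_rmul // ld_rmul // rd_lmul.
Qed.
End LeftRight.

Lemma Tmat_Lmat s h : simple W s ->
  Tmat (lmul s) (Lmat (lmul s) h) = (fun u => 'X * h u).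
Proof.
move=> hs; apply: funext => u; rewrite /Tmat /Lmat !up_lmul // ldM // simpleK //.
case: (ld s u) => /=; ring.
Qed.

Lemma Lmat_Tmat s h : simple W s ->
  Lmat (lmul s) (Tmat (lmul s) h) = (fun u => 'X * h u).
Proof.
move=> hs; apply: funext => u; rewrite /Tmat /Lmat !up_lmul // ldM // simpleK //.
case: (ld s u) => /=; ring.
Qed.

Lemma Tmat_scale M c h : Tmat M (fun u => c * h u) = (fun u => c * Tmat M h u).
Proof. by apply: funext => u; rewrite /Tmat; case: up; ring. Qed.

Lemma Lmat_lin M c h g :
  Lmat M (fun u => c * h u + g u) = (fun u => c * Lmat M h u + Lmat M g u).
Proof. by apply: funext => u; rewrite /Lmat; case: up; ring. Qed.

Definition delta1 v u : {poly int} := (u == v)%:R.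

Lemma Lmat_delta1 s w : simple W s -> ~~ ld s w -> Lmat (lmul s) (delta1 w) = delta1 (s * w)%g.
Proof.
move=> hs nd; apply: funext => u; rewrite /Lmat up_lmul // /delta1.
have [->|ne] := eqVneq u (s * w)%g.
  rewrite ldM // nd /= simpleK // eqxx [_ == w]negbTE ?mulr0 ?subr0 //.
  by apply/eqP => e; move: (ldM w hs); rewrite e (negbTE nd).
have -> : (s * u == w)%g = false.
  by apply/negbTE; apply: contra ne => /eqP <-; rewrite simpleK.
rewrite mulr0; have [->|//] := eqVneq u w; last by rewrite mulr0 subr0 if_same.
by rewrite nd.
Qed.

Lemma Lmat_delta1r t w : simple W t -> ~~ rd t w -> Lmat (rmul t) (delta1 w) = delta1 (w * t)%g.
Proof.
move=> hs nd; apply: funext => u; rewrite /Lmat up_rmul // /delta1.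
have [->|ne] := eqVneq u (w * t)%g.
  rewrite rdM // nd /= simpleKr // eqxx [_ == w]negbTE ?mulr0 ?subr0 //.
  by apply/eqP => e; move: (rdM w hs); rewrite e (negbTE nd).
have -> : (u * t == w)%g = false.
  by apply/negbTE; apply: contra ne => /eqP <-; rewrite simpleKr.
rewrite mulr0; have [->|//] := eqVneq u w; last by rewrite mulr0 subr0 if_same.
by rewrite nd.
Qed.

Definition Tword l h := foldr (fun s k => Tmat (lmul s) k) h l.
Definition Lword l h := foldr (fun s k => Lmat (lmul s) k) h l.

Lemma Tword_scale l c h : Tword l (fun u => c * h u) = (fun u => c * Tword l h u).
Proof. by elim: l => //= s l ->; rewrite Tmat_scale. Qed.

Lemma Lword_lin l c h g :
  Lword l (fun u => c * h u + g u) = (fun u => c * Lword l h u + Lword l g u).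
Proof. by elim: l => //= s l ->; rewrite Lmat_lin. Qed.

Lemma Lword_scale l c h : Lword l (fun u => c * h u) = (fun u => c * Lword l h u).
Proof.
have e0 : Lword l (fun=> 0) = (fun=> 0).
  elim: l => //= s l ->; apply: funext => u; rewrite /Lmat !mulr0 subr0; exact: if_same.
have -> : (fun u => c * h u) = (fun u => c * h u + 0) by apply: funext => u; rewrite addr0.
by rewrite Lword_lin e0; apply: funext => u; rewrite addr0.
Qed.

Lemma Lword_delta1 l : reduced l -> Lword l (delta1 1%g) = delta1 (prodw l).
Proof.
elim: l => [_|s l IH hl]; first by rewrite prodw_nil.
by have [hs rl hd] := reduced_cons hl; rewrite /= IH // Lmat_delta1 // prodw_cons.
Qed.

Lemma Lword_rmul l t h : sword l -> simple W t ->
  Lword l (Lmat (rmul t) h) = Lmat (rmul t) (Lword l h).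
Proof.
move=> hl ht; elim: l hl => //= s l IH /sword_cons[hs hl].
by rewrite IH // Lmat_lr.
Qed.

Lemma Tword_rmul l t h : sword l -> simple W t ->
  Tword l (Tmat (rmul t) h) = Tmat (rmul t) (Tword l h).
Proof.
move=> hl ht; elim: l hl => //= s l IH /sword_cons[hs hl].
by rewrite IH // Tmat_lr.
Qed.

(** Independence of the reduced word without braid moves: [delta1 v] is built from [delta1 1] by
    right operators, which commute with the left ones, and on [delta1 1] the result is visibly
    [delta1 (prodw l)]. *)
Lemma Lword_eq_delta1 l l' v : reduced l -> reduced l' -> prodw l = prodw l' ->
  Lword l (delta1 v) = Lword l' (delta1 v).
Proof.
move=> hl hl' e; have [n] := ubnP (len v); elim: n v => // n IH v hn.
have [->|ne] := pselect (v = 1%g); first by rewrite !Lword_delta1 // e.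
have [t ht dt] := ex_rd ne; have lv := rd_len ht dt.
have -> : delta1 v = Lmat (rmul t) (delta1 (v * t)%g).
  by rewrite Lmat_delta1r ?simpleKr // rdM // dt.
rewrite !Lword_rmul ?IH //; [by lia|exact: (proj1 hl')|exact: (proj1 hl)].
Qed.

(** Finite support makes [h] a finite combination of delta functions, to which [Lword_eq_delta1]
    extends by linearity. *)
Definition fsupp h := exists r : seq W, forall u, u \notin r -> h u = 0.

Lemma Lword_eq l l' h : reduced l -> reduced l' -> prodw l = prodw l' ->
  fsupp h -> Lword l h = Lword l' h.
Proof.
move=> hl hl' e [r]; elim: r h => [|v r IH] h hr.
  have -> : h = (fun u => 0 * h u) by apply: funext => u; rewrite hr ?mulr0.
  by rewrite !Lword_scale; apply: funext => u; rewrite !mul0r.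
pose g u := if u == v then 0 else h u.
have -> : h = (fun u => h v * delta1 v u + g u).
  apply: funext => u; rewrite /g /delta1; have [->|_] := eqVneq u v.
    by rewrite mulr1 addr0.
  by rewrite mulr0 add0r.
rewrite !Lword_lin (Lword_eq_delta1 _ hl hl' e) (IH g) // => u ur.
by rewrite /g; case: eqVneq => // ne; apply: hr; rewrite inE negb_or ne.
Qed.

Lemma fsupp_Tword l : sword l -> fsupp (Tword l (delta1 1%g)).
Proof.
elim: l => [_|s l IH /sword_cons[hs /IH[r hr]]] /=.
  by exists [:: 1%g] => u; rewrite inE /delta1 => /negbTE->.
exists (r ++ map (lmul s) r) => u; rewrite mem_cat negb_or => /andP[h1 h2].
have h3 : (s * u)%g \notin r.
  by apply: contra h2 => h; apply/mapP; exists (s * u)%g; rewrite ?simpleK.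
by rewrite /Tmat !hr // !mulr0 addr0 if_same.
Qed.

Lemma Tword_Lword l h : sword l ->
  Tword l (Lword (rev l) h) = (fun u => 'X^(size l) * h u).
Proof.
elim: l h => [|s l IH] h /=; first by move=> _; apply: funext => u; rewrite mul1r.
case/sword_cons => hs hl; rewrite rev_cons -cats1 /Lword foldr_cat /= -/(Lword _ _) IH //.
by rewrite Tmat_scale Tmat_Lmat //; apply: funext => u; rewrite mulrA -exprSr.
Qed.

Lemma Lword_Tword l h : sword l ->
  Lword (rev l) (Tword l h) = (fun u => 'X^(size l) * h u).
Proof.
elim: l h => [|s l IH] h /=; first by move=> _; apply: funext => u; rewrite mul1r.
case/sword_cons => hs hl; rewrite rev_cons -cats1 /Lword foldr_cat /= -/(Lword _ _).
by rewrite Lmat_Tmat // Lword_scale IH //; apply: funext => u; rewrite mulrA -exprS.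
Qed.

Lemma reduced_rev l : reduced l -> reduced (rev l).
Proof.
case=> h e; split; first exact/sword_rev.
by rewrite prodw_rev // lenV e size_rev.
Qed.

(** [Tword l] and [Lword (rev l)] are inverse to each other up to the factor 'X^(size l); the
    independence known for the reversed words is transferred and the factor cancelled. *)
Lemma Tword_eq l l' : reduced l -> reduced l' -> prodw l = prodw l' ->
  Tword l (delta1 1%g) = Tword l' (delta1 1%g).
Proof.
move=> hl hl' e; have [sl sl'] := (proj1 hl, proj1 hl').
have esz : size l = size l' by rewrite -(proj2 hl) e (proj2 hl').
have e1 : Lword (rev l) (Tword l' (delta1 1%g)) = (fun u => 'X^(size l) * delta1 1%g u).
  rewrite (@Lword_eq _ (rev l')) ?Lword_Tword ?esz //; try exact: reduced_rev.
    by rewrite !prodw_rev // e.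
  exact: fsupp_Tword.
have := Tword_Lword (Tword l' (delta1 1%g)) sl; rewrite e1 Tword_scale => e2.
apply: funext => u; have /(congr1 (fun k => k u)) := e2.
by move/(mulfI (monic_neq0 (monicXn _ _))).
Qed.

Definition redword v : seq W := sval (cid (reduced_word v)).

Lemma redwordP v : reduced (redword v) /\ prodw (redword v) = v.
Proof.
by rewrite /redword; case: cid => l [h1 h2 h3] /=; split=> //; split; rewrite // h2.
Qed.

(** The whole column of [v] is obtained at once by unrolling the recursion along a chosen reduced
    word; [Tword_eq] makes the choice immaterial. *)
Definition Rpol u v : {poly int} := Tword (redword v) (delta1 1%g) u.

Lemma Rpol_word l u : reduced l -> Rpol u (prodw l) = Tword l (delta1 1%g) u.
Proof.
by move=> hl; have [h1 h2] := redwordP (prodw l); rewrite /Rpol (Tword_eq h1 hl h2).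
Qed.

Lemma Rpol_ld s v u : simple W s -> ld s v ->
  Rpol u v = Tmat (lmul s) (Rpol^~ (s * v)%g) u.
Proof.
move=> hs dv; have [l hl e] := exists_reduced (s * v)%g.
have hsl : reduced (s :: l) by apply: reduced_consI; rewrite // e ldM // dv.
have ev : v = prodw (s :: l) by rewrite prodw_cons e simpleK.
rewrite {1}ev Rpol_word //= -e; apply: eq_Tmat; by rewrite Rpol_word.
Qed.

Lemma Tmat_delta1 t : simple W t -> Tmat (lmul t) (delta1 1%g) = Tmat (rmul t) (delta1 1%g).
Proof.
move=> ht; apply: funext => u; rewrite /Tmat up_lmul // up_rmul // /delta1.
have -> : (t * u == 1)%g = (u * t == 1)%g.
  by rewrite !mulg_eq1 (simple_inv ht) -{2}(simple_inv ht) -eqg_invLR (simple_inv ht).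
have [->|nu] := eqVneq u 1%g; first by rewrite ld1 rd1.
rewrite mulr0 add0r; have [e|_] := eqVneq (u * t)%g 1%g; last by rewrite mulr0 !if_same.
have -> : u = t by rewrite -(simpleKr ht u) e mul1g.
by rewrite /ld /rd simple_sqr // len1 len_simple.
Qed.

(** Left and right operators of [t] agree on [delta1 1], and the right one then commutes past the
    rest of the word. *)
Lemma Rpol_rd t v u : simple W t -> rd t v ->
  Rpol u v = Tmat (rmul t) (Rpol^~ (v * t)%g) u.
Proof.
move=> ht dv; have [l hl e] := exists_reduced (v * t)%g.
have lt : prodw (l ++ [:: t]) = v by rewrite prodw_cat prodw_seq1 e simpleKr.
have hlt : reduced (l ++ [:: t]).
  split; first by apply/sword_cat; split; [case: hl|apply/sword_cons].
  by rewrite lt (rd_len ht dv) -e (proj2 hl) size_cat addn1.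
rewrite -{1}lt Rpol_word // /Tword foldr_cat /= Tmat_delta1 // -/(Tword _ _).
rewrite Tword_rmul //; last by case: hl.
by rewrite -e; apply: eq_Tmat; rewrite Rpol_word.
Qed.

Lemma Rpol1 u : Rpol u 1%g = delta1 1%g u.
Proof.
by rewrite -(prodw_nil W) Rpol_word ?prodw_nil //; split; rewrite // prodw_nil len1.
Qed.

Lemma Rpol_out u v : ~ u <=b v -> Rpol u v = 0.
Proof.
have [n] := ubnP (len v); elim: n u v => // n IH u v hn nuv.
have [e|ne] := pselect (v = 1%g).
  rewrite e Rpol1 /delta1; case: eqVneq => // eu; case: nuv; rewrite eu; exact: br1.
have [s hs dv] := ex_ld ne; have lv := ld_len hs dv.
rewrite (Rpol_ld _ hs dv) /Tmat up_lmul //.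
have h1 : Rpol u (s * v)%g = 0.
  apply: IH; first by lia.
  by move=> h; apply: nuv; apply: br_trans h (br_dn hs dv).
have h2 : Rpol (s * u)%g (s * v)%g = 0.
  apply: IH; first by lia.
  move=> h; apply: nuv; rewrite -(simpleK hs u); apply: lift_le => //.
  by apply: br_trans h (br_dn hs dv).
by rewrite h1 h2 !mulr0 addr0 if_same.
Qed.

Lemma Rpol_diag v : Rpol v v = 1.
Proof.
have [n] := ubnP (len v); elim: n v => // n IH v hn.
have [->|ne] := pselect (v = 1%g); first by rewrite Rpol1 /delta1 eqxx.
have [s hs dv] := ex_ld ne; have lv := ld_len hs dv.
by rewrite (Rpol_ld _ hs dv) /Tmat up_lmul // dv /= IH //; lia.
Qed.

End RPolynomials.

Arguments Rpol {W} u v.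

(** * Invariance of the ordinary R-polynomials *)

(** The R-polynomial of a dihedral interval as a function of the length difference. The value at 2
    is exceptional: there [M u] and [M w] are distinct of equal length, so the 'X-term of the
    recursion vanishes. *)
Fixpoint rho n : {poly int} :=
  match n with
  | 0 => 1
  | 1 => 'X - 1
  | 2 => ('X - 1) ^+ 2
  | (n'.+1 as m).+1 => ('X - 1) * rho m + 'X * rho n'
  end.

Lemma rho3 n : rho n.+3 = ('X - 1) * rho n.+2 + 'X * rho n.+1.
Proof. by []. Qed.

Section Calculating.
Variable W : coxeterSystem.
Implicit Types (s t u v w x y z f : W) (M N : W -> W) (h : W -> {poly int}).

Lemma special_right t w : simple W t -> rd t w -> special w (fun u => u * t)%g.
Proof.
move=> ht dw; have := special_inv (special_left ht (_ : ld t w^-1)%g).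
rewrite ldV // invgK => /(_ dw); congr special; apply: funext => u.
by rewrite invMg invgK (simple_inv ht).
Qed.

(** If [M] and [N] move [u] in opposite directions, counting lengths around the square suffices. If
    they move it in the same direction, [sm_sp] applied to one edge orders the opposite one. *)
Lemma sign_special w M N u : special w M -> special w N -> u <=b w ->
  M (N u) = N (M u) -> M u <> N u -> up M (N u) = up M u.
Proof.
move=> HM HN hu e ne.
have hMu := sm_le HM hu; have hNu := sm_le HN hu.
have lM : len (M (N u)) = len (N (M u)) by rewrite e.
have [uM|uM] := boolP (up M u); have [uN|uN] := boolP (up N u).
- have [c1 c2] := up_cov HM hu uM; have [d1 d2] := up_cov HN hu uN.
  have h := sm_sp HN hMu (conj c1 c2) (not_eq_sym ne).
  rewrite -e in h; apply/negPn/negP => h'.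
  by have [_] := dn_cov HM hNu h'; have := br_leq h; clear; lia.
- have [_ c2] := up_cov HM hu uM; have [_ d2] := dn_cov HN hu uN.
  apply/negPn/negP => h'; have [_ e1] := dn_cov HM hNu h'.
  case: (sm_cov HN hMu) => [[_ e2]|[_ e2]]; move: lM c2 d2 e1 e2; clear; lia.
- have [_ c2] := dn_cov HM hu uM; have [_ d2] := up_cov HN hu uN.
  apply/negP => h'; have [_ e1] := up_cov HM hNu h'.
  case: (sm_cov HN hMu) => [[_ e2]|[_ e2]]; move: lM c2 d2 e1 e2; clear; lia.
- have [_ c2] := dn_cov HM hu uM; have dN := dn_cov HN hu uN.
  apply/negP => h'; have [_ e1] := up_cov HM hNu h'.
  have ne' : M (N u) <> u by move=> h; apply: ne; rewrite -{1}h (sm_K HM).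
  have := br_leq (sm_sp HM hu dN ne'); case: dN => _ d2.
  by move: c2 d2 e1; clear; lia.
Qed.

(** In a dihedral interval a strict length inequality already gives comparability, so every special
    matching, multiplication or not, leads to the same recursion. *)
Lemma Tmat_rho w M a b h u : special w M -> dih a b w ->
  (forall x, x <=b M w -> h x = rho (len (M w) - len x)) ->
  (forall x, ~ x <=b M w -> h x = 0) -> u <=b w ->
  Tmat M h u = rho (len w - len u).
Proof.
move=> HM Dw h1 h0 hu; have [_ lw] := dn_cov HM (br_refl w) (sm_w HM).
have hMu := sm_le HM hu; have hMw := sm_le HM (br_refl w).
rewrite /Tmat; have [uM|uM] := boolP (up M u); last first.
  have [_ lu] := dn_cov HM hu uM.
  rewrite h1; last exact: (sm_dn_dn HM (br_refl w) hu (sm_w HM) uM).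
  by congr rho; move: lw lu; clear; lia.
have [_ lu] := up_cov HM hu uM.
have huM := sm_dn_up HM (br_refl w) hu (sm_w HM) uM.
rewrite h1 //; have l1 := br_leq huM.
have nMu : (len (M w) <= len (M u))%N -> M u <=b M w -> False.
  move=> h2 h3; have e := br_eq h3 h2.
  have ew : u = w by rewrite -(sm_K HM hu) e (sm_K HM (br_refl w)).
  by have := sm_w HM; rewrite -ew uM.
have [e|ne] := eqVneq (len u) (len (M w)).
  have e1 : (len w - len u)%N = 1%N by move: lw lu e; clear; lia.
  rewrite e1 e subnn h0 /= ?mulr1 ?mulr0 ?addr0 //.
  by apply: nMu; move: lw lu e; clear; lia.
have [e|ne'] := eqVneq (len u).+1 (len (M w)).
  have e1 : (len w - len u)%N = 2%N by move: lw lu e; clear; lia.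
  have e2 : (len (M w) - len u)%N = 1%N by move: lw lu e; clear; lia.
  rewrite e1 e2 h0 /= ?mulr0 ?addr0 ?expr2 //.
  by apply: nMu; move: lw lu e; clear; lia.
rewrite h1; last first.
  apply: (dih_le (inW_le hMu Dw) (inW_le hMw Dw)).
  by move/eqP: ne; move/eqP: ne'; move: lw lu l1; clear; lia.
have [k ek] : exists k, (len w - len u)%N = k.+3.
  exists (len w - len u - 3)%N.
  by move/eqP: ne; move/eqP: ne'; move: lw lu l1; clear; lia.
have -> : (len (M w) - len u)%N = k.+2 by move: lw lu ek; clear; lia.
have -> : (len (M w) - len (M u))%N = k.+1 by move: lw lu ek; clear; lia.
by rewrite ek rho3.
Qed.

Lemma Rpol_dih a b u w : dih a b w -> u <=b w -> Rpol u w = rho (len w - len u).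
Proof.
have [n] := ubnP (len w); elim: n u w => // n IH u w hn Dw hu.
have [e|ne] := pselect (w = 1%g).
  have -> : u = w by apply: br_anti => //; rewrite e; exact: br1.
  by rewrite Rpol_diag subnn.
have [s hs dw] := ex_ld ne; have lw := ld_len hs dw.
rewrite (Rpol_ld _ hs dw).
apply: (Tmat_rho (special_left hs dw) Dw) => // x hx; last exact: Rpol_out.
by apply: IH => //; [lia|apply: inW_le Dw; exact: br_dn].
Qed.

(** As [M] and [N] commute and differ at [w], [M] goes down from [N w] and is special there. Write T
    for the operators and R_v for the column of [v]: R_w = T_N R_(N w) = T_N T_M R_(M N w) = T_M T_N
    R_(N M w) = T_M R_(M w). *)
Lemma Rpol_special_step w M N : special w M -> special w N -> w <> 1%g ->
  (forall v u, ~~ up N v -> Rpol u v = Tmat N (Rpol^~ (N v)) u) ->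
  (forall v, (len v < len w)%N -> special v M -> v <> 1%g -> forall u, u <=b v ->
    Rpol u v = Tmat M (Rpol^~ (M v)) u) ->
  N w <> M w -> (forall u, u <=b w -> M (N u) = N (M u)) ->
  forall u, u <=b w -> Rpol u w = Tmat M (Rpol^~ (M w)) u.
Proof.
move=> HM HN w1 HR IH new comm u hu.
have hw := br_refl w; have nMw := sm_w HM; have nNw := sm_w HN.
have hNw := sm_le HN hw; have hMw := sm_le HM hw.
have nMN : ~~ up M (N w).
  by rewrite (sign_special HM HN hw (comm _ hw)) //; exact: nesym.
have nNM : ~~ up N (M w).
  by rewrite (sign_special HN HM hw _ new) //; exact/esym/comm.
have Nw1 : N w <> 1%g by move=> e; have := up_M1 HM; rewrite -e (negbTE nMN).
have HM' := special_res HM hNw nMN.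
have [_ lw] := dn_cov HN hw nNw.
(* T_N is evaluated at [u] and [N u], which need not lie below [N w]; there both sides vanish. *)
have ext x : x <=b w -> Rpol x (N w) = Tmat M (Rpol^~ (M (N w))) x.
  move=> hx; have [hx'|nx] := pselect (x <=b N w).
    by apply: IH => //; rewrite lw.
  have hMN := sm_le HM' (br_refl (N w)).
  rewrite Rpol_out // /Tmat [Rpol x _]Rpol_out; last first.
    by move=> h; apply: nx; exact: br_trans h hMN.
  rewrite [Rpol (M x) _]Rpol_out; first by rewrite !mulr0 addr0 if_same.
  move=> h; apply: nx; rewrite -(sm_K HM hx); apply: (sm_le HM').
  exact: br_trans h hMN.
rewrite (HR w u nNw) (@eq_Tmat _ _ _ (Tmat M (Rpol^~ (M (N w)))));
  [|exact: ext|exact/ext/(sm_le HN)].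
have -> : Tmat N (Tmat M (Rpol^~ (M (N w)))) u = Tmat M (Tmat N (Rpol^~ (M (N w)))) u.
  apply: Tmat_comm; [exact: (sm_K HN)|exact: (sm_K HM)|exact/esym/comm|].
  move=> ne; split.
    by apply: (sign_special HN HM) => //; exact/esym/comm.
  by apply: (sign_special HM HN) => //; [exact: comm|exact: nesym].
by apply: eq_Tmat; rewrite comm // -HR.
Qed.

Lemma Rpol_special w M u : dl4 W -> special w M -> w <> 1%g -> u <=b w ->
  Rpol u w = Tmat M (Rpol^~ (M w)) u.
Proof.
move=> D4; have [n] := ubnP (len w); elim: n w u => // n IH w u hn HM w1 hu.
have IH' v : (len v < len w)%N -> special v M -> v <> 1%g -> forall u, u <=b v ->
    Rpol u v = Tmat M (Rpol^~ (M v)) u.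
  by move=> lv Hv v1 x hx; apply: IH => //; move: lv hn; clear; lia.
have [[a [b D]]|ND] := pselect (exists a b, dih a b w).
  rewrite (Rpol_dih D hu); apply/esym; apply: (Tmat_rho HM D) => // x.
    by apply: Rpol_dih; apply: inW_le D; exact: (sm_le HM (br_refl w)).
  exact: Rpol_out.
have [|[f [hf df ne gf]]|[t [ht dt ne gt]]] := partner_exists HM D4 _ w1.
- by move=> a b _ _ D; apply: ND; exists a, b.
- apply: (Rpol_special_step HM (special_left hf df)) => // [v x|x hx].
    by rewrite up_lmul // negbK => dv; exact: Rpol_ld.
  by apply: (lgood_comm HM w1 D4) => //; exact: lift_le.
- apply: (Rpol_special_step HM (special_right ht dt)) => // [v x|x hx].
    by rewrite up_rmul // negbK => dv; exact: Rpol_rd.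
  by apply: (rgood_comm HM w1 D4) => //; exact: rlift_le.
Qed.
End Calculating.

(* Mutually inverse isomorphisms between the intervals [1, v1] and [1, v2]. *)
Record lower_iso (W1 W2 : coxeterSystem) (v1 : W1) (v2 : W2) (f : W1 -> W2) (g : W2 -> W1)
  : Prop := LowerIso {
  li_f : forall u u', u' <=b v1 -> u <=b u' -> f u <=b f u';
  li_g : forall y y', y' <=b v2 -> y <=b y' -> g y <=b g y';
  li_gf : forall u, u <=b v1 -> g (f u) = u;
  li_fg : forall y, y <=b v2 -> f (g y) = y;
  li_top : f v1 = v2
}.

Lemma lower_iso_sym (W1 W2 : coxeterSystem) (v1 : W1) (v2 : W2) f g :
  lower_iso v1 v2 f g -> lower_iso v2 v1 g f.
Proof. by case=> h1 h2 h3 h4 e; split=> //; rewrite -e (h3 _ (br_refl _)). Qed.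

Section LowerIsoBasics.
Variables (W1 W2 : coxeterSystem).
Implicit Types (u : W1) (y : W2) (f : W1 -> W2) (g : W2 -> W1).

Lemma li_le (v1 : W1) (v2 : W2) f g u : lower_iso v1 v2 f g -> u <=b v1 -> f u <=b v2.
Proof. by move=> L h; rewrite -(li_top L); apply: (li_f L) => //; exact: br_refl. Qed.

Lemma li_res (v1 : W1) (v2 : W2) f g w : lower_iso v1 v2 f g -> w <=b v1 -> lower_iso w (f w) f g.
Proof.
move=> L hw; have hfw := li_le L hw; split=> // [u u' h|y y' h|u h|y h].
- by apply: (li_f L); exact: br_trans hw.
- by apply: (li_g L); exact: br_trans hfw.
- by apply: (li_gf L); exact: br_trans hw.
- by apply: (li_fg L); exact: br_trans hfw.
Qed.

End LowerIsoBasics.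

Section LowerIsoTheory.
Variables (W1 W2 : coxeterSystem) (v1 : W1) (v2 : W2) (f : W1 -> W2) (g : W2 -> W1).
Hypothesis L : lower_iso v1 v2 f g.

Lemma li_gle y : y <=b v2 -> g y <=b v1.
Proof. exact: (li_le (lower_iso_sym L)). Qed.

Lemma li_inj u u' : u <=b v1 -> u' <=b v1 -> f u = f u' -> u = u'.
Proof. by move=> h h' e; rewrite -(li_gf L h) e (li_gf L h'). Qed.

Lemma li_leE u u' : u <=b v1 -> u' <=b v1 -> (f u <=b f u') -> u <=b u'.
Proof.
by move=> h h' k; rewrite -(li_gf L h) -(li_gf L h'); apply: (li_g L) => //; exact: li_le L h'.
Qed.

Lemma li_1 : f 1%g = 1%g.
Proof.
apply: br_anti; last exact: br1.
rewrite -(li_fg L (br1 v2)); apply: (li_f L); last exact: br1.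
exact/li_gle/br1.
Qed.

Lemma li_cov u u' : u' <=b v1 -> cov u u' -> cov (f u) (f u').
Proof.
move=> h' [h l]; have hu := br_trans h h'; have hf := li_f L h' h.
have ne : f u <> f u' by move=> /(li_inj hu h') e; move: l; rewrite e; lia.
have [x h1 h2] := br_cov hf ne; have hx := br_trans (proj1 h2) (li_le L h').
have gx := li_gle hx.
have e1 : u <=b g x by apply: li_leE => //; rewrite (li_fg L).
have e2 : g x <=b u' by apply: li_leE => //; rewrite (li_fg L) //; case: h2.
have ne2 : g x <> u'.
  by move=> e; case: h2 => _; rewrite -e (li_fg L) //; lia.
have -> : u = g x; last by rewrite (li_fg L).
by apply: br_eq => //; have := br_ltn e2 ne2; rewrite l.
Qed.

(** Length is the rank in a lower interval, so it is recovered by descending along covers. *)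
Lemma li_len u : u <=b v1 -> len (f u) = len u.
Proof.
have [n] := ubnP (len u); elim: n u => // n IH u hn hu.
have [e|ne] := pselect (u = 1%g); first by rewrite e li_1 !len1.
have [x _ c] := br_cov (br1 u) (nesym ne).
have [_ e1] := li_cov hu c; have hx := br_trans (proj1 c) hu.
case: c => _ e2; rewrite e1 e2 IH //; lia.
Qed.
End LowerIsoTheory.

Lemma li_dih (W1 W2 : coxeterSystem) (v1 : W1) (v2 : W2) f g a b : lower_iso v1 v2 f g ->
  dih a b v2 -> dih (g a) (g b) v1.
Proof.
move=> L D; apply: inWP => s hs sv; have hf := li_le L sv.
have hfs : simple W2 (f s) by apply: len_eq1; rewrite (li_len L) // len_simple.
by rewrite -(li_gf L sv); case: (inW_supp D hfs hf) => ->; [left|right].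
Qed.

Lemma Rpol_lower_iso (W1 W2 : coxeterSystem) (v1 : W1) (v2 : W2) f g u : lower_iso v1 v2 f g ->
  dl4 W2 \/ (exists a b, dih a b v2) -> u <=b v1 -> Rpol u v1 = Rpol (f u) v2.
Proof.
have [n] := ubnP (len v1); elim: n v1 v2 u => // n IH v1 v2 u hn L H hu.
have [D|ND] := pselect (exists a b, dih a b v2).
  have [a [b D']] := D; rewrite (Rpol_dih D' (li_le L hu)) (Rpol_dih (li_dih L D') hu).
  by rewrite -(li_top L) !(li_len L) //; exact: br_refl.
case: H => // D4.
have [e|ne] := pselect (v1 = 1%g).
  have -> : u = v1 by apply: br_anti => //; rewrite e; exact: br1.
  by rewrite (li_top L) !Rpol_diag.
have v21 : v2 <> 1%g.
  move=> e; apply: ne; apply: (li_inj L); [exact: br_refl|exact: br1|].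
  by rewrite (li_1 L) (li_top L).
have [s hs dv] := ex_ld ne; have lv := ld_len hs dv.
have sl x : x <=b v1 -> (s * x)%g <=b v1 by move=> h; exact: lift_le.
pose M y := f (s * g y)%g.
have HM : special v2 M.
  have Sp := special_left hs dv; have Ls := lower_iso_sym L.
  split=> [y hy|y hy|y hy|y z hz c ne'].
  - exact/(li_le L)/sl/(li_gle L).
  - by rewrite /M (li_gf L) ?simpleK ?(li_fg L) //; exact/sl/(li_gle L).
  - have gy := li_gle L hy; rewrite /M -{1 4}(li_fg L hy).
    by case: (sm_cov Sp gy) => c; [left|right]; apply: (li_cov L) => //; exact: sl.
  - have gz := li_gle L hz; apply: (li_f L); first exact: sl.
    apply: (sm_sp Sp gz (li_cov Ls hz c)) => e; apply: ne'.
    by rewrite /M e (li_fg L).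
have ev : M v2 = f (s * v1)%g by rewrite /M -(li_top L) (li_gf L) //; exact: br_refl.
have hsv : (s * v1)%g <=b v1 by exact: br_dn.
have ext x : x <=b v1 -> Rpol x (s * v1)%g = Rpol (f x) (M v2).
  move=> hx; rewrite ev; have [h|h] := pselect (x <=b (s * v1)%g).
    apply: (IH _ _ _ _ (li_res L hsv)) => //; last by left.
    by move: lv hn; clear; lia.
  by rewrite !Rpol_out // => h'; apply: h; exact: (li_leE L).
rewrite (Rpol_ld _ hs dv) (Rpol_special D4 HM v21 (li_le L hu)) /Tmat.
have -> : up M (f u) = up (fun u => s * u)%g u.
  by rewrite /up /M !(li_len L) ?(li_gf L) //; exact: sl.
by rewrite /M (li_gf L hu) -/(M v2) !ext //; exact: sl.
Qed.

Local Open Scope classical_set_scope.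

(** * Parabolic R-polynomials *)

Section Quotient.
Variables (W : coxeterSystem) (H : set W).
Implicit Types (s t u v w z b : W).

Lemma mcrP u : min_coset_reps H u <-> rnoJ H u.
Proof.
split=> [h s hs Hs|h s [hs ds]].
  by apply/negP => d; have [] := h s (conj hs d).
by split=> // Hs; have := h s hs Hs; rewrite /rd ds.
Qed.

Lemma mcr_desc s u : min_coset_reps H u -> simple W s -> ld s u ->
  min_coset_reps H (s * u)%g.
Proof.
move=> /mcrP hu hs ds; apply/mcrP => t ht Ht; apply: contra (hu t ht Ht) => dt.
have e : len (s * (s * u))%g = (len s + len (s * u)%g)%N.
  by rewrite simpleK // (ld_len hs ds) (len_simple hs) add1n.
by have := rd_suffix e dt; rewrite simpleK.
Qed.

(** A descent [t] in [H] of [s * u] that [u] lacks must account for the whole cover of [u] by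
    [s * u]. *)
Lemma mcr_asc_out s u : min_coset_reps H u -> simple W s -> ~~ ld s u ->
  ~ min_coset_reps H (s * u)%g -> exists2 t, simple W t /\ H t & (s * u = u * t)%g.
Proof.
move=> /mcrP hu hs ds nsu.
have [t [ht Ht dt]] : exists t, [/\ simple W t, H t & rd t (s * u)%g].
  apply: contrapT => h; apply: nsu; apply/mcrP => t ht Ht; apply/negP => d.
  by apply: h; exists t.
exists t => //; apply: cov_rd' ht _ (hu t ht Ht) dt.
by split; [exact: br_up|exact: ldN_len].
Qed.

Definition mcoset u z := exists2 b, inW H b & z = (u * b)%g.

Lemma coset_len u b : min_coset_reps H u -> inW H b ->
  len (u * b)%g = (len u + len b)%N.
Proof. by move=> /mcrP; exact: rcoset_add. Qed.

Lemma coset_br u z : min_coset_reps H u -> mcoset u z -> u <=b z.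
Proof. by move=> hu [b hb ->]; exact: (br_prefix (coset_len hu hb)). Qed.

(* The minimal representative of a coset is determined by the order alone: it is
   the greatest element of the quotient below the given one. *)
Lemma mcosetP u z : min_coset_reps H u -> mcoset u z <->
  u <=b z /\ (forall u', min_coset_reps H u' -> u' <=b z -> u' <=b u).
Proof.
move=> hu; split=> [cz|[huz hmax]].
  split; first exact: coset_br.
  case: cz => b hb -> u' /mcrP hu'; have [n] := ubnP (len b); elim: n b hb => // n IH b hb hn.
  have [->|ne] := pselect (b = 1%g); first by rewrite mulg1.
  have [t ht dt] := ex_rd ne; have Ht : H t := inW_supp hb ht (rd_le ht dt).
  have lb := rd_len ht dt; have hbt : inW H (b * t)%g by apply: inWM => //; exact: inWs.
  move=> h; apply: (IH (b * t)%g hbt); first by move: lb hn; clear; lia.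
  rewrite wmulA; apply: rlift_up => //; last exact: hu'.
  by apply: rd_suffix dt; exact: coset_len.
have [u0 [b [hb /mcrP h0 e l]]] := rcoset_dec H z.
exists b => //; rewrite e; congr (_ * _)%g; apply: br_anti.
  by apply: hmax => //; rewrite e; apply: br_prefix; exact: coset_len.
move: huz; rewrite e => huz.
have [n] := ubnP (len b); elim: n b hb huz {e l} => // n IH b hb huz hn.
have [e|ne] := pselect (b = 1%g); first by move: huz; rewrite e mulg1.
have [t ht dt] := ex_rd ne; have Ht : H t := inW_supp hb ht (rd_le ht dt).
have lb := rd_len ht dt; have hbt : inW H (b * t)%g by apply: inWM => //; exact: inWs.
apply: (IH (b * t)%g hbt); last by move: lb hn; clear; lia.
rewrite wmulA; apply: rlift_up => //; last by move/mcrP: hu; exact.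
by apply: rd_suffix dt; exact: coset_len.
Qed.

(** Lifting puts [1, v] inside the union of [1, s v] and its translate by [s]. Finiteness is what
    allows the sums over cosets and intervals to be split. *)
Lemma finite_lower v : finite_set [set z | z <=b v].
Proof.
have [n] := ubnP (len v); elim: n v => // n IH v hn.
have [->|ne] := pselect (v = 1%g).
  apply: (@sub_finite_set _ _ [set 1%g]); last exact: finite_set1.
  by move=> z /= h; apply: br_anti => //; exact: br1.
have [s hs ds] := ex_ld ne; have lv := ld_len hs ds.
have F : finite_set [set z | z <=b (s * v)%g] by apply: IH; move: lv hn; clear; lia.
apply: (@sub_finite_set _ _ ([set z | z <=b (s * v)%g] `|`
   [set (s * z)%g | z in [set z | z <=b (s * v)%g]])).
  move=> z /= h; have [d|d] := boolP (ld s z); last by left; exact: lift_up.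
  by right; exists (s * z)%g; rewrite ?simpleK //=; exact: lift_dn.
by rewrite finite_setU; split=> //; exact: finite_image.
Qed.

Definition mcosetle u v : set W := [set z | mcoset u z /\ z <=b v].

Lemma finite_cosetle u v : finite_set (mcosetle u v).
Proof. by apply: sub_finite_set (@finite_lower v) => z []. Qed.

Variable x : {poly int}.
Hypothesis hx : x = -1 \/ x = 'X.

(** The values -1 and 'X are the roots of the Hecke relation x^2 = (q - 1) x + q; the two choices of
    [x] are treated together through it. *)
Lemma x_quadratic : - x * ('X - 1 - x) = 'X.
Proof. by case: hx => ->; ring. Qed.

Definition wt u z : {poly int} := (- x) ^+ (len z - len u).

Definition Dsum u v := \sum_(z \in mcosetle u v) wt u z * Rpol z v.

Lemma Dsum_widen u v v' : v' <=b v ->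
  Dsum u v' = \sum_(z \in mcosetle u v) wt u z * Rpol z v'.
Proof.
move=> hv; apply: fsbig_widen => [z [h1 h2]|z [[h1 h2] h3]].
  by split=> //; exact: br_trans hv.
by rewrite /= Rpol_out ?mulr0 // => h; apply: h3.
Qed.

Lemma Dsum_out u v : min_coset_reps H u -> ~ u <=b v -> Dsum u v = 0.
Proof.
move=> hu h; apply: fsbig1 => z [h1 h2]; case: h.
exact: br_trans (coset_br hu h1) h2.
Qed.

Lemma Dsum_diag v : min_coset_reps H v -> Dsum v v = 1.
Proof.
move=> hv; have -> : Dsum v v = \sum_(z \in [set v]) wt v z * Rpol z v.
  apply: eq_fsbigl; apply/seteqP; split=> [z [h1 h2]|z /= ->].
    by apply: br_anti => //; exact: coset_br.
  by split; [exists 1%g; [exact: inW1|rewrite mulg1]|exact: br_refl].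
by rewrite fsbig_set1 /wt subnn expr0 Rpol_diag mul1r.
Qed.

Lemma mulg_bij s (A B : set W) : simple W s ->
  (forall z, A z -> B (s * z)%g) -> (forall z, B z -> A (s * z)%g) ->
  set_bij A B (fun z => s * z)%g.
Proof.
move=> hs h1 h2; split=> //.
  by move=> z z' _ _ /(congr1 (fun y => s * y)%g); rewrite !simpleK.
by move=> z hz; exists (s * z)%g; rewrite ?simpleK //; exact: h2.
Qed.

Section Step.
Variables (s u v : W).
Hypotheses (hu : min_coset_reps H u) (hs : simple W s) (dv : ld s v).

Lemma Dsum_desc : ld s u -> Dsum u v = Dsum (s * u)%g (s * v)%g.
Proof.
move=> du; have hsu := mcr_desc hu hs du.
have ldz b : inW H b -> ld s (u * b)%g.
  by move=> hb; apply: ld_prefix du; exact: coset_len.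
rewrite /Dsum (@reindex_fsbig _ _ _ _ _ (fun z => s * z)%g (mcosetle (s * u)%g (s * v)%g)).
  apply: eq_fsbigr => z; rewrite inE => -[[b hb e] _].
  have e' : (s * z = u * b)%g by rewrite e -wmulA simpleK.
  have lz : len (s * z)%g = (len z).+1.
    by rewrite e' (ld_len hs (ldz b hb)) -e' simpleK.
  congr (_ * _); first by rewrite /wt lz (ld_len hs du) subSS.
  by rewrite (Rpol_ld _ hs dv) /Tmat up_lmul // e' ldz //= -e' simpleK.
apply: mulg_bij => // z [[b hb e] h]; split.
- by exists b => //; rewrite e -wmulA simpleK.
- by apply: lift_le => //; apply: br_trans h _; exact: br_dn.
- by exists b => //; rewrite e wmulA.
- by apply: lift_dn => //; rewrite e; exact: ldz.
Qed.

Lemma Dsum_asc_in : ~~ ld s u -> min_coset_reps H (s * u)%g ->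
  Dsum u v = ('X - 1) * Dsum u (s * v)%g + 'X * Dsum (s * u)%g (s * v)%g.
Proof.
move=> du hsu; have hsv : (s * v)%g <=b v by exact: br_dn.
have lsu := ldN_len hs du.
have lz b : inW H b -> len (s * (u * b))%g = (len (u * b)%g).+1.
  by move=> hb; rewrite wmulA (coset_len hsu hb) (coset_len hu hb) lsu.
have B : set_bij (mcosetle u v) (mcosetle (s * u)%g v) (fun z => s * z)%g.
  apply: mulg_bij => // z [[b hb e] h]; split; try exact: lift_le.
    by exists b => //; rewrite e wmulA.
  by exists b => //; rewrite e -wmulA simpleK.
rewrite !(Dsum_widen _ hsv) (reindex_fsbig _ _ _ _ B).
rewrite !mulr_fsumr -fsbig_split /=; last exact: finite_cosetle.
apply: eq_fsbigr => z; rewrite inE => -[[b hb e] _].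
have h := lz b hb; rewrite -e in h.
have -> : wt (s * u)%g (s * z)%g = wt u z by rewrite /wt h lsu subSS.
rewrite (Rpol_ld _ hs dv) /Tmat up_lmul //.
have -> : ~~ ld s z by rewrite /ld h -leqNgt leqnSn.
by ring.
Qed.

(** Here [s * u = u * t] with [t] in [H], so left multiplication by [s] permutes the coset of [u].
    Pairing [z] with [s * z] collects the coefficient of each [Rpol z (s * v)], and [x_quadratic]
    turns it into 'X - 1 - x times the weight. *)
Lemma Dsum_asc_out : ~~ ld s u -> ~ min_coset_reps H (s * u)%g ->
  Dsum u v = ('X - 1 - x) * Dsum u (s * v)%g.
Proof.
move=> du nsu; have [t [ht Ht] e] := mcr_asc_out hu hs du nsu.
have hsv : (s * v)%g <=b v by exact: br_dn.
have cs z : mcoset u z -> mcoset u (s * z)%g.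
  case=> b hb ->; exists (t * b)%g; last by rewrite !wmulA e.
  by apply: inWM => //; exact: inWs.
have lc z : mcoset u z -> (len u <= len z)%N by move=> /(coset_br hu)/br_leq.
have B : set_bij (mcosetle u v) (mcosetle u v) (fun z => s * z)%g.
  by apply: mulg_bij => // z [h1 h2]; split; [exact: cs|exact: lift_le|exact: cs|exact: lift_le].
(* [a z] and [c z] are the coefficients of the terms at [z] and at [s * z] in the recursion; after
   reindexing, the coefficient at [z] is [a z + c (s * z)]. *)
pose a z : {poly int} := if ld s z then 0 else wt u z * ('X - 1).
pose c z : {poly int} := wt u z * (if ld s z then 1 else 'X).
have F := finite_cosetle u v.
rewrite (Dsum_widen _ hsv) mulr_fsumr.
transitivity (\sum_(z \in mcosetle u v)
    (a z * Rpol z (s * v)%g + c z * Rpol (s * z)%g (s * v)%g)).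
  apply: eq_fsbigr => z _; rewrite (Rpol_ld _ hs dv) /Tmat up_lmul // /a /c.
  by case: (ld s z) => /=; ring.
rewrite fsbig_split //= [X in _ + X](reindex_fsbig _ _ _ _ B) -fsbig_split //=.
apply: eq_fsbigr => z; rewrite inE => -[cz _]; rewrite simpleK // -mulrDl mulrA; congr (_ * _).
have l1 := lc _ cz; have l2 := lc _ (cs _ cz).
rewrite /a /c ldM //; have [d|d] := boolP (ld s z) => /=.
  have -> : wt u z = wt u (s * z)%g * - x.
    rewrite /wt -exprSr; congr (_ ^+ _); have := ld_len hs d.
    by move: l1 l2; clear; lia.
  by rewrite add0r -{1}x_quadratic; ring.
have -> : wt u (s * z)%g = wt u z * - x.
  by rewrite /wt -exprSr (ldN_len hs d) subSn.
by ring.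
Qed.
End Step.

(* Deodhar's formula. *)
Lemma parabolic_R_sum R u v : is_parabolic_R H x R ->
  min_coset_reps H u -> min_coset_reps H v -> R u v = Dsum u v.
Proof.
move=> HR; have [n] := ubnP (len v); elim: n u v => // n IH u v hn hu hv.
have [uv|nuv] := pselect (u <=b v); last first.
  by rewrite (parabolic_R_out HR) // Dsum_out.
have [->|ne] := pselect (u = v); first by rewrite (parabolic_R_diag HR) // Dsum_diag.
have v1 : v <> 1%g by move=> e; apply: ne; rewrite e in uv *; apply: br_anti => //; exact: br1.
have [s hs ds] := ex_ld v1; have lv := ld_len hs ds.
have hsv := mcr_desc hv hs ds; have dsv : left_descents v s by split.
have IH' u' : min_coset_reps H u' -> R u' (s * v)%g = Dsum u' (s * v)%g.
  by move=> h; apply: IH => //; move: lv hn; clear; lia.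
have [du|du] := boolP (ld s u).
  rewrite (parabolic_R_desc HR hu hv uv ne dsv (conj hs du)) (Dsum_desc hu hs ds du).
  exact/IH'/mcr_desc.
have ndu : ~ left_descents u s by case=> _ h; move: du; rewrite /ld h.
have [hsu|hsu] := pselect (min_coset_reps H (s * u)%g).
  rewrite (parabolic_R_asc_in HR hu hv uv ne dsv ndu hsu) (Dsum_asc_in hu hs ds du hsu).
  by rewrite !IH'.
rewrite (parabolic_R_asc_out HR hu hv uv ne dsv ndu hsu) (Dsum_asc_out hu hs ds du hsu).
by rewrite IH'.
Qed.
End Quotient.

(** * Transport along the isomorphism *)

Lemma poset_iso_lower_iso (W1 W2 : coxeterSystem) (v1 : W1) (v2 : W2) f :
  poset_iso (bruhat_itv 1%g v1) (bruhat_itv 1%g v2) f ->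
  exists g, lower_iso v1 v2 f g.
Proof.
case=> -[fh fi fs] fe.
have [g gP] : exists g : W2 -> W1, forall y, y <=b v2 -> g y <=b v1 /\ f (g y) = y.
  have ch y : exists u, y <=b v2 -> u <=b v1 /\ f u = y.
    (* Outside the interval the inverse map takes the arbitrary value 1. *)
    have [h|h] := pselect (y <=b v2); last by exists 1%g.
    by have [u [_ hu] e] := fs y (conj (br1 y) h); exists u.
  by have [g gP] := choice ch; exists g.
have itv (W : coxeterSystem) (z v : W) : z <=b v -> bruhat_itv 1%g v z.
  by move=> h; split=> //; exact: br1.
have hf u : u <=b v1 -> f u <=b v2 by move=> h; have [] := fh _ (itv _ _ _ h).
have gf u : u <=b v1 -> g (f u) = u.
  move=> h; have [h1 h2] := gP _ (hf _ h).
  by apply: fi => //; rewrite inE; exact: itv.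
exists g; split=> // [u u' h h'|y y' h h'|y h|].
- apply/fe => //; apply: itv => //; exact: br_trans h.
- have hy := br_trans h' h; have [h1 h2] := gP _ h; have [h3 h4] := gP _ hy.
  by apply/(fe _ _ (itv _ _ _ h3) (itv _ _ _ h1)); rewrite h2 h4.
- by have [] := gP _ h.
- have [h1 h2] := gP _ (br_refl v2).
  apply: br_anti; first exact/hf/br_refl.
  rewrite -{1}h2; apply/fe => //; [exact: itv|exact/itv/br_refl].
Qed.

Lemma poset_iso_mcr (W1 W2 : coxeterSystem) (H1 : set W1) (H2 : set W2) v1 v2 f u :
  poset_iso (bruhat_itv 1%g v1) (bruhat_itv 1%g v2) f ->
  poset_iso (parabolic_itv H1 1%g v1) (parabolic_itv H2 1%g v2) f ->
  u <=b v1 -> min_coset_reps H1 u <-> min_coset_reps H2 (f u).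
Proof.
case=> -[fh fi fs] _ [[ph pi ps] _] hu.
have iu : bruhat_itv 1%g v1 u by split=> //; exact: br1.
split=> h; first by have [] := ph _ (conj h iu).
have [u' [h' iu'] e] := ps _ (conj h (fh _ iu)).
by rewrite -(fi u' u) // inE.
Qed.

Section Transport.
Variables (W1 W2 : coxeterSystem) (H1 : set W1) (H2 : set W2).
Variables (v1 : W1) (v2 : W2) (f : W1 -> W2) (g : W2 -> W1).
Hypothesis L : lower_iso v1 v2 f g.
Hypothesis fH : forall u, u <=b v1 -> min_coset_reps H1 u <-> min_coset_reps H2 (f u).
Implicit Types (u w z : W1) (y : W2).

Lemma mcr_lower_iso y : y <=b v2 -> min_coset_reps H2 y -> min_coset_reps H1 (g y).
Proof. by move=> hy h; apply/fH; [exact: (li_gle L)|rewrite (li_fg L)]. Qed.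

Lemma mcoset_lower_iso u z : u <=b v1 -> z <=b v1 -> min_coset_reps H1 u ->
  mcoset H1 u z <-> mcoset H2 (f u) (f z).
Proof.
move=> hu hz mu; have mfu := proj1 (fH hu) mu.
have hfz := li_le L hz.
rewrite mcosetP // mcosetP //; split=> -[h1 h2]; split.
- exact: (li_f L).
- move=> y my hy; have hyv := br_trans hy hfz.
  rewrite -(li_fg L hyv); apply: (li_f L hu); apply: h2; first exact: mcr_lower_iso.
  by rewrite -(li_gf L hz); apply: (li_g L).
- exact: (li_leE L).
- move=> u' mu' hu'; have huv := br_trans hu' hz.
  apply: (li_leE L) => //; apply: h2; first exact/fH.
  exact: (li_f L).
Qed.

Lemma lower_iso_bij w (P : set W1) (Q : set W2) : w <=b v1 ->
  (forall z, z <=b w -> P z <-> Q (f z)) ->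
  set_bij [set z | P z /\ z <=b w] [set y | Q y /\ y <=b f w] f.
Proof.
move=> hw PQ; have Lw := li_res L hw; split.
- by move=> z [h1 h2]; split; [apply/PQ|exact: (li_le Lw)].
- by move=> z z'; rewrite !inE => -[_ h] [_ h']; exact: (li_inj Lw).
- move=> y [h1 h2]; exists (g y); last by rewrite (li_fg Lw).
  by have h := li_gle Lw h2; split=> //; apply/PQ; rewrite ?(li_fg Lw).
Qed.

Variable x : {poly int}.
Hypothesis hx : x = -1 \/ x = 'X.
Variables (R1 : W1 -> W1 -> {poly int}) (R2 : W2 -> W2 -> {poly int}).
Hypotheses (HR1 : is_parabolic_R H1 x R1) (HR2 : is_parabolic_R H2 x R2).
Hypothesis good : dl4 W2 \/ exists a b, dih a b v2.

Lemma parabolic_R_lower_iso u w : u <=b w -> w <=b v1 ->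
  min_coset_reps H1 u -> min_coset_reps H1 w -> R1 u w = R2 (f u) (f w).
Proof.
move=> huw hw mu mw; have hu := br_trans huw hw; have Lw := li_res L hw.
have good' : dl4 W2 \/ exists a b, dih a b (f w).
  case: good => [|[a [b D]]]; [by left|right; exists a, b].
  by apply: inW_le D; exact: (li_le L).
rewrite (parabolic_R_sum hx HR1 mu mw).
rewrite (parabolic_R_sum hx HR2 (proj1 (fH hu) mu) (proj1 (fH hw) mw)).
rewrite /Dsum; have B : set_bij (mcosetle H1 u w) (mcosetle H2 (f u) (f w)) f.
  by apply: lower_iso_bij => // z hz; apply: mcoset_lower_iso => //; exact: br_trans hw.
rewrite (reindex_fsbig _ _ _ _ B); apply: eq_fsbigr => z; rewrite inE => -[_ hz].
rewrite (Rpol_lower_iso Lw good' hz) /wt !(li_len L) //; exact: br_trans hw.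
Qed.

End Transport.

(** * Kazhdan-Lusztig polynomials: uniqueness from the degree bound, and transport *)

Lemma qpow_eval_invE n (p : {poly int}) : (size p <= n.+1)%N ->
  qpow_eval_inv n p = FracField.tofrac (\poly_(i < n.+1) p`_(n - i)).
Proof.
move=> hp; rewrite /qpow_eval_inv; set q := FracField.tofrac _.
have q0 : q != 0 by rewrite /q tofrac_eq0 polyX_eq0.
have hp' : (size (map_poly (intr : int -> {fraction {poly int}}) p) <= n.+1)%N.
  exact: leq_trans (size_poly _ _) hp.
rewrite (horner_coef_wide _ hp') mulr_sumr poly_def rmorph_sum /=.
rewrite (reindex_inj rev_ord_inj); apply: eq_bigr => i _.
rewrite coef_map_id0 //= subSS.
have hi : (i <= n)%N by rewrite -ltnS.
rewrite mulrCA exprVn -exprB ?unitfE ?leq_subr // subKn //.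
rewrite -mul_polyC rmorphM /= rmorphXn /=; congr (_ * _).
by rewrite -[in RHS](intz p`_(n - i)) !rmorph_int.
Qed.

(** With n + 1 the length difference, p - q is invariant under reversal in degree n + 1 but has
    degree at most n / 2. Of two mirror coefficients at least one is therefore zero, hence both
    are. *)
Lemma low_degree_palindrome n (p q a : {poly int}) :
  (2 * (size p).-1 <= n)%N -> (2 * (size q).-1 <= n)%N ->
  qpow_eval_inv n.+1 p = FracField.tofrac (p + a) ->
  qpow_eval_inv n.+1 q = FracField.tofrac (q + a) -> p = q.
Proof.
move=> hp hq; have sz (r : {poly int}) : (2 * (size r).-1 <= n)%N -> (2 * size r <= n.+2)%N.
  by case: (size r); clear; lia.
have {hp}hp := sz p hp; have {hq}hq := sz q hq.
rewrite !qpow_eval_invE; [|by move: hq; clear; lia|by move: hp; clear; lia].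
move=> /eqP; rewrite tofrac_eq => /eqP ep /eqP; rewrite tofrac_eq => /eqP eq.
have c i : (i < n.+2)%N -> p`_i - q`_i = p`_(n.+1 - i) - q`_(n.+1 - i).
  move=> hi; have := congr1 (fun r : {poly int} => r`_i) ep.
  have := congr1 (fun r : {poly int} => r`_i) eq.
  by rewrite !coef_poly !coefD hi => -> ->; rewrite opprD addrACA subrr addr0.
have z i : (n.+1 <= 2 * i)%N -> p`_i - q`_i = 0.
  move=> hi; have hpi : (size p <= i)%N by move: hp hi; clear; lia.
  have hqi : (size q <= i)%N by move: hq hi; clear; lia.
  by rewrite (nth_default _ hpi) (nth_default _ hqi) subrr.
apply/polyP => i; apply/eqP; rewrite -subr_eq0; apply/eqP.
have [hi|hi] := leqP n.+1 (2 * i); first exact: z.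
rewrite c; last by move: hi; clear; lia.
by apply: z; move: hi; clear; lia.
Qed.

Lemma parabolic_itv_split (W : coxeterSystem) (H : set W) (R P : W -> W -> {poly int})
    (u w : W) : u <=b w -> min_coset_reps H u -> R u u = 1 ->
  \sum_(z \in parabolic_itv H u w) R u z * P z w =
  P u w + \sum_(z \in parabolic_itv H u w `\ u) R u z * P z w.
Proof.
move=> huw mu e; rewrite (@fsbigD1 _ _ _ _ u) ?e ?mul1r //.
  by apply: sub_finite_set (@finite_lower _ w) => z [_ []].
by split=> //; split=> //; exact: br_refl.
Qed.

Section TransportP.
Variables (W1 W2 : coxeterSystem) (H1 : set W1) (H2 : set W2).
Variables (v1 : W1) (v2 : W2) (f : W1 -> W2) (g : W2 -> W1).
Hypothesis L : lower_iso v1 v2 f g.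
Hypothesis fH : forall u, u <=b v1 -> min_coset_reps H1 u <-> min_coset_reps H2 (f u).
Variables (R1 P1 : W1 -> W1 -> {poly int}) (R2 P2 : W2 -> W2 -> {poly int}).
Hypotheses (HP1 : is_parabolic_P H1 R1 P1) (HP2 : is_parabolic_P H2 R2 P2).
Hypotheses (dR1 : forall u, min_coset_reps H1 u -> R1 u u = 1)
  (dR2 : forall y, min_coset_reps H2 y -> R2 y y = 1).
Hypothesis eR : forall u w, u <=b w -> w <=b v1 ->
  min_coset_reps H1 u -> min_coset_reps H1 w -> R1 u w = R2 (f u) (f w).

(** Once the term z = u is split off, the rest of the defining sum involves only shorter length
    differences and is preserved by induction; the degree bound then determines the polynomial. *)
Lemma parabolic_P_lower_iso u w : u <=b w -> w <=b v1 ->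
  min_coset_reps H1 u -> min_coset_reps H1 w -> P1 u w = P2 (f u) (f w).
Proof.
have [n] := ubnP (len w - len u); elim: n u => // n IH u hn huw hw mu mw.
have hu := br_trans huw hw; have Lw := li_res L hw.
have mfu := proj1 (fH hu) mu; have mfw := proj1 (fH hw) mw.
have hfuw := li_le Lw huw.
have [e|ne] := pselect (u = w).
  by rewrite e in mfu mu *; rewrite (parabolic_P_diag HP1) // (parabolic_P_diag HP2).
have nef : f u <> f w by move=> e; apply: ne; exact: (li_inj L).
have luw := br_ltn huw ne.
have [k ek] : exists k, (len w - len u)%N = k.+1.
  by exists (len w - len u).-1; move: luw; clear; lia.
have := parabolic_P_inv HP1 mu mw; have := parabolic_P_inv HP2 mfu mfw.
have := parabolic_P_deg HP1 mu mw huw ne; have := parabolic_P_deg HP2 mfu mfw hfuw nef.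
rewrite !(li_len L) // ek subn1 /= !parabolic_itv_split ?dR1 ?dR2 // => d2 d1 i2 i1.
apply: (low_degree_palindrome d1 d2 i1); rewrite i2; congr (FracField.tofrac (_ + _)).
have B : set_bij (parabolic_itv H1 u w `\ u) (parabolic_itv H2 (f u) (f w) `\ f u) f.
  split.
  - move=> z [[mz [uz zw]] /= zu]; have hz := br_trans zw hw.
    split; last by move=> e; apply: zu; exact: (li_inj L).
    by split; [exact/fH|split; [exact: (li_f L)|exact: (li_le Lw)]].
  - move=> z z'; rewrite !inE => -[[_ [_ h]] _] [[_ [_ h']] _]; exact: (li_inj Lw).
  - move=> y [[my [uy yw]] /= yu]; have gyw := li_gle Lw yw.
    have fgy := li_fg Lw yw; exists (g y) => //; split.
      split; first by apply/fH; [exact: br_trans hw|rewrite fgy].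
      by split=> //; apply: (li_leE Lw) => //; rewrite fgy.
    by move=> /= e; apply: yu; rewrite -fgy e.
rewrite (reindex_fsbig _ _ _ _ B); apply: eq_fsbigr => z; rewrite inE => -[[mz [uz zw]] /= zu].
have hz := br_trans zw hw; rewrite eR // IH //.
by have := br_ltn uz (nesym zu); move: (br_leq zw) luw hn; clear; lia.
Qed.
End TransportP.

Theorem theorem5p2 (W1 W2 : coxeterSystem)
    (dl1 : doubly_laced W1 \/ dihedral W1)
    (dl2 : doubly_laced W2 \/ dihedral W2)
    (H1 : set W1) (H2 : set W2)
    (sH1 : H1 `<=` simple W1) (sH2 : H2 `<=` simple W2)
    (v1 : W1) (v2 : W2)
    (v1H1 : min_coset_reps H1 v1) (v2H2 : min_coset_reps H2 v2)
    (iso : exists f : W1 -> W2,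
       poset_iso (bruhat_itv 1%g v1) (bruhat_itv 1%g v2) f /\
       poset_iso (parabolic_itv H1 1%g v1) (parabolic_itv H2 1%g v2) f)
    (x : {poly int}) (hx : x = -1 \/ x = 'X)
    (R1 P1 : W1 -> W1 -> {poly int}) (R2 P2 : W2 -> W2 -> {poly int})
    (R1P : is_parabolic_R H1 x R1) (P1P : is_parabolic_P H1 R1 P1)
    (R2P : is_parabolic_R H2 x R2) (P2P : is_parabolic_P H2 R2 P2) :
  P1 1%g v1 = P2 1%g v2 /\ R1 1%g v1 = R2 1%g v2.
Proof.
have [f [isof isoH]] := iso; have [g L] := poset_iso_lower_iso isof.
have fH u : u <=b v1 -> min_coset_reps H1 u <-> min_coset_reps H2 (f u).
  exact (poset_iso_mcr isof isoH).
have good : dl4 W2 \/ exists a b, dih a b v2.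
  case: dl2 => [/doubly_laced_dl4|/dihedral_dih[a [b D]]]; [by left|right].
  by exists a, b.
have m1 : min_coset_reps H1 1%g by apply/mcrP => s _ _; rewrite rd1.
have eR u w := @parabolic_R_lower_iso _ _ _ _ _ _ _ _ L fH x hx R1 R2 R1P R2P good u w.
rewrite -(li_1 L) -(li_top L); split; last by apply: eR => //; [exact: br1|exact: br_refl].
apply: (parabolic_P_lower_iso L fH P1P P2P _ _ eR) => //; last exact: br_refl.
- exact: parabolic_R_diag R1P.
- exact: parabolic_R_diag R2P.
- exact: br1.
Qed.
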